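(* Let $\mathbb{G}$ be a homogeneous group of homogeneous dimension $Q$ with a homogeneous quasi-norm $|\cdot|$. Let $\phi$ and $\psi$ be positive functions defined on $\mathbb{G}$. Then there exists a positive constant $C$ such that $$\int_{\mathbb{G}}\phi(x)\exp(\mathcal{M}\log f)(x)\,dx\leq C\int_{\mathbb{G}}\psi(x)f(x)\,dx$$ holds for all positive $f$ if and only if $$A:=\sup_{R>0}\,R^{Q}\int_{|x|\geq R}\frac{\phi(x)\exp\left(\mathcal{M}\log\frac{1}{\psi}\right)(x)}{|x|^{2Q}}\,dx<\infty,$$ where $(\mathcal{M}f)(x)=\frac{1}{|B(0,|x|)|}\int_{B(0,|x|)}f(z)\,dz$.
   Context: A homogeneous group $\mathbb{G}$ is a connected simply connected Lie group whose Lie algebra $\mathfrak{g}$ is equipped with a family of dilations $D_\lambda=\mathrm{Exp}(A_0\ln\lambda)$, $\lambda>0$, that are Lie algebra morphisms, where $A_0$ is a diagonalisable linear operator on $\mathfrak{g}$ with positive eigenvalues. The induced dilations on $\mathbb{G}$ are written $x\mapsto\lambda x$, and $Q=\mathrm{Tr}\,A_0$ is the homogeneous dimension. A homogeneous quasi-norm is a continuous function $|\cdot|:\mathbb{G}\to[0,\infty)$ with $|x^{-1}|=|x|$, $|\lambda x|=\lambda|x|$ for $\lambda>0$, and $|x|=0$ if and only if $x=0$. Haar measure is denoted $dx$, $|S|$ denotes the Haar measure of a measurable set $S$, and $B(0,R)=\{z\in\mathbb{G}:|z|<R\}$ is the quasi-ball of radius $R$ centred at the identity element $0$. *)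

(* Defs.v *)
From HB Require Import structures.
From mathcomp Require Import all_boot all_order all_algebra.
From mathcomp Require Import all_classical all_reals all_analysis.

Set Implicit Arguments.
Unset Strict Implicit.
Unset Printing Implicit Defensive.

Import Order.TTheory GRing.Theory Num.Theory.
Import numFieldNormedType.Exports.

Local Open Scope classical_set_scope.
Local Open Scope ring_scope.

(* The distinguished point is only there because [measurableType] is pointed;
   it is not assumed to be the identity [1%g]. *)
HB.mixin Record isTopologicalGroup G of PointedTopological G & Group G := {
  mulg_continuous : continuous (fun p : G * G => (p.1 * p.2)%g) ;
  invg_continuous : continuous (fun x : G => (x^-1)%g)
}.

#[short(type="topologicalGroupType")]
HB.structure Definition TopologicalGroup :=
  {G of isTopologicalGroup G & PointedTopological G & Group G}.

Section Smoothness.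
Context {R : realType} {V W : normedModType R}.

(* For open [U] in finite dimension, all iterated directional derivatives of
   order at most [k] exist and are continuous iff [f] is of class C^k. *)
Fixpoint Ck_on (k : nat) (U : set V) (f : V -> W) : Prop :=
  (forall x, U x -> {for x, continuous f}) /\
  if k is k'.+1 then
    forall v, (forall x, U x -> derivable f x v) /\ Ck_on k' U ('D_v f)
  else True.

Definition smooth_on (U : set V) (f : V -> W) : Prop :=
  forall k, Ck_on k U f.

End Smoothness.

Record chart (R : realType) (n : nat) (T : topologicalType) := Chart {
  cdom : set T ;
  crange : set 'rV[R]_n ;
  cmap : T -> 'rV[R]_n ;
  cinv : 'rV[R]_n -> T ;
  cdom_open : open cdom ;
  crange_open : open crange ;
  cmap_range : forall x, cdom x -> crange (cmap x) ;
  cinv_dom : forall u, crange u -> cdom (cinv u) ;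
  cmapK : forall x, cdom x -> cinv (cmap x) = x ;
  cinvK : forall u, crange u -> cmap (cinv u) = u ;
  cmap_continuous : forall x, cdom x -> {for x, continuous cmap} ;
  cinv_continuous : forall u, crange u -> {for u, continuous cinv}
}.

Section Manifold.
Context {R : realType} {n : nat} {T : topologicalType}.
Implicit Types (c : chart R n T) (atlas : set (chart R n T)).

Definition smooth_atlas atlas : Prop :=
  (forall x, exists2 c, atlas c & cdom c x) /\
  (forall c1 c2, atlas c1 -> atlas c2 ->
    smooth_on [set u | crange c1 u /\ cdom c2 (cinv c1 u)]
              (fun u => cmap c2 (cinv c1 u))).

Definition smooth_map atlas (f : T -> T) : Prop :=
  continuous f /\
  forall c1 c2, atlas c1 -> atlas c2 ->
    smooth_on [set u | crange c1 u /\ cdom c2 (f (cinv c1 u))]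
              (fun u => cmap c2 (f (cinv c1 u))).

Definition smooth_map2 atlas (f : T -> T -> T) : Prop :=
  continuous (fun p : T * T => f p.1 p.2) /\
  forall c1 c2 c3, atlas c1 -> atlas c2 -> atlas c3 ->
    smooth_on [set p : 'rV[R]_n * 'rV[R]_n |
                [/\ crange c1 p.1, crange c2 p.2 &
                    cdom c3 (f (cinv c1 p.1) (cinv c2 p.2))]]
              (fun p => cmap c3 (f (cinv c1 p.1) (cinv c2 p.2))).

End Manifold.

Definition simply_connected (R : realType) (T : topologicalType) : Prop :=
  forall f : R -> T, {within `[0, 1], continuous f} -> f 0 = f 1 ->
  exists H : R * R -> T,
    [/\ {within `[0, 1] `*` `[0, 1], continuous H},
        forall t, t \in `[0, 1] -> H (0, t) = f t,
        forall t, t \in `[0, 1] -> H (1, t) = f 0 &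
        forall s, s \in `[0, 1] -> H (s, 0) = f 0 /\ H (s, 1) = f 0].

Record lieGroup (R : realType) (n : nat) := LieGroup {
  lg_sort :> topologicalGroupType ;
  lg_atlas : set (chart R n lg_sort) ;
  lg_hausdorff : hausdorff_space lg_sort ;
  lg_second_countable : @second_countable lg_sort ;
  lg_smooth_atlas : smooth_atlas lg_atlas ;
  lg_smooth_mul : smooth_map2 lg_atlas (fun x y => (x * y)%g) ;
  lg_smooth_inv : smooth_map lg_atlas (fun x => (x^-1)%g)
}.

(* The Lie algebra T_1 G is identified with R^n through the differential at the
   identity of a chart around it; linear operators are matrices acting on row
   vectors on the right. *)
Section LieAlgebra.
Context {R : realType} {n : nat} {G : topologicalGroupType}.
Variable c : chart R n G.

Let e := cmap c (1%g : G).

(* In coordinates centred at the identity the group law is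
   x + y + lie_bilin x y + O(|(x, y)|^3), so that antisymmetrising lie_bilin
   gives the bracket of left-invariant vector fields. *)
Definition lie_bilin (u v : 'rV[R]_n) : 'rV[R]_n :=
  'D_u (fun x => 'D_v (fun y => cmap c (cinv c x * cinv c y)%g) e) e.

Definition lie_bracket (u v : 'rV[R]_n) : 'rV[R]_n :=
  lie_bilin u v - lie_bilin v u.

Definition lie_algebra_morphism (D : 'M[R]_n) : Prop :=
  forall u v, lie_bracket u v *m D = lie_bracket (u *m D) (v *m D).

Definition differential_at_1 (f : G -> G) (D : 'M[R]_n) : Prop :=
  forall v, 'D_v (fun y => cmap c (f (cinv c y))) e = v *m D.

End LieAlgebra.

Definition expmx (R : realType) (n : nat) (A : 'M[R]_n) : 'M[R]_n :=
  lim (series (fun k => (k`!%:R)^-1 *: A ^+ k) @ \oo).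

Definition lie_dilation (R : realType) (n : nat) (A0 : 'M[R]_n) (lambda : R) :
  'M[R]_n := expmx (ln lambda *: A0).

(* [hg_dil lambda] is the automorphism of G induced by
   [lie_dilation hg_A0 lambda]: since G is connected, it is the only Lie group
   morphism with that differential. *)
Record homogeneousGroup (R : realType) (n : nat) := HomogeneousGroup {
  hg_lie :> lieGroup R n ;
  hg_connected : connected [set: hg_lie] ;
  hg_simply_connected : simply_connected R hg_lie ;
  hg_chart : chart R n hg_lie ;
  hg_chart_atlas : lg_atlas hg_chart ;
  hg_chart_1 : cdom hg_chart (1%g : hg_lie) ;
  hg_A0 : 'M[R]_n ;
  hg_A0_diag : diagonalizable hg_A0 ;
  hg_A0_gt0 : forall a, eigenvalue hg_A0 a -> 0 < a ;
  hg_dilation_morphism : forall lambda, 0 < lambda ->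
    lie_algebra_morphism hg_chart (lie_dilation hg_A0 lambda) ;
  hg_dil : R -> hg_lie -> hg_lie ;
  hg_dilM : forall lambda, 0 < lambda ->
    forall x y, hg_dil lambda (x * y)%g = (hg_dil lambda x * hg_dil lambda y)%g ;
  hg_dil_smooth : forall lambda, 0 < lambda ->
    smooth_map (@lg_atlas _ _ hg_lie) (hg_dil lambda) ;
  hg_dil_diff : forall lambda, 0 < lambda ->
    differential_at_1 hg_chart (hg_dil lambda) (lie_dilation hg_A0 lambda)
}.

Definition homogeneous_dim (R : realType) (n : nat)
  (G : homogeneousGroup R n) : R := \tr (hg_A0 G).

Notation borel T := (g_sigma_algebraType (@open T)).

Definition haar_measure (R : realType) (G : topologicalGroupType)
    (mu : {measure set (borel G) -> \bar R}) : Prop :=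
  [/\ forall (x : G) (S : set (borel G)), measurable S ->
        mu [set (x * y)%g | y in (S : set G)] = mu S,
      forall K : set G, compact K -> (mu K < +oo)%E &
      forall U : set G, open U -> U !=set0 -> (0 < mu U)%E].

Definition quasi_norm (R : realType) (n : nat) (G : homogeneousGroup R n)
    (N : G -> R) : Prop :=
  [/\ continuous N /\ (forall x, 0 <= N x),
      forall x, N (x^-1)%g = N x,
      forall (lambda : R) x, 0 < lambda -> N (hg_dil lambda x) = lambda * N x &
      forall x, N x = 0 <-> x = 1%g].

Definition quasi_ball (R : realType) (G : Type) (N : G -> R) (r : R) : set G :=
  [set z | N z < r].

(* The integral is the library's total one, positive part minus negative part,
   with value -oo when both are infinite. *)
Definition mean (R : realType) (G : ptopologicalType)
    (mu : {measure set (borel G) -> \bar R}) (N : G -> R) (f : G -> R) (x : G)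
    : \bar R :=
  ((mu (quasi_ball N (N x)))^-1 *
    \int[mu]_(z in (quasi_ball N (N x) : set (borel G))) (f z)%:E)%E.

Definition positive_function (R : realType) (G : ptopologicalType) (f : G -> R)
    : Prop :=
  measurable_fun setT (f : borel G -> R) /\ forall x, 0 < f x.

(* Main.v *)
(* Write [Q] for the homogeneous dimension and [V r] for the measure of the
   quasi-ball of radius [r].  The inequality only needs [V r] to be comparable
   with [r^Q], so neither uniqueness of Haar measure nor a Jacobian formula
   enters.  In linear coordinates at the identity diagonalising [A0], the group
   law is Lipschitz, so counting translates of small cubes shows that the
   measure of a small coordinate box is comparable, with universal constants,
   with the product of its sides; a dilation maps a small enough cube
   approximately onto a box with sides [l^(a_i)], and a maximal packing of a
   quasi-ball by translates of such a cube gives [V l ~ l^Q].  Quasi-balls are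
   relatively compact because some dilation contracts a neighbourhood of the
   identity, hence (by connectedness) every point, to the identity; that
   dilations of parameters [l] and [1/l] are inverse to each other follows from
   the uniqueness of a Lie group morphism with given differential.

   If the supremum is finite, write [g = psi f] and [w z = (|z|/|x|)^Q].  On the
   ball of radius [|x|] the mean of [ln (1/w)] is bounded independently of [x],
   so Jensen's inequality for [g w] bounds [exp (M ln f) (x)] by a multiple of
   [exp (M ln (1/psi)) (x) * |x|^(-2Q)] times the integral of [|z|^Q g z] over
   that ball, and Tonelli's theorem concludes.  Conversely, test the inequality
   on [f z = r^Q / (psi z * max(r, |z|)^(2Q))]: on the ball of radius
   [|x| >= r] one has [psi f >= r^Q |x|^(-2Q)], and the integral of [psi f] is
   bounded independently of [r]. *)

Require Import Defs.
From HB Require Import structures.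
From mathcomp Require Import all_boot all_order all_algebra.
From mathcomp Require Import all_classical all_reals all_analysis.
From mathcomp Require Import measurable_realfun lra ring.
Import Order.TTheory GRing.Theory Num.Theory.
Import numFieldNormedType.Exports.
Local Open Scope classical_set_scope.
Local Open Scope ring_scope.

Set Implicit Arguments.
Unset Strict Implicit.
Unset Printing Implicit Defensive.

(** * Increments of C^1 maps *)

(** Two obstacles shape the proof. A dilation is known near the identity only through its
    differential there, and the cube on which this linearisation is accurate depends on the
    parameter [l], with no control as [l] varies. Every comparison of measures therefore needs a
    constant independent both of [l] and of the size of the cube. Boxes are compared through
    translates of a common small cube whose radius cancels, and quasi-balls through the number of
    centres of a packing, which a dilation preserves.

    Secondly, neither [ln f] nor [ln (1 / psi)] is assumed integrable on balls, so the means may be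
    infinite or of the form oo - oo. Jensen's inequality is therefore used in pointwise form: the
    tangent to [ln] at the mean of g w bounds [ln f] by [ln (1 / psi)] plus an integrable function.
    Signed integrals are then only compared under pointwise inequalities or shifted by integrable
    functions, and both operations are safe for infinite values. *)

Lemma rV_norm_leP (R : realType) (m : nat) (x : 'rV[R]_m) (e : R) :
  0 <= e -> (`|x| <= e) <-> (forall j, `|x ord0 j| <= e).
Proof.
move=> e0; rewrite {1}/Num.norm /= mx_normrE; split=> [/bigmax_leP[_ H] j|H].
  exact: (H (ord0, j)).
by apply/bigmax_leP; split=> // -[i j] _ /=; rewrite ord1.
Qed.

Lemma rV_norm_ltP (R : realType) (m : nat) (x : 'rV[R]_m) (e : R) :
  0 < e -> (`|x| < e) <-> (forall j, `|x ord0 j| < e).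
Proof.
move=> e0; rewrite {1}/Num.norm /= mx_normrE; split=> [/bigmax_ltP[_ H] j|H].
  exact: (H (ord0, j)).
by apply/bigmax_ltP; split=> // -[i j] _ /=; rewrite ord1.
Qed.

Lemma rV_norm_coord (R : realType) (m : nat) (x : 'rV[R]_m) j :
  `|x ord0 j| <= `|x|.
Proof. by move: j; apply: (iffLR (rV_norm_leP x (normr_ge0 x))). Qed.

(** The mean value theorem holds for scalar functions only, but row vectors carry the maximum norm,
    so applying it to each coordinate loses no constant. *)
Lemma increment_line (R : realType) (V : normedModType R) (m : nat)
    (f : V -> 'rV[R]_m) (p b : V) (L : 'rV[R]_m) (t eps : R) :
  (forall s, `|s| <= `|t| ->
     derivable f (p + s *: b) b /\ `|'D_b f (p + s *: b) - L| <= eps) ->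
  `|f (p + t *: b) - f p - t *: L| <= `|t| * eps.
Proof.
move=> H.
have eps0 : 0 <= eps.
  have [|_] := H 0; first by rewrite normr0.
  exact: le_trans.
apply: (iffRL (rV_norm_leP _ (mulr_ge0 (normr_ge0 t) eps0))) => j.
pose g s : R := f (p + s *: b) ord0 j - s * L ord0 j.
have gE : (f (p + t *: b) - f p - t *: L) ord0 j = g t - g 0.
  by rewrite /g !mxE scale0r addr0 mul0r subr0 addrAC.
rewrite gE.
pose dg s := 'D_b f (p + s *: b) ord0 j - L ord0 j.
have dgP s : `|s| <= `|t| -> is_derive s (1 : R) g (dg s).
  move=> /H [df _].
  have /derivableP df1 := df.
  pose fj s := f (p + s *: b) ord0 j.
  have cf : (fun h => h^-1 *: (fj (h *: 1 + s) - fj s)) @ 0^' -->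
      'D_b f (p + s *: b) ord0 j.
    have -> : (fun h => h^-1 *: (fj (h *: 1 + s) - fj s)) =
        (fun M : 'rV[R]_m => M ord0 j) \o
        (fun h => h^-1 *: (f (h *: b + (p + s *: b)) - f (p + s *: b))).
      apply/funext => h /=; rewrite !mxE; congr (_ * (f _ _ _ - _)).
      by rewrite [h%:A]mulr1 scalerDl addrCA.
    by apply: cvg_comp; [exact: df | exact: coord_continuous].
  have dcf : is_derive s (1 : R) (fun s => f (p + s *: b) ord0 j) ('D_b f (p + s *: b) ord0 j).
    apply: DeriveDef; first by apply/cvg_ex; eexists; exact: cf.
    by apply: cvg_lim => //; exact: cf.
  rewrite /g /dg.
  apply: is_deriveB.
  by apply: is_derive_eq; rewrite scaler0 add0r [_%:A]mulr1.
have main a c : a < c -> (forall s, s \in `[a, c] -> `|s| <= `|t|) ->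
    `|g c - g a| <= (c - a) * eps.
  move=> ac sub.
  have [||x xac ->] := @MVT R g dg a c ac.
  - by move=> x /subset_itv_oo_cc /sub; exact: dgP.
  - apply: derivable_within_continuous => x /sub xt.
    by have [] := dgP x xt.
  have /H [_ Hx] := sub x (subset_itv_oo_cc xac).
  rewrite normrM mulrC (gtr0_norm (_ : 0 < c - a)) ?subr_gt0//.
  apply: ler_wpM2l; first by rewrite subr_ge0 ltW.
  apply: le_trans _ Hx; rewrite /dg.
  have -> : 'D_b f (p + x *: b) ord0 j - L ord0 j = ('D_b f (p + x *: b) - L) ord0 j by rewrite !mxE.
  exact: rV_norm_coord.
have [t0|t0|->] := ltgtP t 0.
- rewrite distrC (ltr0_norm t0) -[- t]add0r.
  apply: main => // s; rewrite in_itv/= => /andP[ts s0].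
  by rewrite (ltr0_norm t0) ler0_norm// lerN2.
- rewrite (gtr0_norm t0) -[X in _ <= X * _](subr0 t); apply: main => // s.
  by rewrite in_itv/= => /andP[s0 st]; rewrite (gtr0_norm t0) ger0_norm.
by rewrite subrr !normr0 mul0r.
Qed.

(** The directions are followed one after the other. The base point [p] moves during the induction
    while [p0] and [rad] stay fixed; the bound on the sum of the [|t i|] keeps the whole broken path
    inside the ball. *)
Lemma increment_span (R : realType) (V : normedModType R) (m : nat) (I : Type)
    (f : V -> 'rV[R]_m) (b : I -> V) (L : I -> 'rV[R]_m) (p0 : V)
    (rad eps : R) (r : seq I) (t : I -> R) (p : V) :
  (forall i, `|b i| <= 1) ->
  (forall i x, `|x - p0| < rad ->
     derivable f x (b i) /\ `|'D_(b i) f x - L i| <= eps) ->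
  `|p - p0| + \sum_(i <- r) `|t i| < rad ->
  `|f (p + \sum_(i <- r) t i *: b i) - f p - \sum_(i <- r) t i *: L i| <=
     (\sum_(i <- r) `|t i|) * eps.
Proof.
move=> b1 H; elim: r p => [|i r IH] p.
  by rewrite !big_nil !addr0 !subrr normr0 mul0r.
rewrite !big_cons => Hp.
have sum0 : 0 <= \sum_(j <- r) `|t j| by apply: sumr_ge0.
have tb (s : R) : `|s| <= `|t i| -> `|p + s *: b i - p0| <= `|p - p0| + `|t i|.
  move=> st; rewrite addrAC (le_trans (ler_normD _ _))// lerD2l normrZ.
  by rewrite (le_trans _ st)// ler_piMr.
have H1 : `|f (p + t i *: b i) - f p - t i *: L i| <= `|t i| * eps.
  apply: increment_line => s st; apply: H.
  by rewrite (le_lt_trans (tb _ st))// (le_lt_trans _ Hp)// lerD2l lerDl.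
have H2 : `|p + t i *: b i - p0| + \sum_(j <- r) `|t j| < rad.
  by rewrite (le_lt_trans _ Hp)// addrA lerD2r tb.
have {}H2 := IH _ H2.
rewrite mulrDl; apply: le_trans (lerD H1 H2).
apply: le_trans (ler_normD _ _); rewrite le_eqVlt; apply/orP; left; apply/eqP.
congr (`|_|); rewrite addrA.
set A := f (p + t i *: b i + _); set B := f (p + _); set C := f p.
by apply/rowP => k; rewrite !mxE; ring.
Qed.

Lemma ler_term_sum (R : realType) (I : finType) (F : I -> R) (i : I) :
  (forall j, 0 <= F j) -> F i <= \sum_j F j.
Proof. by move=> F0; rewrite (bigD1 i)//= lerDl sumr_ge0. Qed.

Lemma smooth_near (R : realType) (V W : normedModType R) (I : finType)
    (U : set V) (f : V -> W) (b : I -> V) (p0 : V) (eps : R) :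
  open U -> U p0 -> smooth_on U f -> 0 < eps ->
  exists2 rad : R, 0 < rad & forall i x, `|x - p0| < rad ->
    derivable f x (b i) /\ `|'D_(b i) f x - 'D_(b i) f p0| <= eps.
Proof.
move=> oU Up0 sf eps0.
have : \forall x \near p0, forall i : I,
    derivable f x (b i) /\ `|'D_(b i) f x - 'D_(b i) f p0| <= eps.
  apply: filter_forall => i.
  have [_ /(_ (b i)) [df [cdf _]]] := sf 1%N.
  have cdf0 := cdf _ Up0.
  near=> x; split.
    apply: df; near: x; exact: open_nbhs_nbhs.
  apply: ltW; rewrite distrC; near: x.
  by move/cvgr_dist_lt : cdf0; apply.
move=> /nbhs_normP[rad /= rad0 H]; exists rad => // i x xp0.
by apply: (H x); rewrite /= distrC.
Unshelve. all: by end_near. Qed.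

Lemma norm_delta_mx_le1 (R : realType) (n : nat) (i : 'I_n) :
  `|delta_mx ord0 i : 'rV[R]_n| <= 1.
Proof.
apply: (iffRL (rV_norm_leP _ ler01)) => j; rewrite mxE eqxx/=.
by case: eqP; rewrite ?normr1// normr0.
Qed.

Lemma sum_coord_le (R : realType) (n : nat) (u : 'rV[R]_n) :
  \sum_(i < n) `|u ord0 i| <= n%:R * `|u|.
Proof.
apply: (le_trans (y := \sum_(i < n) `|u|)).
  by apply: ler_sum => i _; exact: rV_norm_coord.
by rewrite sumr_const card_ord mulr_natl.
Qed.

(** Smoothness is defined by directional derivatives; following the basis directions recovers a
    total differential from their continuity. *)
Lemma smooth_differential (R : realType) (n m : nat) (U : set 'rV[R]_n)
    (f : 'rV[R]_n -> 'rV[R]_m) (p0 : 'rV[R]_n) (D : 'M[R]_(n, m)) (eps : R) :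
  open U -> U p0 -> smooth_on U f -> (forall v, 'D_v f p0 = v *m D) ->
  0 < eps ->
  exists2 rad : R, 0 < rad & forall h, `|h| < rad ->
    `|f (p0 + h) - f p0 - h *m D| <= eps * `|h|.
Proof.
move=> oU Up0 sf fD eps0.
have n1 : 0 < n%:R + 1 :> R by rewrite ltr_wpDl.
have [rad rad0 H] := smooth_near (fun i : 'I_n => delta_mx ord0 i : 'rV[R]_n)
  oU Up0 sf (divr_gt0 eps0 n1).
(* A path along the axes is at most [n] times as long as its maximum norm; [n + 1] stays positive
   for [n = 0]. *)
exists (rad / (n%:R + 1)) => [|h hrad]; first exact: divr_gt0.
have sh : \sum_(i < n) `|h ord0 i| <= (n%:R + 1) * `|h|.
  by rewrite (le_trans (sum_coord_le h))// ler_wpM2r// lerDl.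
have := increment_span (r := index_enum 'I_n) (t := fun i => h ord0 i)
  (p := p0) (@norm_delta_mx_le1 R n) H.
rewrite subrr normr0 add0r -row_sum_delta.
have -> : \sum_i h ord0 i *: 'D_(delta_mx ord0 i) f p0 = h *m D.
  rewrite {2}(row_sum_delta h) mulmx_suml; apply: eq_bigr => i _.
  by rewrite fD scalemxAl.
move=> H1; apply: (le_trans (H1 _)).
  by rewrite (le_lt_trans sh)// mulrC -ltr_pdivlMr.
rewrite mulrCA; apply: ler_wpM2l; first exact: ltW.
by rewrite ler_pdivrMr// mulrC.
Qed.

(** [increment_span] is applied with zero in place of the derivatives, so that its error term
    becomes a bound [M] on the derivatives themselves; the first argument is moved, then the
    second. *)
Lemma smooth_lipschitz (R : realType) (n m : nat)
    (U : set ('rV[R]_n * 'rV[R]_n))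
    (f : 'rV[R]_n * 'rV[R]_n -> 'rV[R]_m) (p0 : 'rV[R]_n * 'rV[R]_n) :
  open U -> U p0 -> smooth_on U f ->
  exists C rad : R, [/\ 0 < C, 0 < rad & forall u v u' v',
    `|u - p0.1| < rad -> `|u' - p0.1| < rad ->
    `|v - p0.2| < rad -> `|v' - p0.2| < rad ->
    `|f (u, v) - f (u', v')| <= C * (`|u - u'| + `|v - v'|)].
Proof.
move=> oU Up0 sf.
pose b1 (i : 'I_n) : 'rV[R]_n * 'rV[R]_n := (delta_mx ord0 i, 0).
pose b2 (i : 'I_n) : 'rV[R]_n * 'rV[R]_n := (0, delta_mx ord0 i).
have b11 i : `|b1 i| <= 1.
  by rewrite prod_normE/= normr0 ge_max norm_delta_mx_le1 ler01.
have b21 i : `|b2 i| <= 1.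
  by rewrite prod_normE/= normr0 ge_max norm_delta_mx_le1 ler01.
have [r1 r10 H1] := smooth_near b1 oU Up0 sf ltr01.
have [r2 r20 H2] := smooth_near b2 oU Up0 sf ltr01.
pose M := 1 + \sum_i `|'D_(b1 i) f p0| + \sum_i `|'D_(b2 i) f p0|.
have M0 : 0 < M by rewrite /M -addrA ltr_pwDl// addr_ge0// sumr_ge0.
have n1 : 0 < n%:R + 1 :> R by rewrite ltr_wpDl.
have Hb (b : 'I_n -> 'rV[R]_n * 'rV[R]_n) (r : R) :
   1 + \sum_i `|'D_(b i) f p0| <= M ->
   (forall i x, `|x - p0| < r ->
    derivable f x (b i) /\ `|'D_(b i) f x - 'D_(b i) f p0| <= 1) ->
   forall i x, `|x - p0| < r -> derivable f x (b i) /\ `|'D_(b i) f x - 0| <= M.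
  move=> bM H i x /H-/(_ i) [? Hx]; split=> //; rewrite subr0.
  apply: le_trans bM; rewrite -(subrK ('D_(b i) f p0) ('D_(b i) f x)).
  apply: le_trans (ler_normD _ _) _; apply: lerD; first exact: Hx.
  exact: (ler_term_sum i (fun j => normr_ge0 ('D_(b j) f p0))).
have {}H1 := Hb _ _ _ H1.
have {}H2 := Hb _ _ _ H2.
have {}H1 := H1 ltac:(by rewrite /M lerDl sumr_ge0).
have {}H2 := H2 ltac:(by rewrite /M addrAC lerDl sumr_ge0).
exists ((n%:R + 1) * M).
pose rad := Num.min r1 r2.
have rad0 : 0 < rad by rewrite lt_min r10.
(* This radius [del] satisfies [del + (n + 1) * (2 * del) = rad]: distance of the starting point
   plus length of a path between two points less than [2 * del] apart. *)
exists (rad / (2 * (n%:R + 1) + 1)).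
have d0 : 0 < 2 * (n%:R + 1) + 1 :> R.
  by rewrite addr_gt0// mulr_gt0.
split; [exact: mulr_gt0|exact: divr_gt0|].
set del := rad / _.
have del0 : 0 < del by rewrite divr_gt0.
have radE : rad = del + (n%:R + 1) * (2 * del).
  by rewrite /del; field; rewrite gt_eqF.
move=> u v u' v' hu hu' hv hv'.
have sh (x y w : 'rV[R]_n) : `|x - w| < del -> `|y - w| < del ->
    \sum_(i < n) `|(x - y) ord0 i| <= (n%:R + 1) * `|x - y| /\
    (n%:R + 1) * `|x - y| < (n%:R + 1) * (2 * del).
  move=> xw yw; split.
    by rewrite (le_trans (sum_coord_le _))// ler_wpM2r// lerDl.
  rewrite ltr_pM2l//; rewrite (_ : x - y = (x - w) - (y - w)); last first.
    by rewrite opprB addrA subrK.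
  by rewrite (le_lt_trans (ler_normB _ _))// [2 * _]mulrDl !mul1r ltrD.
have pn (x y : 'rV[R]_n) : `|x - p0.1| < del -> `|y - p0.2| < del ->
    `|(x, y) - p0| < del.
  by move=> ? ?; rewrite prod_normE gt_max; apply/andP.
have L0 (w : 'rV[R]_n) : \sum_i w ord0 i *: (0 : 'rV[R]_m) = 0.
  by apply: big1 => i _; rewrite scaler0.
have E1 : `|f (u, v) - f (u', v)| <= (n%:R + 1) * M * `|u - u'|.
  have [sh1 sh2] := sh _ _ _ hu hu'.
  have := increment_span (r := index_enum 'I_n) (t := fun i => (u - u') ord0 i)
   (p := (u', v)) b11 H1.
  have -> : (u', v) + \sum_i (u - u') ord0 i *: b1 i = (u, v).
    rewrite -[in RHS](subrK u' u) {2}(row_sum_delta (u - u')).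
    rewrite /b1; apply/pair_equal_spec; split => /=.
      rewrite addrC; congr (_ + _).
      by rewrite (raddf_sum fst).
    by rewrite (raddf_sum snd)/= big1 ?addr0// => i _; rewrite scaler0.
  rewrite L0 subr0.
  move=> H; apply: le_trans (H _) _.
    rewrite (lt_le_trans (y := rad)) ?ge_min ?lexx// radE ltrD// ?pn//.
    exact: le_lt_trans sh2.
  by rewrite mulrAC; apply: ler_wpM2r => //; exact: ltW.
have E2 : `|f (u', v) - f (u', v')| <= (n%:R + 1) * M * `|v - v'|.
  have [sh1 sh2] := sh _ _ _ hv hv'.
  have := increment_span (r := index_enum 'I_n) (t := fun i => (v - v') ord0 i)
   (p := (u', v')) b21 H2.
  have -> : (u', v') + \sum_i (v - v') ord0 i *: b2 i = (u', v).
    rewrite -[in RHS](subrK v' v) {2}(row_sum_delta (v - v')).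
    rewrite /b2; apply/pair_equal_spec; split => /=.
      by rewrite (raddf_sum fst)/= big1 ?addr0// => i _; rewrite scaler0.
    rewrite addrC; congr (_ + _).
    by rewrite (raddf_sum snd).
  rewrite L0 subr0.
  move=> H; apply: le_trans (H _) _.
    rewrite (lt_le_trans (y := rad)) ?ge_min ?lexx ?orbT// radE ltrD// ?pn//.
    exact: le_lt_trans sh2.
  by rewrite mulrAC; apply: ler_wpM2r => //; exact: ltW.
rewrite mulrDr -(subrK (f (u', v)) (f (u, v))) -addrA.
by rewrite (le_trans (ler_normD _ _))// lerD.
Qed.

(** * Exponentials of diagonalisable matrices *)

Lemma expr_conjmx (R : realType) (n : nat) (P D : 'M[R]_n) (k : nat) :
  P \in unitmx ->
  (invmx P *m D *m P) ^+ k = invmx P *m (D ^+ k) *m P.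
Proof.
move=> Pu; elim: k => [|k IH]; first by rewrite !expr0 mulmx1 mulVmx.
rewrite !exprS IH -!mulmxE !mulmxA; congr (_ *m _ *m _).
by rewrite mulmxK.
Qed.

Lemma expr_diag_mx (R : realType) (n : nat) (d : 'rV[R]_n) (k : nat) :
  diag_mx d ^+ k = diag_mx (\row_i d ord0 i ^+ k).
Proof.
elim: k => [|k IH].
  by rewrite expr0; apply/matrixP => i j; rewrite !mxE expr0.
rewrite exprS IH -mulmxE mul_diag_mx; apply/matrixP => i j; rewrite !mxE exprS.
by case: (i == j); rewrite ?mulr1n// !mulr0n mulr0.
Qed.

(** The partial sums are combinations of the fixed matrices [E i] whose coefficients are partial
    sums of scalar exponential series, so the limit reduces to [n] scalar limits. *)
Lemma expmx_conj_diag (R : realType) (n : nat) (P : 'M[R]_n) (d : 'rV[R]_n) :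
  P \in unitmx ->
  expmx (invmx P *m diag_mx d *m P) =
  invmx P *m diag_mx (\row_i expR (d ord0 i)) *m P.
Proof.
move=> Pu.
pose E i : 'M[R]_n := invmx P *m delta_mx i i *m P.
have conjE (c : 'rV[R]_n) :
    invmx P *m diag_mx c *m P = \sum_i c ord0 i *: E i.
  rewrite diag_mx_sum_delta mulmx_sumr mulmx_suml; apply: eq_bigr => i _.
  by rewrite -scalemxAr -scalemxAl.
have serE : series (fun k => (k`!%:R)^-1 *: (invmx P *m diag_mx d *m P) ^+ k) =
    (fun m => \sum_i series (exp_coeff (d ord0 i)) m *: E i).
  apply/funext => m; rewrite /series/=.
  transitivity (\sum_(0 <= k < m) \sum_i exp_coeff (d ord0 i) k *: E i).
    apply: eq_bigr => k _.
    rewrite expr_conjmx// expr_diag_mx conjE scaler_sumr; apply: eq_bigr => i _.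
    by rewrite scalerA /exp_coeff/= mxE mulrC.
  by rewrite exchange_big; apply: eq_bigr => i _; rewrite scaler_suml.
rewrite /expmx serE conjE; apply: cvg_lim; first exact: norm_hausdorff.
apply: cvg_big; first exact: add_continuous.
move=> i _; apply: cvgZr_tmp; rewrite mxE; exact: is_cvg_series_exp_coeff.
Qed.

Lemma mulmx_bound (R : realType) (n m : nat) (P : 'M[R]_(n, m)) :
  exists2 K : R, 0 < K & forall u : 'rV[R]_n, `|u *m P| <= K * `|u|.
Proof.
have M0 : 0 <= \sum_i \sum_j `|P i j|.
  by apply: sumr_ge0 => i _; apply: sumr_ge0.
exists (1 + \sum_i \sum_j `|P i j|) => [|u]; first by rewrite ltr_pwDl.
apply: (iffRL (rV_norm_leP _ _)) => [|j]; first by rewrite mulr_ge0// addr_ge0.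
rewrite mxE (le_trans (ler_norm_sum _ _ _))// mulrDl mul1r.
rewrite ler_wpDl// mulr_suml; apply: ler_sum => i _.
rewrite normrM mulrC; apply: ler_pM => //; last exact: rV_norm_coord.
exact: (ler_term_sum j (fun j => normr_ge0 (P i j))).
Qed.

Lemma mulmx_continuous (R : realType) (n m : nat) (P : 'M[R]_(n, m)) :
  continuous (fun u : 'rV[R]_n => u *m P).
Proof.
have [K K0 HK] := mulmx_bound P.
move=> u; suff : (fun v => v *m P) v @[v --> nbhs u] --> u *m P by [].
apply/cvgrPdist_lt => eps eps0; near=> v.
rewrite -mulmxBl (le_lt_trans (HK _))// -ltr_pdivlMl//; near: v.
by apply: cvgr_dist_lt; [exact: cvg_id|rewrite mulr_gt0// invr_gt0].
Unshelve. all: by end_near. Qed.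

Lemma affine_continuous (R : realType) (n m : nat) (P : 'M[R]_(n, m)) e :
  continuous (fun u : 'rV[R]_n => u *m P + e).
Proof.
move=> u; suff : (fun v => v *m P + e) v @[v --> nbhs u] --> u *m P + e by [].
by apply: cvgD; [exact: mulmx_continuous|exact: cvg_cst].
Qed.

(** * Local coordinates on a Lie group *)

Lemma open_restrict_preimage (S T : topologicalType) (A : set S) (B : set T)
    (f : S -> T) :
  open A -> open B -> (forall x, A x -> {for x, continuous f}) ->
  open [set x | A x /\ B (f x)].
Proof.
move=> oA oB cf; rewrite openE => x [Ax Bx].
apply: filterI; first exact: open_nbhs_nbhs.
exact: (cf x Ax _ (open_nbhs_nbhs (conj oB Bx))).
Qed.

Section TopologicalGroupFacts.
Variable G : topologicalGroupType.

Lemma mulg_cvg2 (T : Type) (F : set_system T) (f g : T -> G) (a b : G) :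
  Filter F -> f @ F --> a -> g @ F --> b -> (f x * g x)%g @[x --> F] --> (a * b)%g.
Proof.
move=> FF fa gb.
by apply: continuous2_cvg => //; exact: (@mulg_continuous G (a, b)).
Qed.

Lemma mulg3_nbhs1 (W : set G) : nbhs (1%g : G) W ->
  exists2 V : set G, nbhs (1%g : G) V &
    forall z p q, V z -> V p -> V q -> W (z * p * q)%g.
Proof.
move=> W1.
have : \forall zpq \near (((1%g : G), (1%g : G)), (1%g : G)),
    W (zpq.1.1 * zpq.1.2 * zpq.2)%g.
  have /(_ W) : (zpq.1.1 * zpq.1.2 * zpq.2)%g
      @[zpq --> (((1%g : G), (1%g : G)), (1%g : G))] --> (1%g * 1%g * 1%g : G)%g.
    apply: mulg_cvg2; last exact: cvg_snd.
    by apply: mulg_cvg2; apply: cvg_comp cvg_fst _; [exact: cvg_fst|exact: cvg_snd].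
  by rewrite !mulg1; apply.
move=> [[A B] [/= [[A1 A2] [/= A11 A21] A12] B1] AB].
exists (A1 `&` A2 `&` B); first by apply: filterI => //; exact: filterI.
move=> z p q [[z1 _] _] [[_ p2] _] [_ q3].
by apply: (AB ((z, p), q)); split => //=; apply: A12.
Qed.

Lemma lmul_continuous (x : G) : continuous (fun y : G => (x * y)%g).
Proof. by move=> y; apply: mulg_cvg2; [exact: cvg_cst|exact: cvg_id]. Qed.

Lemma lmul_open (x : G) (U : set G) : open U -> open [set (x * y)%g | y in U].
Proof.
move=> oU.
have -> : [set (x * y)%g | y in U] = (fun y => (x^-1 * y)%g) @^-1` U.
  apply/seteqP; split=> [_ [y Uy <-]|y /= Uy]; first by rewrite /= mulKg.
  by exists (x^-1 * y)%g => //; rewrite mulVKg.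
by apply: open_comp => // y _; exact: lmul_continuous.
Qed.

(** All cosets of [H] are open, so [H] is open and closed. It is applied to the set where two
    homomorphisms agree and to the set of points contracted to the identity. *)
Lemma connected_open_subgroup (H : set G) :
  connected [set: G] -> (forall x y, H x -> H y -> H (x * y)%g) ->
  (forall x, H x -> H x^-1%g) -> nbhs (1%g : G) H -> forall x, H x.
Proof.
move=> cG HM HV H1 x.
have H1' : H 1%g by exact: nbhs_singleton.
have trans (y : G) : nbhs y [set (y * z)%g | z in H].
  have -> : [set (y * z)%g | z in H] = (fun w => (y^-1 * w)%g) @^-1` H.
    apply/seteqP; split=> [_ [w Hw <-]|w /= Hw]; first by rewrite /= mulKg.
    by exists (y^-1 * w)%g => //; rewrite mulVKg.
  by apply: (@lmul_continuous (y^-1)%g y); rewrite mulVg.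
have oH : open H.
  rewrite openE => y Hy; apply: filterS (trans y) => _ [z Hz <-]; exact: HM.
have cH : closed H.
  rewrite -openC openE => y nHy; apply: filterS (trans y) => _ [z Hz <-] Hyz.
  by apply: nHy; rewrite -(mulgK z y); apply: HM => //; exact: HV.
have -> : H = [set: G].
  by apply: cG; [exists 1%g|exists H => //; rewrite setTI|exists H => //; rewrite setTI].
by [].
Qed.

End TopologicalGroupFacts.

(* Coordinates centred at the identity in which the group law is Lipschitz;
   they are total functions, meaningful only on [lc_dom] and on the ball of
   radius [lc_rad]. *)
Record local_coords (R : realType) (n : nat) (G : topologicalGroupType) :=
    LocalCoords {
  lc_dom : set G ;
  lc_map : G -> 'rV[R]_n ;
  lc_inv : 'rV[R]_n -> G ;
  lc_rad : R ;
  lc_lip : R ;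
  lc_rad_gt0 : 0 < lc_rad ;
  lc_lip_ge1 : 1 <= lc_lip ;
  lc_dom_open : open lc_dom ;
  lc_dom1 : lc_dom 1%g ;
  lc_map1 : lc_map 1%g = 0 ;
  lc_mapK : forall x, lc_dom x -> lc_inv (lc_map x) = x ;
  lc_inv_dom : forall u, `|u| < lc_rad -> lc_dom (lc_inv u) ;
  lc_invK : forall u, `|u| < lc_rad -> lc_map (lc_inv u) = u ;
  lc_map_continuous : forall x, lc_dom x -> {for x, continuous lc_map} ;
  lc_inv_continuous : forall u, `|u| < lc_rad -> {for u, continuous lc_inv} ;
  lc_lipP : forall z p p' q,
    lc_dom z -> `|lc_map z| < lc_rad -> lc_dom p -> `|lc_map p| < lc_rad ->
    lc_dom p' -> `|lc_map p'| < lc_rad -> lc_dom q -> `|lc_map q| < lc_rad ->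
    lc_dom (z * p * q)%g /\
    `|lc_map (z * p * q)%g - lc_map (z * p' * q)%g| <=
      lc_lip * `|lc_map p - lc_map p'|
}.

Definition cube (R : realType) (n : nat) (G : topologicalGroupType)
    (K : local_coords R n G) (s : R) : set G :=
  [set x | lc_dom K x /\ `|lc_map K x| < s].

Lemma cube_base (R : realType) (n : nat) (G : topologicalGroupType)
    (K : local_coords R n G) (W : set G) : nbhs (1%g : G) W ->
  exists s : R, [/\ 0 < s, s <= lc_rad K & cube K s `<=` W].
Proof.
move=> W1.
have i0 : lc_inv K 0 = 1%g by rewrite -(lc_map1 K) lc_mapK//; exact: lc_dom1.
have : \forall u \near (0 : 'rV[R]_n), W (lc_inv K u).
  apply: (@lc_inv_continuous _ _ _ K 0); first by rewrite normr0 lc_rad_gt0.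
  by rewrite i0.
move=> /nbhs_normP[s0 /= s00 Hs0].
exists (Num.min s0 (lc_rad K)); split.
- by rewrite lt_min s00 lc_rad_gt0.
- by rewrite ge_min lexx orbT.
move=> x [dx kx]; rewrite -(lc_mapK dx); apply: Hs0.
by rewrite /= sub0r normrN (lt_le_trans kx)// ge_min lexx.
Qed.

(** Total differentiability at the identity with a diagonal differential. The condition on the
    domain is included because [lc_map] is a total function that means nothing outside [lc_dom]. *)
Definition diag_diff (R : realType) (n : nat) (G : topologicalGroupType)
    (K : local_coords R n G) (phi : G -> G) (d : 'I_n -> R) : Prop :=
  forall eps, 0 < eps -> exists2 s : R, 0 < s & forall y, cube K s y ->
    lc_dom K (phi y) /\
    forall i, `|lc_map K (phi y) ord0 i - d i * lc_map K y ord0 i| <=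
      eps * `|lc_map K y|.

Section LocalCoordsExist.
Variables (R : realType) (n : nat) (G : homogeneousGroup R n).
Variable P : 'M[R]_n.
Hypothesis Pu : P \in unitmx.

Let c := hg_chart G.
Let e := cmap c (1%g : G).
Let k (x : G) : 'rV[R]_n := (cmap c x - e) *m invmx P.
Let k' (u : 'rV[R]_n) : G := cinv c (u *m P + e).

(** Conjugating the chart by [P] makes an operator diagonalised by [P] act diagonally. The Lipschitz
    bound for a triple product comes from two uses of the bound for the group law of the chart. *)
Lemma exists_local_coords :
  exists K : local_coords R n G,
    [/\ lc_dom K = cdom c, lc_map K = k & lc_inv K = k'].
Proof.
have c1 : cdom c (1%g : G) by exact: hg_chart_1.
have ce : cinv c e = 1%g by exact: cmapK.
have re : crange c e by exact: cmap_range.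
pose U := [set p : 'rV[R]_n * 'rV[R]_n |
                [/\ crange c p.1, crange c p.2 &
                    cdom c (cinv c p.1 * cinv c p.2)%g]].
have [_ /(_ _ _ _ (hg_chart_atlas G) (hg_chart_atlas G) (hg_chart_atlas G))] :=
  lg_smooth_mul G.
rewrite -/c -/U => sF.
have UE : U = [set p : 'rV[R]_n * 'rV[R]_n | (crange c `*` crange c) p /\
                    cdom c (cinv c p.1 * cinv c p.2)%g].
  by apply/seteqP; split=> p /=; [move=> []|move=> [[]]].
have oU : open U.
  rewrite UE; apply: open_restrict_preimage.
  - rewrite openE => -[u v] [/= ru rv]; exists (crange c, crange c) => //=.
    by split; apply: open_nbhs_nbhs; split => //; exact: crange_open.
  - exact: cdom_open.
  - move=> [u v] [/= ru rv]; apply: mulg_cvg2.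
      by apply: (@cvg_comp _ _ _ fst (cinv c) _ (nbhs u)); [exact: cvg_fst|exact: cinv_continuous].
    by apply: (@cvg_comp _ _ _ snd (cinv c) _ (nbhs v)); [exact: cvg_snd|exact: cinv_continuous].
have Ue : U (e, e) by split => //=; rewrite ce mulg1.
have [C [r [C0 r0 HF]]] := smooth_lipschitz oU Ue sF.
have [K1 K10 HK1] := mulmx_bound P.
have [K2 K20 HK2] := mulmx_bound (invmx P).
have kP x : k x *m P = cmap c x - e by rewrite /k mulmxKV.
have k'0 : k' 0 = 1%g by rewrite /k' mul0mx add0r.
have k'c u : crange c (u *m P + e) -> {for u, continuous k'}.
  move=> ru.
  apply: (@cvg_comp _ _ _ (fun u => u *m P + e) (cinv c) (nbhs u) (nbhs (u *m P + e))).
    by apply: cvgD; [exact: mulmx_continuous|exact: cvg_cst].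
  exact: cinv_continuous.
have kc x : cdom c x -> {for x, continuous k}.
  move=> dx; apply: (@cvg_comp _ _ _ (fun x => cmap c x - e) (fun u => u *m invmx P)
    (nbhs x) (nbhs (cmap c x - e))).
    by apply: cvgB; [exact: cmap_continuous|exact: cvg_cst].
  exact: mulmx_continuous.
pose Br := [set x | cdom c x /\ `|cmap c x - e| < r].
have Br1 : nbhs (1%g : G) Br.
  apply: filterI; first by apply: open_nbhs_nbhs; split => //; exact: cdom_open.
  have /cvgr_dist_lt /(_ _ r0) := @cmap_continuous _ _ _ c _ c1.
  by apply: filterS => x /=; rewrite distrC.
(* Products of three factors of [W], and of two by taking the last factor 1, stay where the
   Lipschitz bound of the chart applies. *)
have [W W1 HW] := mulg3_nbhs1 Br1.
have : \forall u \near (0 : 'rV[R]_n), crange c (u *m P + e) /\ W (k' u).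
  apply: filterI.
    apply: (@affine_continuous R n n P e 0); rewrite mul0mx add0r.
    apply: open_nbhs_nbhs; split => //.
    exact: crange_open.
  apply: (k'c 0); first by rewrite mul0mx add0r.
  by rewrite k'0.
move=> /nbhs_normP[rho0 /= rho00 Hrho0].
pose rho := Num.min rho0 (r / K1).
have rho0' : 0 < rho by rewrite lt_min rho00 divr_gt0.
have Hrho u : `|u| < rho -> crange c (u *m P + e) /\ W (k' u).
  move=> ur; apply: Hrho0; rewrite /= sub0r normrN.
  by rewrite (lt_le_trans ur)// ge_min lexx.
have kK x : cdom c x -> k' (k x) = x.
  by move=> dx; rewrite /k' kP subrK cmapK.
have inW x : cdom c x -> `|k x| < rho -> W x.
  by move=> dx /Hrho[_]; rewrite kK.
have inr x : cdom c x -> `|k x| < rho -> `|cmap c x - e| < r.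
  move=> dx kx; rewrite -kP (le_lt_trans (HK1 _))// -ltr_pdivlMl//.
  by rewrite (lt_le_trans kx)// ge_min mulrC lexx orbT.
have W11 : W 1%g by exact: nbhs_singleton.
(* [K1] and [K2] pay for the change of basis, the two factors [C] for the two multiplications, and
   the 1 ensures [1 <= L]. *)
pose L := 1 + K2 * (C * (C * K1)).
have L1 : 1 <= L by rewrite lerDl ltW// !mulr_gt0.
have H1 : k 1%g = 0 by rewrite /k subrr mul0mx.
have Hdom u : `|u| < rho -> cdom c (k' u).
  by move=> /Hrho[ru _]; exact: cinv_dom.
have HkK u : `|u| < rho -> k (k' u) = u.
  by move=> /Hrho[ru _]; rewrite /k /k' cinvK// addrK mulmxK.
have Hk'c u : `|u| < rho -> {for u, continuous k'}.
  by move=> /Hrho[ru _]; exact: k'c.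
have Hlip z p p' q :
    cdom c z -> `|k z| < rho -> cdom c p -> `|k p| < rho ->
    cdom c p' -> `|k p'| < rho -> cdom c q -> `|k q| < rho ->
    cdom c (z * p * q)%g /\
    `|k (z * p * q)%g - k (z * p' * q)%g| <= L * `|k p - k p'|.
  move=> dz rz dp rp dp' rp' dq rq.
  have Wz := inW _ dz rz. have Wp := inW _ dp rp.
  have Wp' := inW _ dp' rp'. have Wq := inW _ dq rq.
  have [dzp rzp] : Br (z * p)%g by rewrite -(mulg1 (z * p)%g); exact: HW.
  have [dzp' rzp'] : Br (z * p')%g by rewrite -(mulg1 (z * p')%g); exact: HW.
  have [dzpq _] := HW _ _ _ Wz Wp Wq.
  split; first exact: dzpq.
  have E x y : cdom c x -> cdom c y -> cmap c (x * y)%g =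
      cmap c (cinv c (cmap c x, cmap c y).1 * cinv c (cmap c x, cmap c y).2)%g.
    by move=> dx dy; rewrite /= !cmapK.
  have S1 : `|cmap c (z * p)%g - cmap c (z * p')%g| <= C * `|cmap c p - cmap c p'|.
    rewrite (E z p)// (E z p')//; apply: (le_trans (HF _ _ _ _ _ _ _ _)) => //=.
    - exact: inr. - exact: inr. - exact: inr. - exact: inr.
    by rewrite subrr normr0 add0r.
  have S2 : `|cmap c (z * p * q)%g - cmap c (z * p' * q)%g| <=
      C * `|cmap c (z * p)%g - cmap c (z * p')%g|.
    rewrite (E (z * p)%g q)// (E (z * p')%g q)//.
    apply: (le_trans (HF _ _ _ _ _ _ _ _)) => //=.
    - exact: inr. - exact: inr.
    by rewrite subrr normr0 addr0.
  have S3 : `|cmap c p - cmap c p'| <= K1 * `|k p - k p'|.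
    apply: le_trans (HK1 _); rewrite mulmxBl !kP opprB addrA subrK; exact: lexx.
  have -> : k (z * p * q)%g - k (z * p' * q)%g =
      (cmap c (z * p * q)%g - cmap c (z * p' * q)%g) *m invmx P.
    by rewrite /k -mulmxBl opprB addrA subrK.
  apply: (le_trans (HK2 _)); rewrite /L mulrDl mul1r ler_wpDl//.
  rewrite -!mulrA ler_pM2l//; apply: (le_trans S2); rewrite ler_pM2l//.
  by apply: (le_trans S1); rewrite ler_pM2l.
by exists (@LocalCoords R n G (cdom c) k k' rho L rho0' L1 (@cdom_open _ _ _ c)
  c1 H1 kK Hdom HkK kc Hk'c Hlip).
Qed.

(** As [phi] fixes the identity, both sides are centred at the same point and the conjugation by [P]
    cancels in the coordinates [k]. The error is divided by [K2 * K1] in advance to absorb the two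
    changes of basis. *)
Lemma diag_diff_of_differential (K : local_coords R n G) (phi : G -> G)
    (d : 'rV[R]_n) :
  lc_dom K = cdom c -> lc_map K = k ->
  phi 1%g = 1%g -> smooth_map (@lg_atlas _ _ G) phi ->
  differential_at_1 c phi (invmx P *m diag_mx d *m P) ->
  diag_diff K phi (d ord0).
Proof.
move=> Kd Kk phi1 [phic /(_ _ _ (hg_chart_atlas G) (hg_chart_atlas G))].
rewrite -/c; set U := [set _ | _] => sf Dphi.
have c1 : cdom c (1%g : G) by exact: hg_chart_1.
have ce : cinv c e = 1%g by exact: cmapK.
have re : crange c e by exact: cmap_range.
have kP x : k x *m P = cmap c x - e by rewrite /k mulmxKV.
have oU : open U.
  apply: open_restrict_preimage; [exact: crange_open|exact: cdom_open|].
  move=> u ru; apply: (@cvg_comp _ _ _ (cinv c) phi (nbhs u) (nbhs (cinv c u))).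
    exact: cinv_continuous.
  exact: phic.
have Ue : U e by split => //=; rewrite ce phi1.
have [K1 K10 HK1] := mulmx_bound P.
have [K2 K20 HK2] := mulmx_bound (invmx P).
move=> eps eps0.
have eps1 : 0 < eps / (K2 * K1) by rewrite divr_gt0// mulr_gt0.
have [rad rad0 Hr] := smooth_differential oU Ue sf Dphi eps1.
have : \forall x \near (1%g : G), cdom c (phi x) /\ cdom c x.
  apply: filterI; last by apply: open_nbhs_nbhs; split => //; exact: cdom_open.
  apply: (phic 1%g); rewrite phi1; apply: open_nbhs_nbhs; split => //.
  exact: cdom_open.
move=> /(cube_base K)[s1 [s10 _ Hs1]].
exists (Num.min s1 (rad / K1)); first by rewrite lt_min s10 divr_gt0.
move=> y [dy ky].
have [dpy _] : cdom c (phi y) /\ cdom c y.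
  by apply: Hs1; split => //; rewrite (lt_le_trans ky)// ge_min lexx.
rewrite Kd in dy *; rewrite Kk in ky *; split => // i.
have h1 : `|cmap c y - e| < rad.
  rewrite -kP (le_lt_trans (HK1 _))// -ltr_pdivlMl//.
  by rewrite (lt_le_trans ky)// ge_min mulrC lexx orbT.
have := Hr _ h1; rewrite (addrC e) subrK /= cmapK// ce phi1 -/e => H2.
have -> : k (phi y) ord0 i - d ord0 i * k y ord0 i =
   ((cmap c (phi y) - e - (cmap c y - e) *m (invmx P *m diag_mx d *m P)) *m invmx P) ord0 i.
  rewrite mulmxBl -/(k (phi y)) !mulmxA mulmxK// -/(k y) mul_mx_diag.
  by move: (k (phi y)) (k y) => u v; rewrite !mxE mulrC.
apply: (le_trans (rV_norm_coord _ _)); apply: (le_trans (HK2 _)).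
rewrite -ler_pdivlMl//; apply: (le_trans H2).
rewrite -kP; apply: (le_trans (ler_wpM2l (ltW eps1) (HK1 _))).
rewrite le_eqVlt; apply/orP; left; apply/eqP; field.
by rewrite !gt_eqF.
Qed.
End LocalCoordsExist.

Section LocalCoordsFacts.
Variables (R : realType) (n : nat) (G : topologicalGroupType).
Variable K : local_coords R n G.

Local Notation k := (lc_map K).
Local Notation rho := (lc_rad K).
Local Notation L := (lc_lip K).

Lemma lc_lip_gt0 : 0 < L.
Proof. exact: lt_le_trans ltr01 (lc_lip_ge1 K). Qed.

Lemma cube1 (s : R) : 0 < s -> cube K s 1%g.
Proof. by move=> s0; split; [exact: lc_dom1|rewrite lc_map1 normr0]. Qed.

Lemma cube_sub (s t : R) : s <= t -> cube K s `<=` cube K t.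
Proof. by move=> st x [dx kx]; split => //; exact: lt_le_trans st. Qed.

Lemma cube_open (s : R) : open (cube K s).
Proof.
have -> : cube K s = [set x | lc_dom K x /\ [set u | `|u| < s] (k x)] by [].
apply: open_restrict_preimage; first exact: lc_dom_open.
  have -> : [set u : 'rV[R]_n | `|u| < s] = (fun u => `|u|) @^-1` [set x | x < s].
    by [].
  apply: open_comp => [u _|]; [exact: norm_continuous|exact: open_lt].
exact: lc_map_continuous.
Qed.

Lemma cube_nbhs1 (s : R) : 0 < s -> nbhs (1%g : G) (cube K s).
Proof.
by move=> s0; apply: open_nbhs_nbhs; split; [exact: cube_open|exact: cube1].
Qed.

Lemma lc_inv0 : lc_inv K 0 = 1%g.
Proof. by rewrite -(lc_map1 K) lc_mapK//; exact: lc_dom1. Qed.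

Lemma cube_inv (s : R) (u : 'rV[R]_n) :
  s <= rho -> `|u| < s -> cube K s (lc_inv K u).
Proof.
move=> sr us; have ur := lt_le_trans us sr.
by split; [exact: lc_inv_dom|rewrite lc_invK].
Qed.

Lemma lc_map_inj (x y : G) : lc_dom K x -> lc_dom K y -> k x = k y -> x = y.
Proof. by move=> dx dy xy; rewrite -(lc_mapK dx) xy lc_mapK. Qed.

Lemma lip_cube (z p p' q : G) :
  cube K rho z -> cube K rho p -> cube K rho p' -> cube K rho q ->
  lc_dom K (z * p * q)%g /\
  `|k (z * p * q)%g - k (z * p' * q)%g| <= L * `|k p - k p'|.
Proof. by move=> [? ?] [? ?] [? ?] [? ?]; exact: lc_lipP. Qed.

Lemma lip_lmul (z p p' : G) :
  cube K rho z -> cube K rho p -> cube K rho p' ->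
  lc_dom K (z * p)%g /\
  `|k (z * p)%g - k (z * p')%g| <= L * `|k p - k p'|.
Proof.
move=> hz hp hp'; have := lip_cube hz hp hp' (cube1 (lc_rad_gt0 K)).
by rewrite !mulg1.
Qed.

End LocalCoordsFacts.

(** * Group homomorphisms with a given differential at the identity *)

Section Homomorphisms.
Variables (G : topologicalGroupType) (phi : G -> G).
Hypothesis phiM : forall x y, phi (x * y)%g = (phi x * phi y)%g.

Lemma hom1 : phi 1%g = 1%g.
Proof. by apply: (mulgI (phi 1%g)); rewrite -phiM !mulg1. Qed.

Lemma homV x : phi x^-1%g = (phi x)^-1%g.
Proof. by apply: (mulgI (phi x)); rewrite -phiM !mulgV hom1. Qed.

End Homomorphisms.

(* Along the path [t |-> lc_inv (t w)] cut into [m] pieces, replacing [phi2] by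
   [phi1] on one increment costs [o(1/m)], so the total discrepancy vanishes. *)
Lemma diag_homs_agree_near (R : realType) (n : nat) (G : topologicalGroupType)
    (K : local_coords R n G) (phi1 phi2 : G -> G) (d : 'I_n -> R) :
  (forall x y, phi1 (x * y)%g = (phi1 x * phi1 y)%g) ->
  (forall x y, phi2 (x * y)%g = (phi2 x * phi2 y)%g) ->
  continuous phi1 -> continuous phi2 ->
  diag_diff K phi1 d -> diag_diff K phi2 d ->
  \forall x \near (1%g : G), phi1 x = phi2 x.
Proof.
move=> M1 M2 c1 c2 D1 D2.
set k := lc_map K; set rho := lc_rad K; set L := lc_lip K.
have rho0 : 0 < rho := lc_rad_gt0 K.
have L0 : 0 < L := lc_lip_gt0 K.
pose W := [set x | [/\ cube K rho x, cube K rho (phi1 x) & cube K rho (phi2 x)]].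
have W1 : nbhs (1%g : G) W.
  have H1 : \forall x \near (1%g : G), cube K rho (phi1 x).
    by apply: (c1 1%g); rewrite hom1//; exact: cube_nbhs1.
  have H2 : \forall x \near (1%g : G), cube K rho (phi2 x).
    by apply: (c2 1%g); rewrite hom1//; exact: cube_nbhs1.
  near=> x; split; near: x => //; exact: cube_nbhs1.
have [V0 V01 HV0] := mulg3_nbhs1 W1.
(* Symmetrising the neighbourhood lets quotients [a^-1 * b] of points of the small cube be
   controlled as well. *)
pose V := V0 `&` [set x | V0 x^-1%g].
have V1 : nbhs (1%g : G) V.
  apply: filterI => //.
  by apply: (@invg_continuous G 1%g); rewrite invg1.
have [r [r0 rrho Hr]] := cube_base K V1.
have V010 : V0 1%g by exact: nbhs_singleton.
have HV a b : cube K r a -> cube K r b -> W (a^-1 * b)%g.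
  move=> /Hr[_ Va] /Hr[Vb _].
  by rewrite -(mulg1 (a^-1 * b)%g); exact: HV0.
have HV1 b : cube K r b -> W b.
  by move=> hb; rewrite -(mul1g b) -invg1; apply: HV => //; exact: cube1.
have HVi a : cube K r a -> W a^-1%g.
  by move=> ha; rewrite -(mulg1 a^-1%g); apply: HV => //; exact: cube1.
have : nbhs (1%g : G) (cube K r) by exact: cube_nbhs1.
apply: filterS => x hx.
have [dp1 rp1] : cube K rho (phi1 x) by case: (HV1 _ hx).
have [dp2 rp2] : cube K rho (phi2 x) by case: (HV1 _ hx).
apply: (lc_map_inj dp1 dp2); apply/eqP; rewrite -subr_eq0 -normr_le0.
rewrite leNgt; apply/negP => Dl0.
set Dl := `|_| in Dl0.
(* The 4 makes the [m] steps, each of size at most [L * (2 * eps * (L * r / m))], add up to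
   [Dl / 2], which contradicts a total discrepancy of [Dl > 0]. *)
pose eps := Dl / (4 * (L * (L * r))).
have eps0 : 0 < eps by rewrite divr_gt0// !mulr_gt0.
have [s1 s10 H1] := D1 _ eps0.
have [s2 s20 H2] := D2 _ eps0.
pose s := Num.min s1 s2.
have s0 : 0 < s by rewrite lt_min s10.
(* So many pieces that every increment along the path lies in the cube of radius [s], where both
   linearisations are accurate up to [eps]. *)
pose m := (Num.truncn (L * r / s)).+1.
have m0 : (0 : R) < m%:R by rewrite ltr0n.
have Hm : L * r / m%:R < s.
  by rewrite ltr_pdivrMr// -ltr_pdivrMl// mulrC; exact: truncnS_gt.
pose w := k x.
have [dx kx] := hx.
pose X j : G := lc_inv K ((j%:R / m%:R) *: w).
have jw j : (j <= m)%N -> `|(j%:R / m%:R) *: w| < r.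
  move=> jm; rewrite normrZ ger0_norm ?divr_ge0//.
  by rewrite (le_lt_trans _ kx)// ler_piMl// ler_pdivrMr// mul1r ler_nat.
have hX j : (j <= m)%N -> cube K r (X j).
  by move=> jm; apply: cube_inv => //; exact: jw.
have kX j : (j <= m)%N -> k (X j) = (j%:R / m%:R) *: w.
  by move=> jm; rewrite /k lc_invK// (lt_le_trans (jw _ jm)).
have X0 : X 0%N = 1%g by rewrite /X mul0r scale0r lc_inv0.
have Xm : X m = x by rewrite /X divff ?gt_eqF// scale1r lc_mapK.
(* [P] goes from [phi2 x] at [j = 0] to [phi1 x] at [j = m]; consecutive values differ only in the
   middle one of three factors, [phi1 y] against [phi2 y]. *)
pose P j := (phi1 (X j) * phi2 ((X j)^-1 * x))%g.
have step j : (j < m)%N -> `|k (P j.+1) - k (P j)| <= L * (2 * eps * (L * r / m%:R)).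
  move=> jm; have jm' := ltnW jm.
  have hj := hX _ jm'; have hj1 := hX _ jm.
  pose y := ((X j)^-1 * X j.+1)%g.
  have ky : lc_dom K y /\ `|k y| <= L * r / m%:R.
    have [wi _ _] := HVi _ hj.
    have [dy] := lip_lmul wi (cube_sub rrho hj1) (cube_sub rrho hj).
    rewrite mulVg lc_map1 subr0 -/k -/y kX// kX// -scalerBl -mulrBl.
    rewrite -[in X in X%:R]addn1 natrD addrAC subrr add0r mul1r normrZ => H.
    split => //; apply: (le_trans H); rewrite -mulrA ler_pM2l//.
    rewrite ger0_norm ?invr_ge0// mulrC; apply: ler_pM => //; exact: ltW.
  have [dy kyr] := ky.
  have ys : cube K s y by split => //; exact: le_lt_trans Hm.
  have [e1 E1] := H1 y (cube_sub (ltac:(by rewrite /s ge_min lexx) : s <= s1) ys).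
  have [e2 E2] := H2 y (cube_sub (ltac:(by rewrite /s ge_min lexx orbT) : s <= s2) ys).
  have Dy : `|k (phi1 y) - k (phi2 y)| <= 2 * eps * (L * r / m%:R).
    have B0 : 0 < 2 * eps * (L * r / m%:R).
      by rewrite mulr_gt0// ?divr_gt0// mulr_gt0.
    apply: (iffRL (rV_norm_leP _ (ltW B0))) => i; rewrite !mxE.
    apply: (@le_trans _ _ (2 * eps * `|k y|)); last first.
      by apply: ler_wpM2l => //; rewrite mulr_ge0// ltW.
    rewrite -mulrA [2 * _]mulrDl !mul1r.
    rewrite -(subrK (d i * k y ord0 i) (k (phi1 y) ord0 i)) -addrA.
    apply: (le_trans (ler_normD _ _)); apply: lerD; first exact: E1.
    by rewrite distrC; exact: E2.
  have -> : P j.+1 = (phi1 (X j) * phi1 y * phi2 ((X j.+1)^-1 * x))%g.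
    by rewrite /P -M1 /y mulVKg.
  have -> : P j = (phi1 (X j) * phi2 y * phi2 ((X j.+1)^-1 * x))%g.
    by rewrite /P -mulgA -M2 /y -(mulgA (X j)^-1%g) mulVKg.
  have [_ a1 _] := HV1 _ hj.
  have [_ a2 a3] := HV _ _ hj hj1.
  have [_ _ a4] := HV _ _ hj1 hx.
  have [_ H] := lip_cube a1 a2 a3 a4.
  by apply: (le_trans H); rewrite ler_pM2l.
have tele j : (j <= m)%N -> `|k (P j) - k (P 0%N)| <= j%:R * (L * (2 * eps * (L * r / m%:R))).
  elim: j => [_|j IH jm]; first by rewrite subrr normr0 mul0r.
  rewrite -(subrK (k (P j)) (k (P j.+1))) -addrA.
  apply: (le_trans (ler_normD _ _)); rewrite -[in leRHS]natr1 mulrDl mul1r [leRHS]addrC.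
  by apply: lerD; [exact: step|apply: IH; exact: ltnW].
have := tele m (leqnn m).
rewrite /P X0 Xm mulVg (hom1 M1) (hom1 M2) mulg1 invg1 !mul1g -/Dl.
have -> : m%:R * (L * (2 * eps * (L * r / m%:R))) = Dl / 2.
  rewrite /eps; field; rewrite !gt_eqF//.
by rewrite leNgt ltr_pdivrMr// mulr_natr mulr2n ltrDl Dl0.
Unshelve. all: by end_near. Qed.

Lemma diag_homs_agree (R : realType) (n : nat) (G : topologicalGroupType)
    (K : local_coords R n G) (phi1 phi2 : G -> G) (d : 'I_n -> R) :
  connected [set: G] ->
  (forall x y, phi1 (x * y)%g = (phi1 x * phi1 y)%g) ->
  (forall x y, phi2 (x * y)%g = (phi2 x * phi2 y)%g) ->
  continuous phi1 -> continuous phi2 ->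
  diag_diff K phi1 d -> diag_diff K phi2 d -> phi1 =1 phi2.
Proof.
move=> cG M1 M2 c1 c2 D1 D2.
apply: (connected_open_subgroup cG).
- by move=> x y xE yE; rewrite M1 M2 xE yE.
- by move=> x xE; rewrite !homV// xE.
- exact: (diag_homs_agree_near M1 M2 c1 c2 D1 D2).
Qed.

(** * Dilations and quasi-balls *)

Lemma diag_diff_comp (R : realType) (n : nat) (G : topologicalGroupType)
    (K : local_coords R n G) (phi psi : G -> G) (d d' : 'I_n -> R) :
  diag_diff K phi d -> diag_diff K psi d' ->
  diag_diff K (phi \o psi) (fun i => d i * d' i).
Proof.
move=> Dphi Dpsi eps eps0.
pose M := 1 + \sum_i `|d i|; pose M' := 1 + \sum_i `|d' i|.
have M0 : 0 < M by rewrite ltr_pwDl// sumr_ge0.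
have M'0 : 0 < M' by rewrite ltr_pwDl// sumr_ge0.
have dM i : `|d i| <= M.
  by rewrite ler_wpDl//; exact: (ler_term_sum i (fun j => normr_ge0 (d j))).
have dM' i : `|d' i| <= M'.
  by rewrite ler_wpDl//; exact: (ler_term_sum i (fun j => normr_ge0 (d' j))).
(* The cap 1 bounds the coordinates of [psi y] by [M' + 1] times those of [y]; with [e1] below, each
   of the two errors of the chain rule then takes half of [eps]. *)
pose e2 := Num.min 1 (eps / (2 * M)).
have e20 : 0 < e2 by rewrite lt_min ltr01 divr_gt0// mulr_gt0.
pose e1 := eps / (2 * (M' + 1)).
have e10 : 0 < e1 by rewrite divr_gt0// mulr_gt0// addr_gt0.
have [s1 s10 H1] := Dphi _ e10.
have [s2 s20 H2] := Dpsi _ e20.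
have M'1 : 0 < M' + 1 by rewrite addr_gt0.
exists (Num.min s2 (s1 / (M' + 1))) => [|y [dy ky]].
  by rewrite lt_min s20 divr_gt0.
have [dpy Ey] : lc_dom K (psi y) /\
    forall i, `|lc_map K (psi y) ord0 i - d' i * lc_map K y ord0 i| <=
      e2 * `|lc_map K y|.
  by apply: H2; split => //; rewrite (lt_le_trans ky)// ge_min lexx.
have kpy : `|lc_map K (psi y)| <= (M' + 1) * `|lc_map K y|.
  apply: (iffRL (rV_norm_leP _ _)) => [|i]; first by rewrite mulr_ge0// ltW.
  rewrite -(subrK (d' i * lc_map K y ord0 i) (lc_map K (psi y) ord0 i)).
  apply: (le_trans (ler_normD _ _)); rewrite addrC mulrDl; apply: lerD.
    by rewrite normrM; apply: ler_pM => //; exact: rV_norm_coord.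
  apply: (le_trans (Ey i)); apply: ler_wpM2r => //.
  by rewrite ge_min lexx.
have [dppy Epy] : lc_dom K (phi (psi y)) /\
    forall i, `|lc_map K (phi (psi y)) ord0 i - d i * lc_map K (psi y) ord0 i|
      <= e1 * `|lc_map K (psi y)|.
  apply: H1; split => //; rewrite (le_lt_trans kpy)// -ltr_pdivlMl// mulrC.
  by rewrite (lt_le_trans ky)// ge_min lexx orbT.
split => // i /=.
rewrite -(subrK (d i * lc_map K (psi y) ord0 i) (lc_map K (phi (psi y)) ord0 i)).
rewrite -addrA -mulrA -mulrBr.
apply: (le_trans (ler_normD _ _)).
rewrite [eps]splitr mulrDl; apply: lerD.
  apply: (le_trans (Epy i)); apply: (le_trans (ler_wpM2l (ltW e10) kpy)).
  rewrite le_eqVlt; apply/orP; left; apply/eqP; rewrite /e1; field.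
  by rewrite gt_eqF.
rewrite normrM; apply: (le_trans (ler_pM _ _ (dM i) (Ey i))) => //.
rewrite mulrA; apply: ler_wpM2r => //.
rewrite mulrC -ler_pdivlMr// ge_min; apply/orP; right.
rewrite le_eqVlt; apply/orP; left; apply/eqP; field.
by rewrite gt_eqF.
Qed.

(** Apart from the continuity and multiplicativity of the dilations, this is all that the later
    sections retain of the smooth structure and of the Lie algebra. *)
Lemma dilation_coords (R : realType) (n : nat) (G : homogeneousGroup R n) :
  exists (K : local_coords R n G) (a : 'I_n -> R),
    [/\ forall i, 0 < a i, \sum_i a i = homogeneous_dim G &
      forall lambda, 0 < lambda ->
        diag_diff K (@hg_dil _ _ G lambda) (fun i => lambda `^ a i)].
Proof.
have [P Pu /(similar_diagLR Pu)[a]] := hg_A0_diag G.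
rewrite conjVmx// => A0E.
have [K [Kd Kk _]] := exists_local_coords G Pu.
exists K, (a ord0); split.
(* Operators act on row vectors, so the rows of [P] are the eigenvectors and the [a i] are
   eigenvalues. *)
- move=> i; apply: (@hg_A0_gt0 _ _ G).
  apply/eigenvalueP; exists (row i P).
    rewrite A0E !mulmxA -row_mul mulmxV// -!row_mul mul1mx.
    by rewrite mul_diag_mx; apply/rowP => j; rewrite !mxE.
  apply/eqP => Pi0.
  have : row i (1%:M : 'M[R]_n) ord0 i = 0.
    by rewrite -(mulmxV Pu) row_mul Pi0 mul0mx mxE.
  by rewrite !mxE eqxx => /eqP; rewrite oner_eq0.
- rewrite /homogeneous_dim A0E mxtrace_mulC mulmxA mulmxV// mul1mx.
  by rewrite mxtrace_diag; apply: eq_bigr => i _; congr (a _ i).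
move=> lambda l0.
have dM := hg_dilM (h := G) l0.
have -> : (fun i => lambda `^ a ord0 i) = (\row_i (expR (ln lambda * a ord0 i))) ord0.
  by apply/funext => i; rewrite mxE /powR gt_eqF// mulrC.
apply: (diag_diff_of_differential Pu Kd Kk).
- exact: (@hom1 G _ dM).
- exact: hg_dil_smooth.
have -> : invmx P *m diag_mx (\row_i expR (ln lambda * a ord0 i)) *m P =
    lie_dilation (hg_A0 G) lambda.
  rewrite /lie_dilation A0E.
  have -> : ln lambda *: (invmx P *m diag_mx a *m P) =
     invmx P *m diag_mx (ln lambda *: a) *m P.
    by rewrite linearZ/= -scalemxAr -scalemxAl.
  rewrite expmx_conj_diag//; congr (_ *m diag_mx _ *m _).
  by apply/rowP => i; rewrite !mxE.
exact: hg_dil_diff.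
Qed.

Section Dilations.
Variables (R : realType) (n : nat) (G : topologicalGroupType).
Variables (K : local_coords R n G) (a : 'I_n -> R) (dil : R -> G -> G).
Hypothesis cG : connected [set: G].
Hypothesis hG : hausdorff_space G.
Hypothesis a_gt0 : forall i, 0 < a i.
Hypothesis dilM : forall l x y, 0 < l -> dil l (x * y)%g = (dil l x * dil l y)%g.
Hypothesis dil_continuous : forall l, 0 < l -> continuous (dil l).
Hypothesis dil_diff : forall l, 0 < l -> diag_diff K (dil l) (fun i => l `^ a i).
Variable N : G -> R.
Hypothesis N_continuous : continuous N.
Hypothesis N_ge0 : forall x, 0 <= N x.
Hypothesis N_dil : forall l x, 0 < l -> N (dil l x) = l * N x.
Hypothesis N_eq0 : forall x, N x = 0 <-> x = 1%g.

Lemma dilVK l x : 0 < l -> dil l (dil l^-1 x) = x.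
Proof.
move=> l0; have lV0 : 0 < l^-1 by rewrite invr_gt0.
have E : (fun i => l `^ a i * l^-1 `^ a i) = fun=> 1.
  by apply/funext => i; rewrite -powRM ?ltW// divff ?gt_eqF// powR1.
apply: (@diag_homs_agree _ _ _ K (dil l \o dil l^-1) id (fun=> 1)) => //.
- by move=> y z /=; rewrite !dilM.
- by move=> y; apply: continuous_comp; exact: dil_continuous.
- by move=> y; exact: cvg_id.
- by rewrite -E; apply: diag_diff_comp; exact: dil_diff.
- move=> eps eps0; exists 1 => // y [dy _]; split => // i.
  by rewrite mul1r subrr normr0 mulr_ge0// ltW.
Qed.

Lemma dilKV l x : 0 < l -> dil l^-1 (dil l x) = x.
Proof. by move=> l0; rewrite -{2}(invrK l) dilVK// invr_gt0. Qed.

(** Stated with iterates of a single dilation: the linearisation is used for one parameter only, and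
    no multiplicativity of [dil] in its parameter is required. *)
Lemma contracting_dilation : exists l : R, [/\ 0 < l, l < 1 &
  forall (W : set G) x, nbhs (1%g : G) W -> exists j, W (iter j (dil l) x)].
Proof.
(* As [T * a i >= 3], each factor [exp (- T * a i)] is at most 1/4; a linearisation error of 1/4
   then leaves a contraction by 1/2. *)
pose T := 1 + \sum_i (3 / a i).
have ai0 i : 0 <= 3 / a i by rewrite divr_ge0// ltW.
have T0 : 0 < T by rewrite ltr_pwDl// sumr_ge0.
pose l := expR (- T).
have l0 : 0 < l by exact: expR_gt0.
have l1 : l < 1 by rewrite /l -expR0 ltr_expR oppr_lt0.
have la i : `|l `^ a i| <= 1 / 4.
  rewrite ger0_norm ?powR_ge0// /l -expRM mulNr expRN div1r.
  rewrite lef_pV2 ?posrE ?expR_gt0//.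
  apply: le_trans (expR_ge1Dx _); have -> : 4 = 1 + 3 :> R by ring.
  rewrite lerD2l -ler_pdivrMr// ler_wpDl//.
  exact: (ler_term_sum i ai0).
exists l; split => // W x W1.
have q0 : (0 : R) < 1 / 4 by rewrite divr_gt0.
have [s s0 Hs] := dil_diff l0 q0.
have step y : cube K s y -> lc_dom K (dil l y) /\
    `|lc_map K (dil l y)| <= 1 / 2 * `|lc_map K y|.
  move=> /Hs[dy Hy]; split => //.
  apply: (iffRL (rV_norm_leP _ _)) => [|i]; first by rewrite mulr_ge0.
  rewrite -(subrK (l `^ a i * lc_map K y ord0 i) (lc_map K (dil l y) ord0 i)).
  apply: (le_trans (ler_normD _ _)).
  have -> : 1 / 2 * `|lc_map K y| = 1 / 4 * `|lc_map K y| + 1 / 4 * `|lc_map K y|.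
    by field.
  apply: lerD; first exact: Hy.
  by rewrite normrM; apply: ler_pM => //; exact: rV_norm_coord.
have iter_step y j : cube K s y -> cube K s (iter j (dil l) y) /\
    `|lc_map K (iter j (dil l) y)| <= (1 / 2) ^+ j * `|lc_map K y|.
  move=> hy; elim: j => [|j [IH1 IH2]] /=; first by rewrite expr0 mul1r.
  have [d1 H1] := step _ IH1; split.
    split => //; apply: (le_lt_trans H1); case: IH1 => _; apply: le_lt_trans.
    by rewrite ler_piMl//; lra.
  apply: (le_trans H1); rewrite exprS -(mulrA (1 / 2)); exact: ler_wpM2l.
pose H := [set y : G | iter j (dil l) y @[j --> \oo] --> (1%g : G)].
have iterM j y z : iter j (dil l) (y * z)%g = (iter j (dil l) y * iter j (dil l) z)%g.
  by elim: j => //= j ->; rewrite dilM.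
have iterV j y : iter j (dil l) y^-1%g = (iter j (dil l) y)^-1%g.
  by apply: (@homV G) => u v; exact: iterM.
have Hx : H x.
  apply: (connected_open_subgroup cG).
  - move=> y z hy hz; rewrite /H /=; under eq_fun do rewrite iterM.
    by rewrite -(mulg1 (1%g : G)); exact: mulg_cvg2.
  - move=> y hy; rewrite /H /=; under eq_fun do rewrite iterV.
    rewrite -invg1.
    exact: (@cvg_comp _ _ _ (fun j => iter j (dil l) y) (fun z : G => z^-1%g)
      _ _ _ hy (@invg_continuous G 1%g)).
  apply: filterS (cube_nbhs1 K s0) => y hy V V1.
  have [r [r0 _ Hr]] := cube_base K V1.
  have H1 : (1 / 2) ^+ j * `|lc_map K y| @[j --> \oo] --> (0 * `|lc_map K y| : R).
    by apply: cvgMr_tmp; apply: cvg_expr; rewrite ger0_norm//; lra.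
  rewrite mul0r in H1.
  have /cvgr0_norm_lt /(_ _ r0) := H1.
  apply: filterS => j Hj; apply: Hr.
  have [[dj _] Ej] := iter_step y j hy; split => //.
  by apply: (le_lt_trans Ej); apply: le_lt_trans Hj; exact: ler_norm.
have [j _ Hj] := Hx _ W1.
by exists j; exact: (Hj j (leqnn j)).
Qed.

(** On the compact set [A], which is [C] without a small cube, [N] is bounded below by some [e]. The
    contracting orbit of a point with [N x < e] enters the cube, and one step back from the cube
    still lands in [C]; since [N] does not increase along the orbit, it never visits [A], so the
    orbit was in the cube from the start. *)
Lemma small_ball_compact : exists2 e : R, 0 < e &
  exists2 C : set G, compact C & [set x | N x < e] `<=` C.
Proof.
have [l [l0 l1 Hl]] := contracting_dilation.
have lV0 : 0 < l^-1 by rewrite invr_gt0.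
have rho0 := lc_rad_gt0 K.
pose r0 := lc_rad K / 2.
have r00 : 0 < r0 by rewrite divr_gt0.
have r0rho : r0 < lc_rad K by rewrite ltr_pdivrMr// mulr_natr mulr2n ltrDl.
pose C := lc_inv K @` [set u : 'rV[R]_n | `|u| <= r0].
have cC : compact C.
  apply: continuous_compact.
    apply: continuous_in_subspaceT => u; rewrite inE/= => ur.
    by apply: lc_inv_continuous; exact: le_lt_trans r0rho.
  apply: bounded_closed_compact.
    exists r0; split; first exact: num_real.
    by move=> M rM u /= ur; rewrite (le_trans ur)// ltW.
  have -> : [set u : 'rV[R]_n | `|u| <= r0] = (fun u => `|u|) @^-1` [set x | x <= r0].
    by [].
  by apply: closed_comp => [u _|]; [exact: norm_continuous|exact: closed_le].
have W1 : nbhs (1%g : G) (cube K r0 `&` dil l^-1 @^-1` cube K r0).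
  apply: filterI; first exact: cube_nbhs1.
  apply: (dil_continuous lV0 (x := 1%g)).
  by rewrite (hom1 (fun x y => dilM x y lV0)); exact: cube_nbhs1.
have [r [r'0 _ Hr]] := cube_base K W1.
have cubeC : cube K r0 `<=` C.
  by move=> x [dx kx]; exists (lc_map K x); [exact: ltW|rewrite lc_mapK].
pose A := C `&` ~` cube K r.
have cA : compact A.
  by apply: compact_closedI => //; apply: open_closedC; exact: cube_open.
have clNA : closed (N @` A).
  apply: compact_closed; first exact: Rhausdorff.
  by apply: continuous_compact => //; apply: continuous_subspaceT.
have nA0 : (~` (N @` A)) 0.
  move=> -[x [_ nx] /N_eq0 x1]; apply: nx; rewrite x1; exact: cube1.
have /nbhs_normP[e /= e0 He] : nbhs (0 : R) (~` (N @` A)).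
  by apply: open_nbhs_nbhs; split => //; exact: closed_openC.
exists e => //; exists C => // x /= xe.
suff xr : cube K r x by apply: cubeC; have [] := Hr _ xr.
apply: contrapT => nxr.
have [j Hj] := Hl _ x (cube_nbhs1 K r'0).
(* The orbit is followed backwards, from the first known time in the cube down to [x] itself. *)
elim: j Hj => [//|j IH] Hj.
apply: IH; apply: contrapT => nj.
set y := iter j (dil l) x in Hj nj *.
have Ny : N y < e.
  apply: le_lt_trans xe; rewrite /y; elim: (j) => //= i.
  by rewrite N_dil//; apply: le_trans; rewrite ler_piMl// ltW.
have Cy : C y.
  by apply: cubeC; have [_] := Hr _ Hj; rewrite /= dilKV.
apply: (He (N y)); last by exists y.
by rewrite /= sub0r normrN ger0_norm.
Qed.

Lemma ball_compact (r : R) : exists2 C : set G, compact C & [set x | N x < r] `<=` C.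
Proof.
have [r0|r0] := leP r 0.
  exists set0; first exact: compact0.
  by move=> x /=; rewrite ltNge (le_trans r0).
have [e e0 [C cC HC]] := small_ball_compact.
have er0 : 0 < e / r by rewrite divr_gt0.
exists (dil (e / r)^-1 @` C).
  apply: continuous_compact => //; apply: continuous_subspaceT.
  by apply: dil_continuous; rewrite invr_gt0.
move=> x /= xr; exists (dil (e / r) x); last exact: dilKV.
by apply: HC; rewrite /= N_dil// mulrAC ltr_pdivrMr// ltr_pM2l.
Qed.

End Dilations.

(** * Haar measure of coordinate boxes *)

Lemma measure_cover_seq (d : measure_display) (T : measurableType d)
    (R : realType) (mu : {measure set T -> \bar R}) (I : eqType) (s : seq I)
    (A : I -> set T) (S : set T) :
  measurable S -> (forall i, measurable (A i)) ->
  (forall x, S x -> exists2 i, i \in s & A i x) ->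
  (mu S <= \sum_(i <- s) mu (A i))%E.
Proof.
move=> mS mA; elim: s S mS => [|i s IH] S mS cov.
  rewrite big_nil (_ : S = set0) ?measure0//.
  by apply/seteqP; split => // x /cov[].
rewrite big_cons.
apply: (@le_trans _ _ (mu (A i `|` (S `\` A i)))).
  apply: le_measure; rewrite ?inE//.
    by apply: measurableU => //; exact: measurableD.
  by move=> x Sx; have [Ax|nAx] := pselect (A i x); [left|right].
apply: (@le_trans _ _ (mu (A i) + mu (S `\` A i))%E).
  by apply: measureU2 => //; exact: measurableD.
rewrite leeD2l//; apply: IH; first exact: measurableD.
move=> x [Sx nAx]; have [j] := cov x Sx.
by rewrite inE => /orP[/eqP -> //|js Aj]; exists j.
Qed.

Lemma measure_pack_seq (d : measure_display) (T : measurableType d)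
    (R : realType) (mu : {measure set T -> \bar R}) (I : eqType) (s : seq I)
    (A : I -> set T) (S : set T) :
  measurable S -> (forall i, measurable (A i)) -> uniq s ->
  (forall i j x, i \in s -> j \in s -> A i x -> A j x -> i = j) ->
  (forall i, i \in s -> A i `<=` S) ->
  (\sum_(i <- s) mu (A i) <= mu S)%E.
Proof.
move=> mS mA; elim: s S mS => [|i s IH] S mS us dis sub; first by rewrite big_nil.
have /andP[nis {}us] := us.
rewrite big_cons (_ : S = A i `|` (S `\` A i)); last first.
  apply/seteqP; split=> [x Sx|x [Ax|[]//]].
    by have [Ax|nAx] := pselect (A i x); [left|right].
  by apply: (sub i) => //; rewrite mem_head.
rewrite measureU//; last 2 first.
- exact: measurableD.
- by apply/seteqP; split => // x [? []].
rewrite leeD2l//; apply: IH => //; first exact: measurableD.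
  by move=> j k x js ks; apply: dis; rewrite in_cons ?js ?ks orbT.
move=> j js x Ajx; split; first by apply: (sub j) => //; rewrite in_cons js orbT.
move=> Aix; have ij : i = j.
  by apply: (dis i j x) => //; rewrite in_cons ?eqxx// js orbT.
by move: nis; rewrite ij js.
Qed.

Lemma open_borel (T : ptopologicalType) (U : set T) :
  open U -> measurable (U : set (borel T)).
Proof. exact: sub_gen_smallest. Qed.

Lemma closed_borel (T : ptopologicalType) (U : set T) :
  closed U -> measurable (U : set (borel T)).
Proof.
move=> cU; rewrite -(setCK U); apply: measurableC; apply: open_borel.
exact: closed_openC.
Qed.

Lemma sume_const (R : realType) (I : Type) (s : seq I) (x : \bar R) :
  (\sum_(i <- s) x = (size s)%:R%:E * x)%E.
Proof.
elim: s => [|i s IH]; first by rewrite big_nil mul0e.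
by rewrite big_cons IH /= -add1n natrD EFinD ge0_muleDl ?lee_fin// mul1e.
Qed.

Lemma card_dffun_ord (n : nat) (m : 'I_n -> nat) :
  #|{dffun forall i : 'I_n, 'I_(m i)}| = (\prod_i m i)%N.
Proof.
rewrite card_dep_ffun foldrE big_map big_enum.
by apply: eq_bigr => i _; rewrite card_ord.
Qed.

Section HaarBoxes.
Variables (R : realType) (n : nat) (G : topologicalGroupType).
Variable K : local_coords R n G.
Variable mu : {measure set (borel G) -> \bar R}.
Hypothesis mu_haar : haar_measure mu.

Local Notation L := (lc_lip K).

Definition box (l : 'I_n -> R) : set G :=
  [set x | lc_dom K x /\ forall i, `|lc_map K x ord0 i| < l i].

Lemma box_cube (s : R) : 0 < s -> box (fun=> s) = cube K s.
Proof.
move=> s0; apply/seteqP; split => x [dx kx]; split => //.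
  exact: (iffRL (rV_norm_ltP _ s0)).
exact: (iffLR (rV_norm_ltP _ s0)).
Qed.

Lemma box_open (l : 'I_n -> R) : open (box l).
Proof.
pose B := [set u : 'rV[R]_n | forall i, `|u ord0 i| < l i].
have -> : box l = [set x | lc_dom K x /\ B (lc_map K x)] by [].
apply: open_restrict_preimage; [exact: lc_dom_open| |exact: lc_map_continuous].
rewrite openE => u Bu.
suff H : forall i, \forall v \near u, `|(v : 'rV[R]_n) ord0 i| < l i.
  exact: (filter_forall (nbhs_filter u) H).
move=> i.
have : open [set v : 'rV[R]_n | `|v ord0 i| < l i].
  have -> : [set v : 'rV[R]_n | `|v ord0 i| < l i] =
    (fun v : 'rV[R]_n => `|v ord0 i|) @^-1` [set x | x < l i] by [].
  apply: open_comp => [v _|]; last exact: open_lt.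
  apply: (@cvg_comp _ _ _ (fun v : 'rV[R]_n => v ord0 i) (fun x => `|x|)
    (nbhs v) (nbhs (v ord0 i))); [exact: coord_continuous|exact: norm_continuous].
by move=> oB; apply: open_nbhs_nbhs.
Qed.

Lemma haar_lmul (x : G) (U : set G) : open U ->
  mu [set (x * y)%g | y in U] = mu U.
Proof. by move=> oU; case: mu_haar => H _ _; apply: H; exact: open_borel. Qed.

(** Coverings translate points back by the inverse of a centre, and this inverse must lie where the
    Lipschitz bound holds. *)
Definition inv_radius (r : R) : Prop :=
  [/\ 0 < r, r <= lc_rad K & forall x, cube K r x -> cube K (lc_rad K) x^-1%g].

Lemma inv_radius_exists : exists r, inv_radius r.
Proof.
have W1 : nbhs (1%g : G) [set x | cube K (lc_rad K) x^-1%g].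
  apply: (@invg_continuous G 1%g); rewrite invg1; apply: cube_nbhs1.
  exact: lc_rad_gt0.
have [r [r0 rr Hr]] := cube_base K W1.
by exists r; split.
Qed.

(** A grid of mesh [d] starting at the corner of the box has at most
    [2 * l i / d + 1 <= 3 * l i / d] points in direction [i]. Every point is within [d] of the grid
    point below it, and translating that grid point to the identity costs a factor [L]; the
    remaining factor 2 makes the inequality strict, as open cubes require. *)
Lemma box_cover (r d : R) (l : 'I_n -> R) : inv_radius r -> 0 < d -> d < r ->
  (forall i, d <= l i < r) ->
  (mu (box l) <= (\prod_i (3 * l i / d))%:E * mu (cube K (2 * L * d)))%E.
Proof.
move=> [r0 rr rV] d0 dr dl.
have l0 i : 0 < l i by have /andP[/(lt_le_trans d0)] := dl i.
have lr i : l i < r by have /andP[] := dl i.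
pose m i := (Num.truncn (2 * l i / d)).+1.
pose J := {dffun forall i : 'I_n, 'I_(m i)}.
pose u (f : J) : 'rV[R]_n := \row_i ((f i)%:R * d - l i).
pose X f := lc_inv K (u f).
have ld0 i : 0 <= 2 * l i / d by rewrite divr_ge0// ?mulr_ge0// ltW.
have ur f : `|u f| < r.
  apply: (iffRL (rV_norm_ltP _ r0)) => i; rewrite mxE.
  apply: (le_lt_trans _ (lr i)); rewrite ler_norml.
  rewrite lerBrDr addrC subrr mulr_ge0 ?(ltW d0)//=.
  rewrite lerBlDr -ler_pdivlMr// (_ : l i + l i = 2 * l i); last by ring.
  rewrite -truncn_ge_nat//.
  by have := ltn_ord (f i); rewrite ltnS.
have Xr f : cube K r (X f) by exact: cube_inv.
have oC : open (cube K (2 * L * d)) by exact: cube_open.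
apply: (@le_trans _ _ (\sum_(f <- enum J)
    mu [set (X f * y)%g | y in cube K (2 * L * d)])%E).
  apply: measure_cover_seq.
  - by apply: open_borel; exact: box_open.
  - by move=> f; apply: open_borel; exact: lmul_open.
  move=> x [dx kx].
  pose g i := Num.truncn ((lc_map K x ord0 i + l i) / d).
  have ki i : 0 <= lc_map K x ord0 i + l i <= 2 * l i.
    have := kx i; rewrite ltr_norml => /andP[h1 h2].
    by apply/andP; split; [rewrite -lerBlDr sub0r ltW|rewrite [2 * _]mulrDl !mul1r lerD2r ltW].
  have gm i : (g i < m i)%N.
    rewrite ltnS; apply: le_truncn; rewrite ler_pM2r ?invr_gt0//.
    by have /andP[] := ki i.
  exists [ffun i => Ordinal (gm i)] => /=; first by rewrite mem_enum.
  set f := [ffun i => _].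
  exists ((X f)^-1 * x)%g; last by rewrite mulVKg.
  have rx : cube K (lc_rad K) x.
    split => //; apply: lt_le_trans rr.
    by apply: (iffRL (rV_norm_ltP _ r0)) => i; exact: lt_trans (lr i).
  have [dXx] := lip_lmul (rV _ (Xr f)) rx (cube_sub rr (Xr f)).
  rewrite mulVg lc_map1 subr0 => H; split => //.
  apply: (le_lt_trans H); apply: (@le_lt_trans _ _ (L * d)); last first.
    rewrite -mulrA [2 * _]mulrDl !mul1r ltrDl mulr_gt0//; exact: lc_lip_gt0.
  rewrite ler_pM2l ?lc_lip_gt0//.
  apply: (iffRL (rV_norm_leP _ (ltW d0))) => i.
  rewrite /X lc_invK ?(lt_le_trans (ur f))// !mxE ffunE /= /g.
  set t := lc_map K x ord0 i.
  have /andP[h0 _] := ki i; rewrite -/t in h0.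
  have := truncn_itv (divr_ge0 h0 (ltW d0)); set q := Num.truncn _.
  rewrite ler_pdivlMr// ltr_pdivrMr// -natr1 mulrDl mul1r => /andP[h1 h2].
  rewrite opprB addrA ger0_norm; last by rewrite subr_ge0.
  by rewrite lerBlDr [leRHS]addrC ltW.
rewrite (eq_bigr (fun=> mu (cube K (2 * L * d)))) => [|f _]; last first.
  exact: haar_lmul.
rewrite sume_const -cardE card_dffun_ord natr_prod.
apply: lee_wpmul2r; first exact: measure_ge0.
rewrite lee_fin; apply: ler_prod => i _; rewrite ler0n/= /m -natr1.
have /andP[h _] := truncn_itv (ld0 i).
have h1 : 1 <= l i / d by rewrite ler_pdivlMr// mul1r; have /andP[] := dl i.
by apply: (le_trans (lerD h h1)); rewrite -mulrDl ler_pM2r ?invr_gt0//; lra.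
Qed.

(** Translates of a cube of radius [d / (2 * L)] to grid points stay within [d / 2] of them, hence
    are disjoint. Rounding [l i / d >= 1] down loses at most a factor 2. *)
Lemma box_pack (r d : R) (l : 'I_n -> R) : inv_radius r -> 0 < d -> d < r ->
  (forall i, d <= l i < r) ->
  ((\prod_i (l i / (2 * d)))%:E * mu (cube K (d / (2 * L))) <= mu (box l))%E.
Proof.
move=> [r0 rr rV] d0 dr dl.
have L0 : 0 < L := lc_lip_gt0 K.
have l0 i : 0 < l i by have /andP[/(lt_le_trans d0)] := dl i.
have lr i : l i < r by have /andP[] := dl i.
have ld i : 1 <= l i / d by rewrite ler_pdivlMr// mul1r; have /andP[] := dl i.
pose m i := Num.truncn (l i / d).
pose J := {dffun forall i : 'I_n, 'I_(m i)}.
pose u (f : J) : 'rV[R]_n := \row_i ((f i)%:R * d).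
pose X f := lc_inv K (u f).
have ful (f : J) i : (f i : nat)%:R * d + d <= l i.
  rewrite -{2}(mul1r d) -mulrDl natr1 -ler_pdivlMr//.
  rewrite -truncn_ge_nat; last exact: le_trans ler01 (ld i).
  by have := ltn_ord (f i).
have ur f : `|u f| < r.
  apply: (iffRL (rV_norm_ltP _ r0)) => i; rewrite mxE.
  apply: (le_lt_trans _ (lr i)); rewrite ger0_norm ?mulr_ge0 ?(ltW d0)//.
  by apply: le_trans (ful f i); rewrite lerDl ltW.
have Xr f : cube K r (X f) by exact: cube_inv.
have dL0 : 0 < d / (2 * L) by rewrite divr_gt0// mulr_gt0.
have dLr : d / (2 * L) <= lc_rad K.
  apply: le_trans rr; apply: le_trans (ltW dr).
  rewrite ler_pdivrMr ?mulr_gt0// ler_peMr ?(ltW d0)//.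
  by have := lc_lip_ge1 K; lra.
have near (f : J) y : cube K (d / (2 * L)) y -> lc_dom K (X f * y)%g /\
    forall i, `|lc_map K (X f * y)%g ord0 i - (f i : nat)%:R * d| < d / 2.
  move=> hy; have [dy ky] := hy.
  have [dXy H] := lip_lmul (cube_sub rr (Xr f)) (cube_sub dLr hy)
    (cube1 K (lc_rad_gt0 K)).
  split => // i; apply: (@le_lt_trans _ _ (L * `|lc_map K y|)); last first.
    by rewrite mulrC -ltr_pdivlMr// -mulrA -invfM.
  move: H; rewrite mulg1 lc_map1 subr0 {2}/X lc_invK ?(lt_le_trans (ur f))// => H.
  apply: le_trans H; have := rV_norm_coord (lc_map K (X f * y)%g - u f) i.
  by rewrite !mxE.
have oC : open (cube K (d / (2 * L))) by exact: cube_open.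
apply: (@le_trans _ _ (\sum_(f <- enum J)
    mu [set (X f * y)%g | y in cube K (d / (2 * L))])%E); last first.
  apply: measure_pack_seq.
  - by apply: open_borel; exact: box_open.
  - by move=> f; apply: open_borel; exact: lmul_open.
  - exact: enum_uniq.
  - move=> f g _ _ _ [y hy <-] [z hz E]; apply/ffunP => i; apply/val_inj.
    have [_ /(_ i) H1] := near f y hy; have [_ /(_ i)] := near g z hz.
    rewrite E => H2; apply/eqP; rewrite eqn_leq; move: H1 H2.
    set t := lc_map _ _ _ _; rewrite !ltr_norml => /andP[a1 a2] /andP[b1 b2].
    have H (p q : nat) : - (d / 2) < t - p%:R * d -> t - q%:R * d < d / 2 -> (p <= q)%N.
      move=> h1 h2; rewrite -ltnS -(ltr_nat R) -(ltr_pM2r d0) -natr1; lra.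
    by rewrite (H (f i) (g i))// (H (g i) (f i)).
  - move=> f _ _ [y hy <-]; have [dXy H] := near f y hy; split => // i.
    have := H i; have := ful f i; rewrite !ltr_norml.
    set t := lc_map _ _ _ _; move=> h1 /andP[h2 h3].
    have h4 : 0 <= (f i : nat)%:R * d by rewrite mulr_ge0// ltW.
    apply/andP; split; lra.
rewrite (eq_bigr (fun=> mu (cube K (d / (2 * L))))) => [|f _]; last first.
  exact: haar_lmul.
rewrite sume_const -cardE card_dffun_ord natr_prod.
apply: lee_wpmul2r; first exact: measure_ge0.
rewrite lee_fin; apply: ler_prod => i _.
apply/andP; split; first by rewrite divr_ge0// ?mulr_ge0// ltW.
have h0 := ld i; rewrite invfM mulrCA; set x := l i / d in h0 *.
have /andP[_ h] := truncn_itv (le_trans ler01 h0).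
have h2 : 1 <= (m i)%:R :> R by rewrite ler1n -truncn_gt0 in h0 *.
by move: h; rewrite -natr1 -/(m i); lra.
Qed.

(** The cubes covering one box must be those packed in the other: with meshes [d] and [e] this means
    [2 * L * d = e / (2 * L)], so [d = e / (4 * L ^+ 2)]. The meshes cancel and leave 3 * 4 * 2 =
    24. *)
Lemma box_ratio (r : R) (l l' : 'I_n -> R) : inv_radius r ->
  (forall i, 0 < l i < r) -> (forall i, 0 < l' i < r) ->
  (mu (box l) <= (\prod_i (24 * L ^+ 2 * (l i / l' i)))%:E * mu (box l'))%E.
Proof.
move=> rP hl hl'; have [r0 rr rV] := rP.
have L0 : 0 < L := lc_lip_gt0 K.
have L1 : 1 <= L := lc_lip_ge1 K.
have l0 i : 0 < l i by have /andP[] := hl i.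
have l'0 i : 0 < l' i by have /andP[] := hl' i.
have lr i : l i < r by have /andP[] := hl i.
have l'r i : l' i < r by have /andP[] := hl' i.
(* A closed form for a number below [r] and below all the sides. *)
pose e := (1 + 2 / r + (\sum_i (l i)^-1 + \sum_i (l' i)^-1))^-1.
have S1 : 0 <= \sum_i (l i)^-1 by apply: sumr_ge0 => i _; rewrite invr_ge0 ltW.
have S2 : 0 <= \sum_i (l' i)^-1 by apply: sumr_ge0 => i _; rewrite invr_ge0 ltW.
have r20 : 0 < 2 / r by rewrite divr_gt0.
have e0 : 0 < e by rewrite invr_gt0; lra.
have el i : e <= l i.
  rewrite -[leRHS]invrK lef_pV2 ?posrE ?invr_gt0//; last by lra.
  have := ler_term_sum i (fun j => ltac:(by rewrite invr_ge0 ltW) : 0 <= (l j)^-1).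
  by lra.
have el' i : e <= l' i.
  rewrite -[leRHS]invrK lef_pV2 ?posrE ?invr_gt0//; last by lra.
  have := ler_term_sum i (fun j => ltac:(by rewrite invr_ge0 ltW) : 0 <= (l' j)^-1).
  by lra.
have er : e < r.
  rewrite -[ltRHS]invrK ltf_pV2 ?posrE ?invr_gt0//; last by lra.
  have : 0 < r^-1 by rewrite invr_gt0.
  by lra.
pose d := e / (4 * L ^+ 2).
have L2 : 1 <= L ^+ 2 by exact: exprn_ege1.
have d0 : 0 < d by rewrite divr_gt0//; lra.
have de : d <= e by rewrite ler_pdivrMr ?ler_peMr ?(ltW e0)//; lra.
have prodE : \prod_i (3 * l i / d) =
    \prod_i (24 * L ^+ 2 * (l i / l' i)) * \prod_i (l' i / (2 * e)) :> R.
  rewrite -big_split; apply: eq_bigr => i _ /=; rewrite /d; field.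
  by rewrite !gt_eqF.
apply: (@le_trans _ _ ((\prod_i (3 * l i / d))%:E * mu (cube K (2 * L * d)))%E).
  apply: (box_cover (r := r)) => //; first exact: le_lt_trans er.
  by move=> i; rewrite lr andbT (le_trans de).
rewrite prodE EFinM -muleA; apply: lee_wpmul2l.
  rewrite lee_fin; apply: prodr_ge0 => i _.
  by rewrite !mulr_ge0 ?invr_ge0 ?sqr_ge0// ltW.
have -> : 2 * L * d = e / (2 * L) by rewrite /d; field; rewrite gt_eqF.
by apply: (box_pack (r := r)) => // i; rewrite el' l'r.
Qed.
End HaarBoxes.

(** * Volume growth of quasi-balls *)

Section Translates.
Variables (R : realType) (G : topologicalGroupType).
Variable mu : {measure set (borel G) -> \bar R}.
Hypothesis mu_haar : haar_measure mu.

(** The centres are given by a function [X] so that one list of points serves for a packing and,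
    with [X] a dilation, for its dilated image. *)
Lemma translates_pack (I : eqType) (s : seq I) (X : I -> G) (E T : set G) :
  open E -> measurable (T : set (borel G)) -> uniq s ->
  (forall i j u v, i \in s -> j \in s -> E u -> E v ->
      (X i * u)%g = (X j * v)%g -> i = j) ->
  (forall i u, i \in s -> E u -> T (X i * u)%g) ->
  ((size s)%:R%:E * mu E <= mu T)%E.
Proof.
move=> oE mT us sd sT; rewrite -sume_const.
rewrite (eq_bigr (fun i => mu [set (X i * y)%g | y in E])) => [|x _]; last first.
  by rewrite haar_lmul.
apply: measure_pack_seq => //.
- by move=> x; apply: open_borel; exact: lmul_open.
- by move=> x y z xs ys [u Eu <-] [v Ev] /esym; exact: sd.
- by move=> x xs _ [u Eu <-]; exact: sT.
Qed.

Lemma translates_cover (I : eqType) (s : seq I) (X : I -> G) (E S : set G) :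
  open E -> measurable (S : set (borel G)) ->
  (forall x, S x -> exists2 i, i \in s & exists2 u, E u & x = (X i * u)%g) ->
  (mu S <= (size s)%:R%:E * mu E)%E.
Proof.
move=> oE mS cov; rewrite -sume_const.
rewrite (eq_bigr (fun i => mu [set (X i * y)%g | y in E])) => [|x _]; last first.
  by rewrite haar_lmul.
apply: measure_cover_seq => //.
- by move=> i; apply: open_borel; exact: lmul_open.
- by move=> x /cov[i si [u Eu ->]]; exists i => //; exists u.
Qed.

End Translates.

Lemma compact_borel (T : ptopologicalType) (C : set T) :
  hausdorff_space T -> compact C -> measurable (C : set (borel T)).
Proof. by move=> hT cC; apply: closed_borel; exact: compact_closed. Qed.

Lemma lee_fin_exists (R : realType) (x : \bar R) :
  (0 <= x)%E -> (x < +oo)%E -> exists2 r : R, 0 <= r & x = r%:E.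
Proof.
move=> x0 xoo; exists (fine x); first exact: fine_ge0.
by rewrite fineK// ge0_fin_numE.
Qed.

(** The finite measure of [T] bounds the number of disjoint translates, so a longest packing exists.
    A further centre [x] could be added unless [x * u = y * v] for some centre [y], and this is the
    covering in the conclusion. *)
Lemma maximal_packing (R : realType) (G : topologicalGroupType)
    (mu : {measure set (borel G) -> \bar R}) (S E T : set G) :
  haar_measure mu -> open E -> E !=set0 ->
  measurable (T : set (borel G)) -> (mu T < +oo)%E ->
  (forall x y, S x -> E y -> T (x * y)%g) ->
  exists s : seq G, [/\ uniq s, forall x, x \in s -> S x,
    forall x y u v, x \in s -> y \in s -> E u -> E v ->
      (x * u)%g = (y * v)%g -> x = y &
    forall x, S x -> exists2 y, y \in s &
      exists u v, [/\ E u, E v & x = (y * (u * v^-1))%g]].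
Proof.
move=> muH oE E0 mT Toop STE; have [Hl _ Hp] := muH.
have muE0 : (0 < mu E)%E by exact: Hp.
pose packing (s : seq G) := [/\ uniq s, forall x, x \in s -> S x &
    forall x y u v, x \in s -> y \in s -> E u -> E v ->
      (x * u)%g = (y * v)%g -> x = y].
have bound s : packing s -> ((size s)%:R%:E * mu E <= mu T)%E.
  move=> [us sS sd]; apply: (translates_pack muH (X := id)) => // x u xs.
  by apply: STE; exact: sS.
have [M HM] : exists M, forall s, packing s -> (size s <= M)%N.
  have muEoo : (mu E < +oo)%E \/ (mu E = +oo)%E.
    by case: (mu E) => [r| |]; [left; exact: ltry|right|left].
  have [Efin|Einf] := muEoo.
    have [e Ee] : exists e : R, mu E = e%:E.
      by exists (fine (mu E)); rewrite fineK// ge0_fin_numE.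
    have [t Tt] : exists t : R, mu T = t%:E.
      by exists (fine (mu T)); rewrite fineK// ge0_fin_numE.
    have e0 : 0 < e by move: muE0; rewrite Ee lte_fin.
    exists (Num.truncn (t / e)) => s /bound; rewrite Ee Tt -EFinM lee_fin.
    have t0 : 0 <= t by rewrite -lee_fin -Tt.
    by rewrite -ler_pdivlMr// truncn_ge_nat ?divr_ge0// ltW.
  (* If [E] had infinite measure, only the empty packing would fit into [T]. *)
  exists 0%N => s ps; have := bound _ ps; rewrite Einf.
  case: s {ps} => // x s; rewrite mulry gtr0_sg// mul1e leye_eq => /eqP Ty.
  by rewrite Ty in Toop.
have [s ps smax] : exists2 s, packing s & forall s', packing s' -> (size s' <= size s)%N.
  pose P m := `[< exists2 s, packing s & size s = m >].
  have exP : exists m, P m by exists 0%N; apply/asboolP; exists [::] => //; split.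
  have ubP m : P m -> (m <= M)%N by move=> /asboolP[s /HM sM <-].
  have [m /asboolP[s ps sm] mmax] := ex_maxnP exP ubP.
  by exists s => // s' ps'; rewrite sm; apply: mmax; apply/asboolP; exists s'.
exists s; case: (ps) => us sS sd; split => // x Sx.
apply: contrapT => nex.
have xs : x \notin s.
  apply/negP => xs; apply: nex; exists x => //.
  by have [u Eu] := E0; exists u, u; split => //; rewrite mulgV mulg1.
have := smax (x :: s); rewrite /= ltnn => /(_ _)/negP.
have ndisj y u v : y \in s -> E u -> E v -> (x * u)%g = (y * v)%g -> False.
  move=> ys Eu Ev xy; apply: nex; exists y => //; exists v, u; split => //.
  by rewrite mulgA -xy mulgK.
apply => //; split.
- by rewrite /= xs.
- by move=> y; rewrite inE => /orP[/eqP ->//|]; exact: sS.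
move=> y z u v; rewrite !inE => /orP[/eqP ->|ys] /orP[/eqP ->|zs]// Eu Ev.
- by move=> /(ndisj _ _ _ zs Eu Ev).
- by move=> /esym/(ndisj _ _ _ ys Ev Eu).
- exact: sd.
Qed.

Section BallVolume.
Variables (R : realType) (n : nat) (G : topologicalGroupType).
Variables (K : local_coords R n G) (a : 'I_n -> R) (dil : R -> G -> G).
Hypothesis cG : connected [set: G].
Hypothesis hG : hausdorff_space G.
Hypothesis a_gt0 : forall i, 0 < a i.
Hypothesis dilM : forall l x y, 0 < l -> dil l (x * y)%g = (dil l x * dil l y)%g.
Hypothesis dil_continuous : forall l, 0 < l -> continuous (dil l).
Hypothesis dil_diff : forall l, 0 < l -> diag_diff K (dil l) (fun i => l `^ a i).
Variable mu : {measure set (borel G) -> \bar R}.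
Hypothesis mu_haar : haar_measure mu.

Local Notation L := (lc_lip K).
Local Notation Q := (\sum_i a i).

Let dilVK l x (l0 : 0 < l) : dil l (dil l^-1 x) = x.
Proof. exact: (dilVK cG dilM dil_continuous dil_diff). Qed.

Let dilKV l x (l0 : 0 < l) : dil l^-1 (dil l x) = x.
Proof. exact: (dilKV cG dilM dil_continuous dil_diff). Qed.

Lemma dil_image l (U : set G) : 0 < l -> dil l @` U = dil l^-1 @^-1` U.
Proof.
move=> l0; apply/seteqP; split=> [_ [x Ux <-]|x /= Ux]; first by rewrite /= dilKV.
by exists (dil l^-1 x) => //; rewrite dilVK.
Qed.

Lemma dil_open l (U : set G) : 0 < l -> open U -> open (dil l @` U).
Proof.
move=> l0 oU; rewrite dil_image//; apply: open_comp => // x _.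
by apply: dil_continuous; rewrite invr_gt0.
Qed.

Lemma prod_powR l : 0 < l -> \prod_i l `^ a i = l `^ Q.
Proof.
move=> l0; elim/big_rec2: _ => [|i y z _ ->]; first by rewrite powRr0.
by rewrite powRD//; apply/implyP => _; rewrite gt_eqF.
Qed.

Lemma prod_scaled (c l : R) : 0 < l ->
  \prod_i (c * l `^ a i) = c ^+ n * l `^ Q.
Proof.
by move=> l0; rewrite big_split/= prodr_const card_ord prod_powR.
Qed.

(** The image of a cube lies between the boxes with sides [p i * e / 2] and [2 * (p i * e)]. Only
    [e0] depends on [l]; the constant is that of [box_ratio], with one more factor 2 in each
    direction. *)
Lemma dil_cube : exists2 C : R, 0 < C & forall l, 0 < l ->
  exists2 e0 : R, 0 < e0 & forall e, 0 < e -> e <= e0 ->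
    (mu (dil l @` cube K e) <= (C * l `^ Q)%:E * mu (cube K e))%E /\
    (mu (cube K e) <= (C * (l `^ Q)^-1)%:E * mu (dil l @` cube K e))%E.
Proof.
have [r rP] := inv_radius_exists K.
have [r0 rr _] := rP.
have L0 : 0 < L := lc_lip_gt0 K.
pose c := 24 * L ^+ 2 * 2.
have c0 : 0 < c by rewrite !mulr_gt0// exprn_gt0.
exists (c ^+ n) => [|l l0]; first exact: exprn_gt0.
have lV0 : 0 < l^-1 by rewrite invr_gt0.
pose p i := l `^ a i.
have p0 i : 0 < p i by exact: powR_gt0.
have pV i : l^-1 `^ a i = (p i)^-1.
  by rewrite -[in l^-1]powR_inv1 ?ltW// -powRrM mulN1r powRN.
(* [eps] lies below every [p i], which makes the linearisation error harmless in the outer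
   inclusion, and below [M^-1], which does the same in the inner one. *)
pose eps := (1 + \sum_i (p i)^-1 + \sum_i p i)^-1.
have S1 : 0 <= \sum_i (p i)^-1 by apply: sumr_ge0 => i _; rewrite invr_ge0 ltW.
have S2 : 0 <= \sum_i p i by apply: sumr_ge0 => i _; rewrite ltW.
have eps0 : 0 < eps by rewrite invr_gt0; lra.
have epsp i : eps <= p i.
  rewrite -[leRHS]invrK lef_pV2 ?posrE ?invr_gt0//; last by lra.
  have := ler_term_sum i (fun j => ltac:(by rewrite invr_ge0 ltW) : 0 <= (p j)^-1).
  by lra.
pose M := 1 + \sum_i p i.
have M0 : 0 < M by rewrite /M; lra.
have epsM : eps <= M^-1 by rewrite lef_pV2 ?posrE /M//; lra.
have pM i : p i <= M.
  by have := ler_term_sum i (fun j => ltW (p0 j)); rewrite /M; lra.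
have [s1 s10 H1] := dil_diff l0 eps0.
have [s2 s20 H2] := dil_diff lV0 eps0.
have M20 : 0 < 2 * M + 1 by lra.
(* This keeps the largest box side [2 * (p i * e)] below [r] and all points in the ranges of both
   linearisations; the division by 2 gives strict inequalities. *)
exists (Num.min (Num.min s1 s2) r / 2 / (2 * M + 1)).
  by rewrite !divr_gt0// !lt_min s10 s20.
move=> e e_gt0; set e0 := _ / 2 / _ => ee0.
have e0M : e * (2 * M + 1) < Num.min (Num.min s1 s2) r.
  rewrite -ltr_pdivlMr//; apply: (le_lt_trans ee0); rewrite /e0 ltr_pM2r ?invr_gt0//.
  by rewrite ltr_pdivrMr// mulr_natr mulr2n ltrDl !lt_min s10 s20.
have {e0M} [es1 es2 er] : [/\ e * (2 * M + 1) < s1, e * (2 * M + 1) < s2 &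
    e * (2 * M + 1) < r].
  by move: e0M; rewrite !lt_min => /andP[/andP[]].
have eM0 : 0 < e * M by rewrite mulr_gt0.
have epM i : p i * e <= e * M by rewrite mulrC ler_pM2l.
have cubeE : cube K e = box K (fun=> e) by rewrite box_cube.
have up : dil l @` cube K e `<=` box K (fun i => 2 * (p i * e)).
  move=> _ [y [dy ky] <-].
  have [dly Hy] : lc_dom K (dil l y) /\
    forall i, `|lc_map K (dil l y) ord0 i - p i * lc_map K y ord0 i| <=
      eps * `|lc_map K y|.
    by apply: H1; split => //; lra.
  split => // i.
  rewrite -(subrK (p i * lc_map K y ord0 i) (lc_map K (dil l y) ord0 i)).
  apply: (le_lt_trans (ler_normD _ _)).
  rewrite [2 * _]mulrDl !mul1r; apply: ler_ltD.
    apply: (le_trans (Hy i)); apply: ler_pM => //; exact: ltW.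
  rewrite normrM (gtr0_norm (p0 i)) ltr_pM2l//.
  exact: le_lt_trans (rV_norm_coord _ _) ky.
have down : box K (fun i => p i * e / 2) `<=` dil l @` cube K e.
  move=> y [dy ky]; rewrite dil_image//=.
  have kyM : `|lc_map K y| < e * M.
    apply: (iffRL (rV_norm_ltP _ eM0)) => i; apply: (lt_le_trans (ky i)).
    apply: le_trans (epM i); rewrite ler_pdivrMr// ler_peMr ?mulr_ge0 ?ltW//.
    by rewrite ltr1n.
  have [dly Hy] : lc_dom K (dil l^-1 y) /\
    forall i, `|lc_map K (dil l^-1 y) ord0 i - l^-1 `^ a i * lc_map K y ord0 i| <=
      eps * `|lc_map K y|.
    by apply: H2; split => //; lra.
  have kyM2 : `|lc_map K y| <= e * M / 2.
    apply: (iffRL (rV_norm_leP _ _)) => [|i]; first by rewrite divr_ge0// ltW.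
    apply: (le_trans (ltW (ky i))).
    by rewrite ler_pM2r ?invr_gt0.
  split => //; apply: (iffRL (rV_norm_ltP _ e_gt0)) => i.
  rewrite -(subrK (l^-1 `^ a i * lc_map K y ord0 i) (lc_map K (dil l^-1 y) ord0 i)).
  apply: (le_lt_trans (ler_normD _ _)).
  rewrite [ltRHS]splitr; apply: ler_ltD.
    apply: (le_trans (Hy i)).
    apply: (@le_trans _ _ (M^-1 * (e * M / 2))).
      by apply: ler_pM => //; exact: ltW.
    by rewrite le_eqVlt; apply/orP; left; apply/eqP; field; rewrite gt_eqF.
  rewrite pV normrM (gtr0_norm (_ : 0 < (p i)^-1)) ?invr_gt0//.
  by rewrite ltr_pdivrMl// mulrA.
have mbox l' : measurable (box K l' : set (borel G)).
  by apply: open_borel; exact: box_open.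
have mdil : measurable (dil l @` cube K e : set (borel G)).
  by apply: open_borel; apply: dil_open => //; exact: cube_open.
split.
  apply: (@le_trans _ _ (mu (box K (fun i => 2 * (p i * e))))).
    by apply: le_measure; rewrite ?inE.
  have -> : c ^+ n * l `^ Q = \prod_i (24 * L ^+ 2 * (2 * (p i * e) / e)).
    rewrite -prod_scaled//; apply: eq_bigr => i _; rewrite /c -/(p i).
    by field; rewrite gt_eqF.
  rewrite cubeE; apply: (box_ratio mu_haar rP) => i; apply/andP; split => //.
  - by rewrite !mulr_gt0.
  - by have := epM i; lra.
  - by lra.
have H3 : ((c ^+ n * (l `^ Q)^-1)%R%:E * mu (box K (fun i => p i * e / 2)%R) <=
    (c ^+ n * (l `^ Q)^-1)%R%:E * mu (dil l @` cube K e))%E.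
  apply: lee_wpmul2l; first by rewrite lee_fin mulr_ge0 ?invr_ge0 ?powR_ge0 ?exprn_ge0 ?ltW.
  by apply: le_measure; rewrite ?inE.
apply: le_trans H3.
have -> : c ^+ n * (l `^ Q)^-1 = \prod_i (24 * L ^+ 2 * (e / (p i * e / 2))).
  have lQ : l^-1 `^ Q = (l `^ Q)^-1.
    by rewrite -[in l^-1]powR_inv1 ?ltW// -powRrM mulN1r powRN.
  rewrite -lQ -prod_scaled//; apply: eq_bigr => i _; rewrite /c pV.
  by field; rewrite !gt_eqF.
rewrite cubeE; apply: (box_ratio mu_haar rP) => i; apply/andP; split => //.
- by lra.
- by rewrite divr_gt0// mulr_gt0.
- by have := epM i; lra.
Qed.

Variable N : G -> R.
Hypothesis N_continuous : continuous N.
Hypothesis N_ge0 : forall x, 0 <= N x.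
Hypothesis N_dil : forall l x, 0 < l -> N (dil l x) = l * N x.
Hypothesis N_eq0 : forall x, N x = 0 <-> x = 1%g.

Local Notation B := (quasi_ball N).

Lemma quasi_ball_open r : open (B r).
Proof.
rewrite (_ : B r = N @^-1` [set x | x < r])//.
by apply: open_comp => // x _; exact: N_continuous.
Qed.

(** A maximal packing by cubes yields a covering by the sets of quotients [u * v^-1]. Inverting
    costs a factor [L] and multiplying another, so their coordinates stay below
    [(1 + L ^+ 2) * e <= 2 * L ^+ 2 * e]. *)
Lemma cube_doubling : exists2 D : R, 0 < D & exists2 e0 : R, 0 < e0 &
  forall e, 0 < e -> e <= e0 ->
    (mu (cube K (2 * L ^+ 2 * e)) <= D%:E * mu (cube K e))%E /\
    forall u v, cube K e u -> cube K e v ->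
      cube K (2 * L ^+ 2 * e) (u * v^-1)%g.
Proof.
have [r rP] := inv_radius_exists K.
have [r0 rr rV] := rP.
have L0 : 0 < L := lc_lip_gt0 K.
have L1 : 1 <= L := lc_lip_ge1 K.
have LL : L <= L ^+ 2 by rewrite expr2 ler_peMr// ltW.
pose c := 24 * L ^+ 2 * (2 * L ^+ 2).
exists (c ^+ n); first by rewrite exprn_gt0// !mulr_gt0// exprn_gt0.
exists (r / (4 * L ^+ 2)) => [|e e0]; first by rewrite divr_gt0// mulr_gt0// exprn_gt0.
rewrite ler_pdivlMr ?mulr_gt0 ?exprn_gt0// => er.
have LLe0 : 0 < 2 * L ^+ 2 * e by rewrite !mulr_gt0// exprn_gt0.
have LLer : 2 * L ^+ 2 * e < r by lra.
have LeLL : L * e <= L ^+ 2 * e by rewrite ler_pM2r.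
have eL : e <= L * e by rewrite ler_peMl// ltW.
have e_r : e <= r by lra.
split.
  rewrite -(box_cube K LLe0) -(box_cube K e0).
  have -> : c ^+ n = \prod_(i < n) (24 * L ^+ 2 * (2 * L ^+ 2 * e / e)).
    by rewrite prodr_const card_ord mulfK ?gt_eqF.
  by apply: (box_ratio mu_haar rP) => i; apply/andP; split => //; lra.
move=> u v hu hv.
have hv' := cube_sub e_r hv; have hu' := cube_sub e_r hu.
have c1 : cube K (lc_rad K) 1%g by apply: cube1; exact: lc_rad_gt0.
have hvi := rV _ hv'.
have [dvi] := lip_lmul hvi c1 (cube_sub rr hv').
rewrite mulg1 mulVg lc_map1 subr0 sub0r normrN => H1.
have [duv] := lip_lmul (cube_sub rr hu') hvi c1.
rewrite mulg1 lc_map1 subr0 => H2; split => //.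
rewrite -(subrK (lc_map K u) (lc_map K (u * v^-1)%g)).
apply: (le_lt_trans (ler_normD _ _)).
have [_ ku] := hu; have [_ kv] := hv.
have H3 : `|lc_map K (u * v^-1)%g - lc_map K u| <= L ^+ 2 * e.
  apply: (le_trans H2); rewrite expr2 -mulrA ler_pM2l//.
  by apply: (le_trans H1); rewrite ler_pM2l// ltW.
by lra.
Qed.

Lemma ball_dil l : 0 < l -> B l = dil l @` B 1.
Proof.
move=> l0; rewrite dil_image//.
apply/seteqP; split => x /=; rewrite /quasi_ball/= N_dil ?invr_gt0//.
  by rewrite ltr_pdivrMl// mulr1.
by rewrite ltr_pdivrMl// mulr1.
Qed.

(** The radius [e] of the cubes depends on [l], but the number of centres times the measure of
    [cube K e] is bounded in terms of fixed sets, [U] from below (up to [D]) and [T] from above, so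
    [e] disappears from the constants. *)
Lemma ball_volume : exists c1 c2 : R, [/\ 0 < c1, 0 < c2 &
  forall r, 0 < r -> ((c1 * r `^ Q)%:E <= mu (B r))%E /\
                     (mu (B r) <= (c2 * r `^ Q)%:E)%E].
Proof.
have [C C0 HC] := dil_cube.
have [D D0 [d0 d00 HD]] := cube_doubling.
have L0 : 0 < L := lc_lip_gt0 K.
have L2 : 1 <= L ^+ 2 by apply: exprn_ege1; exact: lc_lip_ge1.
have [H_l H_K H_U] := mu_haar.
have [C1 cC1 BC1] := ball_compact cG a_gt0 dilM dil_continuous dil_diff
  N_continuous N_ge0 N_dil N_eq0 1.
(* A set of finite measure that contains the translates, by points of the unit ball, of all cubes
   inside that ball. *)
pose T := (fun p : G * G => (p.1 * p.2)%g) @` (C1 `*` C1).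
have cT : compact T.
  apply: continuous_compact; last exact: compact_setX.
  by apply: continuous_subspaceT; exact: mulg_continuous.
have mT : measurable (T : set (borel G)) by exact: compact_borel.
have N1 : N 1%g = 0 by apply/N_eq0.
have B1 : nbhs (1%g : G) (B 1).
  apply: open_nbhs_nbhs; split; first exact: quasi_ball_open.
  by rewrite /quasi_ball/= N1.
have [V V1 HV] := mulg3_nbhs1 B1.
have V11 : V 1%g by exact: nbhs_singleton.
have [e1 [e10 _ He1]] := cube_base K V1.
pose U := cube K e1.
have oU : open U by exact: cube_open.
have mU : measurable (U : set (borel G)) by exact: open_borel.
have mB r : measurable (B r : set (borel G)).
  by apply: open_borel; exact: quasi_ball_open.
have UB : U `<=` B 1.
  by move=> x /He1 Vx; rewrite -(mulg1 x) -(mul1g x); exact: HV.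
have mC1 : measurable (C1 : set (borel G)) by exact: compact_borel.
have B1fin : (mu (B 1) < +oo)%E.
  apply: le_lt_trans (H_K _ cC1).
  by apply: le_measure; rewrite ?inE.
have Ufin : (mu U < +oo)%E.
  by apply: le_lt_trans B1fin; apply: le_measure; rewrite ?inE.
have [t t0 tE] := lee_fin_exists (measure_ge0 mu T) (H_K _ cT).
have [u u0 uE] := lee_fin_exists (measure_ge0 mu U) Ufin.
have u_gt0 : 0 < u.
  by rewrite -lte_fin -uE; apply: H_U => //; exists 1%g; exact: cube1.
(* [u] and [t] are the measures of [U] and [T]; [D] passes from the covering cubes to the packed
   ones, [C] through the dilation. [t + 1] is positive whatever [t] is. *)
exists (u / (D * C)), (C * D * (t + 1)); split.
- by rewrite divr_gt0// mulr_gt0.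
- by rewrite !mulr_gt0// ltr_wpDl.
move=> l l0; have [e0 e00 He0] := HC l l0.
have lQ : 0 < l `^ Q by exact: powR_gt0.
pose e := Num.min (Num.min d0 e1) e0 / (2 * L ^+ 2).
have LL0 : 0 < 2 * L ^+ 2 by rewrite mulr_gt0// exprn_gt0.
have e_gt0 : 0 < e by rewrite divr_gt0// !lt_min d00 e10 e00.
have LLe : 2 * L ^+ 2 * e = Num.min (Num.min d0 e1) e0.
  by rewrite /e mulrC divfK// gt_eqF.
have e_le : e <= 2 * L ^+ 2 * e by rewrite ler_peMl ?(ltW e_gt0)//; lra.
have [ed0 ee1 ee0] : [/\ 2 * L ^+ 2 * e <= d0, 2 * L ^+ 2 * e <= e1 & 2 * L ^+ 2 * e <= e0].
  by rewrite LLe !ge_min !lexx ?orbT.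
have [HD1 HD2] := HD e e_gt0 (le_trans e_le ed0).
have [He0a He0b] := He0 e e_gt0 (le_trans e_le ee0).
have [He0c _] := He0 (2 * L ^+ 2 * e) (lt_le_trans e_gt0 e_le) ee0.
have oE : open (cube K e) by exact: cube_open.
have E0 : cube K e !=set0 by exists 1%g; exact: cube1.
have EV : cube K e `<=` V by move=> x /(cube_sub (le_trans e_le ee1)); exact: He1.
have EB : cube K e `<=` B 1.
  by move=> x /EV Vx; rewrite -(mulg1 x) -(mul1g x); exact: HV.
have odl e' : open (dil l @` cube K e').
  apply: dil_open => //; exact: cube_open.
have dil_inj : injective (dil l).
  by move=> x y xy; rewrite -(dilKV x l0) xy dilKV.
have [C2 cC2 BC2] := ball_compact cG a_gt0 dilM dil_continuous dil_diff
  N_continuous N_ge0 N_dil N_eq0 l.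
have mcube e' : measurable (cube K e' : set (borel G)).
  by apply: open_borel; exact: cube_open.
have mdil e' : measurable (dil l @` cube K e' : set (borel G)) by exact: open_borel.
have [x x0 xE] : exists2 x : R, 0 <= x & mu (cube K e) = x%:E.
  apply: lee_fin_exists => //.
  by apply: le_lt_trans B1fin; apply: le_measure; rewrite ?inE.
rewrite xE in HD1 He0a He0b.
have [y y0 yE] : exists2 y : R, 0 <= y & mu (cube K (2 * L ^+ 2 * e)) = y%:E.
  apply: lee_fin_exists => //; apply: (le_lt_trans HD1).
  by rewrite -EFinM ltry.
rewrite yE in HD1 He0c.
have [z z0 zE] : exists2 z : R, 0 <= z & mu (dil l @` cube K e) = z%:E.
  apply: lee_fin_exists => //; apply: (le_lt_trans He0a).
  by rewrite -EFinM ltry.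
have [z2 z20 z2E] : exists2 z : R, 0 <= z &
    mu (dil l @` cube K (2 * L ^+ 2 * e)) = z%:E.
  apply: lee_fin_exists => //; apply: (le_lt_trans He0c).
  by rewrite -EFinM ltry.
have [b b0 bE] : exists2 b : R, 0 <= b & mu (B l) = b%:E.
  apply: lee_fin_exists => //; apply: le_lt_trans (H_K _ cC2).
  by apply: le_measure; rewrite ?inE//; exact: compact_borel.
have yx : y <= D * x by rewrite -EFinM lee_fin in HD1.
have xz : x <= C / l `^ Q * z by rewrite zE -EFinM lee_fin in He0b.
have z2y : z2 <= C * l `^ Q * y by rewrite z2E -EFinM lee_fin in He0c.
split.
  (* Lower bound: the packed cubes lie in the unit ball, so their images are disjoint in [B l],
     while the enlarged cubes cover [U]. *)
  have STE x' y' : U x' -> cube K e y' -> B 1 (x' * y')%g.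
    by move=> /He1 Ux /EV Vy; rewrite -(mul1g x'); exact: HV.
  have [s [us sU sd sc]] := maximal_packing mu_haar oE E0 (mB 1) B1fin STE.
  have P1 : (mu U <= (size s)%:R%:E * mu (cube K (2 * L ^+ 2 * e)))%E.
    apply: (translates_cover mu_haar (X := id)) => //; first exact: cube_open.
    move=> p /sc[q qs [v [w [hv hw ->]]]]; exists q => //.
    by exists (v * w^-1)%g => //; exact: HD2.
  have P2 : ((size s)%:R%:E * mu (dil l @` cube K e) <= mu (B l))%E.
    apply: (translates_pack mu_haar (X := dil l)) => //.
      move=> i j _ _ is_ js [v hv <-] [w hw <-]; rewrite -!dilM//.
      by move=> /dil_inj; exact: sd.
    move=> i _ is_ [v hv <-]; rewrite -dilM// ball_dil//; exists (i * v)%g => //.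
    by apply: STE => //; exact: sU.
  move: P1 P2; rewrite uE yE zE bE -!EFinM !lee_fin => P1 P2.
  rewrite mulrAC ler_pdivrMr ?mulr_gt0// -ler_pdivlMr//.
  apply: (le_trans P1).
  apply: (@le_trans _ _ ((size s)%:R * (D * (C / l `^ Q * z)))).
    apply: ler_wpM2l => //; apply: (le_trans yx); rewrite ler_pM2l//.
  rewrite [leLHS](_ : _ = D * C / l `^ Q * ((size s)%:R * z)); last by ring.
  rewrite [leRHS](_ : _ = D * C / l `^ Q * b); last by ring.
  by rewrite ler_pM2l// divr_gt0// mulr_gt0.
(* Upper bound: the enlarged cubes cover the unit ball, so their images cover [B l], while the
   packed cubes fit into [T]. *)
have STE x' y' : B 1 x' -> cube K e y' -> T (x' * y')%g.
  by move=> /BC1 Cx /EB/BC1 Cy; exists (x', y').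
have [s [us sU sd sc]] := maximal_packing mu_haar oE E0 mT (H_K _ cT) STE.
have P1 : ((size s)%:R%:E * mu (cube K e) <= mu T)%E.
  apply: (translates_pack mu_haar (X := id)) => // i v is_; apply: STE; exact: sU.
have P2 : (mu (B l) <= (size s)%:R%:E * mu (dil l @` cube K (2 * L ^+ 2 * e)))%E.
  apply: (translates_cover mu_haar (X := dil l)) => //.
  move=> p; rewrite ball_dil// => -[p' /sc[q qs [v [w [hv hw pE]]]] <-].
  exists q => //; exists (dil l (v * w^-1)%g); last by rewrite pE (dilM q).
  by exists (v * w^-1)%g => //; exact: HD2.
move: P1 P2; rewrite xE z2E tE bE -!EFinM !lee_fin => P1 P2.
apply: (le_trans P2).
apply: (@le_trans _ _ ((size s)%:R * (C * l `^ Q * (D * x)))).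
  apply: ler_wpM2l => //; apply: (le_trans z2y).
  by rewrite ler_wpM2l// mulr_ge0// ltW.
rewrite [leLHS](_ : _ = C * D * l `^ Q * ((size s)%:R * x)); last by ring.
rewrite [leRHS](_ : _ = C * D * l `^ Q * (t + 1)); last by ring.
rewrite ler_pM2l ?mulr_gt0//.
by apply: (le_trans P1); rewrite lerDl.
Qed.

End BallVolume.

(** * Signed integrals and dyadic bounds *)

(** Valid without integrability: the positive part grows, the negative part shrinks, and the
    convention that oo - oo is [-oo] respects this order. *)
Lemma le_integral_signed (d : measure_display) (T : measurableType d)
    (R : realType) (mu : {measure set T -> \bar R}) (D : set T)
    (f g : T -> \bar R) :
  measurable D -> measurable_fun D f -> measurable_fun D g ->
  (forall x, D x -> (f x <= g x)%E) ->
  (\int[mu]_(x in D) f x <= \int[mu]_(x in D) g x)%E.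
Proof.
move=> mD mf mg fg; rewrite [leLHS]integralE [leRHS]integralE; apply: leeB.
  apply: ge0_le_integral => //; try exact: measurable_funepos.
  by move=> x Dx; rewrite !funeposE ge_max !le_max lexx orbT andbT fg.
apply: ge0_le_integral => //; try exact: measurable_funeneg.
by move=> x Dx; rewrite !funenegE ge_max !le_max lexx orbT andbT leeN2 fg.
Qed.

(** Only [g] is integrable. Subadditivity of the positive and negative parts, applied to [f + g] and
    to [f = (f + g) - g], shows that the same parts of [f] and [f + g] are infinite, so both sides
    agree even when they take the value of oo - oo. *)
Lemma integralD_integrable (d : measure_display) (T : measurableType d)
    (R : realType) (mu : {measure set T -> \bar R}) (D : set T)
    (f g : T -> R) :
  measurable D -> measurable_fun D f -> mu.-integrable D (EFin \o g) ->
  (\int[mu]_(x in D) (f x + g x)%:E =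
   \int[mu]_(x in D) (f x)%:E + \int[mu]_(x in D) (g x)%:E)%E.
Proof.
move=> mD mf ig.
have mg : measurable_fun D g by apply/measurable_EFinP; exact: measurable_int ig.
pose P (h : T -> R) := (\int[mu]_(x in D) (EFin \o h)^\+ x)%E.
pose M (h : T -> R) := (\int[mu]_(x in D) (EFin \o h)^\- x)%E.
have P0 h : (0 <= P h)%E by apply: integral_ge0.
have M0 h : (0 <= M h)%E by apply: integral_ge0.
have IE h : (\int[mu]_(x in D) (h x)%:E = P h - M h)%E by rewrite integralE.
have Pg : (P g < +oo)%E.
  by have := integrable_pos_fin_num mD ig; rewrite fin_numElt => /andP[].
have Mg : (M g < +oo)%E.
  by have := integrable_neg_fin_num mD ig; rewrite fin_numElt => /andP[].
have Padd (h k : T -> R) : measurable_fun D h -> measurable_fun D k ->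
    (P (fun x => h x + k x)%R <= P h + P k)%E.
  move=> mh mk; rewrite -ge0_integralD//.
  - apply: ge0_le_integral => //.
    + by apply: measurable_funepos; apply/measurable_EFinP; exact: measurable_funD.
    + by apply: emeasurable_funD; apply: measurable_funepos; exact/measurable_EFinP.
    + move=> x _; rewrite !funeposE /= -!EFin_max lee_fin.
      by rewrite /Num.max; case: ifP; case: ifP; case: ifP; lra.
  - by apply: measurable_funepos; exact/measurable_EFinP.
  - by apply: measurable_funepos; exact/measurable_EFinP.
have Madd (h k : T -> R) : measurable_fun D h -> measurable_fun D k ->
    (M (fun x => h x + k x)%R <= M h + M k)%E.
  move=> mh mk; rewrite -ge0_integralD//.
  - apply: ge0_le_integral => //.
    + by apply: measurable_funeneg; apply/measurable_EFinP; exact: measurable_funD.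
    + by apply: emeasurable_funD; apply: measurable_funeneg; exact/measurable_EFinP.
    + move=> x _; rewrite !funenegE /= -!EFin_max lee_fin.
      by rewrite /Num.max; case: ifP; case: ifP; case: ifP; lra.
  - by apply: measurable_funeneg; exact/measurable_EFinP.
  - by apply: measurable_funeneg; exact/measurable_EFinP.
have mfg : measurable_fun D (fun x => f x + g x)%R by exact: measurable_funD.
have mNg : measurable_fun D (fun x => - g x)%R by exact: measurable_funN.
have PN : P (fun x => - g x)%R = M g.
  by apply: eq_integral => x _; rewrite funeposE funenegE /= EFinN.
have MN : M (fun x => - g x)%R = P g.
  by apply: eq_integral => x _; rewrite funeposE funenegE /= opprK.
have fE : (fun x => f x + g x + - g x) = f by apply/funext => x; rewrite addrK.
have H1 := Padd _ _ mf mg; have H2 := Madd _ _ mf mg.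
have H3 := Padd _ _ mfg mNg; have H4 := Madd _ _ mfg mNg.
rewrite fE in H3 H4; rewrite PN in H3; rewrite MN in H4.
have [fi|] := pselect (P f < +oo /\ M f < +oo)%E.
  have intf : mu.-integrable D (EFin \o f).
    apply/integrableP; split; first exact/measurable_EFinP.
    rewrite (eq_integral (fun x => (EFin \o f)^\+ x + (EFin \o f)^\- x)%E); last first.
      by move=> x _; rewrite -[LHS]/((abse \o (EFin \o f)) x) fune_abse.
    rewrite ge0_integralD//; last 2 first.
    - by apply: measurable_funepos; exact/measurable_EFinP.
    - by apply: measurable_funeneg; exact/measurable_EFinP.
    by apply: lte_add_pinfty; [case: fi|case: fi].
  by rewrite -integralD.
move=> nfi; rewrite !IE.
have [Mf|Mf] := ltP (M f) +oo%E; last first.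
  have Mfy : M f = +oo%E by apply/eqP; rewrite -leye_eq.
  have Mfgy : M (fun x => f x + g x)%R = +oo%E.
    apply/eqP; rewrite -leye_eq leNgt; apply/negP => h.
    have : (M f < +oo)%E by apply: (le_lt_trans H4); exact: lte_add_pinfty.
    by rewrite Mfy.
  by rewrite Mfy Mfgy !addeNy addNye.
have Pfy : P f = +oo%E.
  apply/eqP; rewrite -leye_eq leNgt; apply/negP => h; exact: nfi.
have Pfgy : P (fun x => f x + g x)%R = +oo%E.
  apply/eqP; rewrite -leye_eq leNgt; apply/negP => h.
  have : (P f < +oo)%E by apply: (le_lt_trans H3); exact: lte_add_pinfty.
  by rewrite Pfy.
have Mfg : (M (fun x => f x + g x)%R < +oo)%E.
  by apply: (le_lt_trans H2); exact: lte_add_pinfty.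
have [r1 _ E1] := lee_fin_exists (M0 _) Mf.
have [r2 _ E2] := lee_fin_exists (M0 _) Mfg.
have [r3 _ E3] := lee_fin_exists (P0 _) Pg.
have [r4 _ E4] := lee_fin_exists (M0 _) Mg.
by rewrite Pfy Pfgy E1 E2 E3 E4.
Qed.

Lemma dyadic_scale (R : realType) (x : R) : 1 <= x ->
  exists k : nat, 2 ^+ k <= x < 2 ^+ k.+1.
Proof.
move=> x1.
have ex : exists m, x < 2 ^+ m.
  exists (Num.truncn x).+1; apply: (lt_trans (truncnS_gt x)).
  by rewrite -natrX ltr_nat ltn_expl.
have := ex_minnP ex; case=> -[|k]; first by rewrite expr0 ltNge x1.
move=> xk kmin; exists k; rewrite xk andbT leNgt; apply/negP => /kmin.
by rewrite ltnn.
Qed.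

Lemma geometric_nneseries_le (R : realType) (c q : R) : 0 <= c -> 0 < q < 1 ->
  (\sum_(0 <= k <oo) (c * q ^+ k)%:E <= (c / (1 - q))%:E)%E.
Proof.
move=> c0 /andP[q0 q1]; apply: lime_le.
  by apply: is_cvg_nneseries => k _ _; rewrite lee_fin mulr_ge0// exprn_ge0 ?ltW.
near=> m; rewrite sumEFin lee_fin.
by apply: geometric_le_lim => //; rewrite ger0_norm// ltW.
Unshelve. all: by end_near. Qed.

(** It serves twice: with shrinking balls for the logarithmic singularity at the identity, and with
    growing balls for decay at infinity. *)
Lemma dyadic_integral_le (d : measure_display) (T : measurableType d)
    (R : realType) (mu : {measure set T -> \bar R}) (D : set T) (F : T -> R)
    (A : nat -> set T) (b : nat -> R) (c q : R) :
  measurable D -> measurable_fun D F -> (forall x, D x -> 0 <= F x) ->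
  (forall k, measurable (A k)) -> (forall k, 0 <= b k) -> 0 <= c ->
  0 < q < 1 -> (forall k, (b k)%:E * mu (A k) <= (c * q ^+ k)%:E)%E ->
  (forall x, D x -> exists m : nat, F x <= \sum_(0 <= k < m) b k * \1_(A k) x) ->
  (\int[mu]_(x in D) (F x)%:E <= (c / (1 - q))%:E)%E.
Proof.
move=> mD mF F0 mA b0 c0 q01 bA HF.
have mbA k : measurable_fun D (fun x => (b k * \1_(A k) x)%:E).
  apply/measurable_EFinP; apply: measurable_funM; first exact: measurable_cst.
  exact: measurable_indic.
have bA0 k x : (0 <= (b k * \1_(A k) x)%:E)%E by rewrite lee_fin mulr_ge0.
apply: (@le_trans _ _ (\int[mu]_(x in D)
    \sum_(0 <= k <oo) (b k * \1_(A k) x)%:E)%E).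
  apply: ge0_le_integral => //.
  - exact/measurable_EFinP.
  - by apply: ge0_emeasurable_sum => // k x _ _; exact: bA0.
  - move=> x Dx; have [m Hm] := HF x Dx.
    apply: (@le_trans _ _ (\sum_(0 <= k < m) b k * \1_(A k) x)%:E).
      by rewrite lee_fin.
    by rewrite -sumEFin; apply: nneseries_lim_ge.
rewrite integral_nneseries//.
apply: le_trans (geometric_nneseries_le c0 q01).
apply: lee_nneseries => [k _ _|k _]; first exact: integral_ge0.
apply: le_trans (bA k); under eq_integral do rewrite EFinM.
rewrite ge0_integralZl ?lee_fin//; last exact/measurable_EFinP/measurable_indic.
rewrite integral_indic//; apply: lee_wpmul2l; first by rewrite lee_fin.
by apply: le_measure; rewrite ?inE//; exact: measurableI.
Qed.

Lemma measurable_expeR_comp (d : measure_display) (T : measurableType d)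
    (R : realType) (g : T -> \bar R) :
  measurable_fun setT g -> measurable_fun setT (fun x => expeR (g x)).
Proof.
move=> mg; apply: (measurability _ (ErealGenOInfty.measurableE R)) => _ [_ [y ->] <-].
rewrite setTI.
have [y0|y0] := ltP y 0.
  rewrite (_ : _ @^-1` _ = setT)//; apply/seteqP; split => // x _ /=.
  by rewrite in_itv/= andbT (lt_le_trans _ (expeR_ge0 _))// lte_fin.
have [z zy] := expeR_total (y0 : (0 <= y%:E)%E).
rewrite (_ : _ @^-1` _ = setT `&` [set x | (z < g x)%E]).
  exact: emeasurable_fun_o_infty.
rewrite setTI; apply/seteqP; split => x /=; by rewrite in_itv/= andbT -zy lte_expeR.
Qed.

Lemma continuous_borel_measurable (R : realType) (T : ptopologicalType)
    (f : T -> R) : continuous f -> measurable_fun setT (f : borel T -> R).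
Proof.
move=> cf; apply: (measurability _ (RGenOInfty.measurableE R)) => _ [_ [y ->] <-].
rewrite setTI; apply: open_borel; apply: open_comp => [x _|]; first exact: cf.
exact: interval_open.
Qed.

Section SigmaFiniteTonelli.
Variables (d : measure_display) (T : measurableType d) (R : realType).
Variable mu : {measure set T -> \bar R}.
Hypothesis smu : sigma_finite setT mu.

(** [mu] is a bare measure; its sigma-finiteness, deduced later from the volume bounds, is packed
    here into the structure that Tonelli's theorem expects. *)
Let sfinite_mixin :=
  isSFinite.Build _ _ _ (Measure.sort mu) (sfinite_measure_sigma_finite smu).
Let sigma_finite_mixin := isSigmaFinite.Build _ _ _ (Measure.sort mu) smu.
Let m : {sigma_finite_measure set T -> \bar R} :=
  HB.pack_for (SigmaFiniteMeasure.type T R) (Measure.sort mu)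
    sfinite_mixin sigma_finite_mixin.

Lemma sigma_finite_tonelli (f : T * T -> \bar R) :
  measurable_fun setT f -> (forall z, 0 <= f z)%E ->
  (\int[mu]_x \int[mu]_y f (x, y) = \int[mu]_y \int[mu]_x f (x, y))%E.
Proof. exact: (fubini_tonelli (m1 := m) (m2 := m) f). Qed.

Lemma sigma_finite_measurable_section (f : T * T -> \bar R) :
  measurable_fun setT f -> (forall z, 0 <= f z)%E ->
  measurable_fun setT (fun x => \int[mu]_y f (x, y))%E.
Proof. exact: (measurable_fun_fubini_tonelli_F (m2 := m) f). Qed.

End SigmaFiniteTonelli.

(** * Logarithmic means over quasi-balls *)

(** The group law is left behind: what remains is a Borel measure and a gauge [N] whose balls have
    volume comparable with [r ^ Q]. *)
Section GaugeMean.
Variables (R : realType) (G : ptopologicalType).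
Variables (mu : {measure set (borel G) -> \bar R}) (N : G -> R) (Q c1 c2 : R).
Hypothesis mN : measurable_fun setT (N : borel G -> R).
Hypothesis N_ge0 : forall x, 0 <= N x.
Hypothesis Q_gt0 : 0 < Q.
Hypothesis c1_gt0 : 0 < c1.
Hypothesis c2_gt0 : 0 < c2.

Local Notation B r := (quasi_ball N r : set (borel G)).

Hypothesis ball_lower : forall r, 0 < r -> ((c1 * r `^ Q)%:E <= mu (B r))%E.
Hypothesis ball_upper : forall r, 0 < r -> (mu (B r) <= (c2 * r `^ Q)%:E)%E.

(** Where [N z = 0], the terms [ln (r / N z)] and [(N z)^-1] take default values. This set is null,
    and removing it makes pointwise estimates honest. *)
Definition punctured_ball (r : R) : set (borel G) := [set z | 0 < N z < r].

Local Notation D := punctured_ball.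

Lemma quasi_ball_measurable r : measurable (B r).
Proof.
have -> : B r = N @^-1` `]-oo, r[.
  by apply/seteqP; split => x; rewrite /quasi_ball/= in_itv.
by rewrite -[X in measurable X]setTI; apply: mN => //; exact: measurable_itv.
Qed.

Lemma gauge_zero_measurable : measurable ([set z | N z = 0%R] : set (borel G)).
Proof.
have -> : [set z | N z = 0%R] = N @^-1` [set 0] by [].
by rewrite -[X in measurable X]setTI; apply: mN => //; exact: measurable_set1.
Qed.

Lemma punctured_ballE r : D r = B r `\` [set z | N z = 0%R].
Proof.
apply/seteqP; split=> x /=.
  by move=> /andP[x0 xr]; split => // /eqP; rewrite gt_eqF.
move=> [xr x0]; rewrite /D/= xr andbT lt_neqAle N_ge0 andbT eq_sym.
exact/eqP.
Qed.

Lemma punctured_ball_measurable r : measurable (D r).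
Proof.
rewrite punctured_ballE; apply: measurableD; first exact: quasi_ball_measurable.
exact: gauge_zero_measurable.
Qed.

Hint Resolve quasi_ball_measurable punctured_ball_measurable
  gauge_zero_measurable : core.

Lemma ball_volume_fin r : 0 < r -> exists V : R,
  [/\ 0 < V, c1 * r `^ Q <= V, V <= c2 * r `^ Q & mu (B r) = V%:E].
Proof.
move=> r0; have rQ : 0 < r `^ Q by exact: powR_gt0.
have [|V V0 VE] := lee_fin_exists (measure_ge0 mu (B r)).
  by apply: le_lt_trans (ball_upper r0) _; exact: ltry.
exists V; have := ball_lower r0; have := ball_upper r0.
rewrite VE !lee_fin => h1 h2; split => //.
by apply: lt_le_trans h2; rewrite mulr_gt0.
Qed.

Lemma gauge_zero_null : mu [set z | N z = 0%R] = 0%E.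
Proof.
apply/eqP; rewrite eq_le measure_ge0 andbT leNgt; apply/negP => Z0.
have ZB r : 0 < r -> (mu [set z | N z = 0%R] <= mu (B r))%E.
  move=> r0; apply: le_measure; rewrite ?inE//.
  by move=> z /= z0; rewrite /quasi_ball/= z0.
have [|m m0 mE] := lee_fin_exists (ltW Z0).
  apply: le_lt_trans (ZB 1 ltr01) _.
  by apply: le_lt_trans (ball_upper ltr01) _; exact: ltry.
rewrite mE lte_fin in Z0.
(* The radius at which the upper volume bound equals half of the supposed positive measure [m]. *)
pose r := (m / (2 * c2)) `^ Q^-1.
have mc0 : 0 < m / (2 * c2) by rewrite divr_gt0// mulr_gt0.
have r0 : 0 < r by exact: powR_gt0.
have rQ : r `^ Q = m / (2 * c2).
  by rewrite /r -powRrM mulVf ?gt_eqF// powRr1// ltW.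
have := le_trans (ZB r r0) (ball_upper r0); rewrite mE lee_fin rQ.
have -> : c2 * (m / (2 * c2)) = m / 2 by field; rewrite gt_eqF.
by rewrite ler_pdivlMr// mulr_natr mulr2n gerDl leNgt Z0.
Qed.

Lemma integral_off_zero (A : set (borel G)) (f : borel G -> \bar R) :
  measurable A -> measurable_fun A f ->
  (\int[mu]_(x in A) f x =
   \int[mu]_(x in A `\` [set z | N z = 0%R]) f x)%E.
Proof.
move=> mA mf.
pose Z : set (borel G) := [set z | N z = 0%R].
have mZ : measurable Z by [].
have mAZ : measurable (A `&` Z) by exact: measurableI.
have ge0_case (g : borel G -> \bar R) : measurable_fun A g -> (forall x, 0 <= g x)%E ->
    (\int[mu]_(x in A) g x = \int[mu]_(x in A `\` Z) g x)%E.
  move=> mg g0; rewrite -{1}(setDUK (@subIsetl _ A Z)) setDIr setDv set0U setUC.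
  rewrite ge0_integral_setU//.
  - rewrite [X in (_ + X)%E]null_set_integral ?adde0//.
    + by apply: measurable_funS mg.
    + apply/eqP; rewrite eq_le measure_ge0 andbT -gauge_zero_null.
      by apply: le_measure; rewrite ?inE//; exact: subIsetr.
  - exact: measurableD.
  - by apply: measurable_funS mg => // x [[]//|[]].
  - by rewrite disj_set2E; apply/eqP/seteqP; split => // x [[_ nZ] [_ /nZ]].
rewrite integralE [RHS]integralE; congr (_ - _)%E; apply: ge0_case => //.
- exact: measurable_funepos.
- exact: measurable_funeneg.
Qed.

Lemma integral_punctured r (f : borel G -> \bar R) : measurable_fun (B r) f ->
  (\int[mu]_(x in B r) f x = \int[mu]_(x in D r) f x)%E.
Proof. by move=> mf; rewrite punctured_ballE; exact: integral_off_zero. Qed.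

Lemma punctured_ball_volume r : mu (D r) = mu (B r).
Proof.
have := @integral_punctured r (cst 1%E) (measurable_cst _).
by rewrite !integral_cst// !mul1e.
Qed.

Lemma gauge_sigma_finite : sigma_finite [set: borel G] mu.
Proof.
exists (fun k : nat => B k.+1%:R).
  apply/seteqP; split => // x _; exists (Num.truncn (N x)) => //.
  exact: truncnS_gt.
move=> k; split; first exact: quasi_ball_measurable.
by have [//|V [_ _ _ ->]] := @ball_volume_fin k.+1%:R; rewrite ltry.
Qed.

(** The domain varies with [x], so the integral is read as that of a section of [g] restricted to
    the measurable set of pairs with [N z < N x]. *)
Lemma measurable_ball_integral (g : borel G -> \bar R) :
  measurable_fun setT g -> (forall x, 0 <= g x)%E ->
  measurable_fun setT (fun x : borel G => \int[mu]_(z in B (N x)) g z)%E.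
Proof.
move=> mg g0.
pose E : set (borel G * borel G) := [set p | N p.2 < N p.1].
have mE : measurable E.
  have : measurable_fun setT (fun p : borel G * borel G => N p.2 < N p.1).
    by apply: measurable_fun_ltr; apply: measurableT_comp mN _;
      [exact: measurable_snd|exact: measurable_fst].
  move=> /(_ measurableT [set true] I); rewrite setTI.
  by congr (measurable _); apply/seteqP; split.
have -> : (fun x : borel G => \int[mu]_(z in B (N x)) g z)%E =
    (fun x => \int[mu]_z ((g \o snd) \_ E) (x, z))%E.
  apply/funext => x; rewrite integral_mkcond; apply: eq_integral => z _.
  by rewrite !patchE /= !mem_setE.
apply: (sigma_finite_measurable_section gauge_sigma_finite).
  apply/(measurable_restrictT _ mE); apply: measurable_funS (measurableT) _ _ => //.
  by apply: measurableT_comp => //; exact: measurable_snd.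
by move=> z; rewrite patchE; case: ifP => _ /=; [exact: g0|exact: lexx].
Qed.

Lemma meanE (f : G -> R) x : 0 < N x ->
  mean mu N f x =
  (((fine (mu (B (N x))))^-1)%:E * \int[mu]_(z in B (N x)) (f z)%:E)%E.
Proof.
move=> x0; have [V [V0 _ _ VE]] := ball_volume_fin x0.
by rewrite /mean VE/= inver gt_eqF.
Qed.

Lemma mean0 (f : G -> R) x : N x = 0 -> mean mu N f x = 0%E.
Proof.
move=> x0; rewrite /mean x0 (_ : quasi_ball N 0 = set0); last first.
  by apply/seteqP; split => // z; rewrite /quasi_ball/= ltNge N_ge0.
by rewrite integral_set0 mule0.
Qed.

Lemma measurable_mean (f : G -> R) :
  measurable_fun setT (f : borel G -> R) ->
  measurable_fun setT (mean mu N f : borel G -> \bar R).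
Proof.
move=> mf.
(* At [N x = 0] the ball is empty and both sides vanish, whatever value the inverse of its measure
   takes. *)
have -> : (mean mu N f : borel G -> \bar R) = (fun x =>
  ((fine (\int[mu]_(z in B (N x)) 1)) `^ (-1))%:E *
   (\int[mu]_(z in B (N x)) (EFin \o f)^\+ z -
    \int[mu]_(z in B (N x)) (EFin \o f)^\- z))%E.
  apply/funext => x; rewrite -integralE integral_cst// mul1e.
  have [x0|] := ltP 0 (N x).
    rewrite meanE// powR_inv1//; exact: fine_ge0.
  move=> x0; have {}x0 : N x = 0 by apply/eqP; rewrite eq_le x0 N_ge0.
  rewrite mean0// x0 (_ : quasi_ball N 0 = set0) ?integral_set0 ?mule0//.
  by apply/seteqP; split => // z; rewrite /quasi_ball/= ltNge N_ge0.
have mfE : measurable_fun setT (EFin \o (f : borel G -> R)) by exact/measurable_EFinP.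
apply: emeasurable_funM.
  apply/measurable_EFinP; apply: (measurableT_comp (@measurable_powR R (-1))).
  apply: (measurableT_comp (fine_measurable measurableT)).
  by apply: measurable_ball_integral.
apply: emeasurable_funB; apply: measurable_ball_integral => //.
- exact: measurable_funepos.
- exact: measurable_funeneg.
Qed.

Lemma powR_exprn (x p : R) k : 0 <= x -> (x ^+ k) `^ p = (x `^ p) ^+ k.
Proof.
move=> x0; elim: k => [|k IH]; first by rewrite !expr0 powR1.
by rewrite !exprS powRM ?exprn_ge0// IH.
Qed.

Let q := (2^-1 : R) `^ Q.

Lemma dyadic_ratio : 0 < q < 1.
Proof.
rewrite powR_gt0 ?invr_gt0//= /q /powR gt_eqF ?invr_gt0// -[ltRHS]expR0 ltr_expR.
rewrite pmulr_rlt0// ln_lt0//; apply/andP; split; first by rewrite invr_gt0.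
by rewrite invf_lt1 ?ltr1n.
Qed.

(** On the layer with [2 ^+ k <= r / N z < 2 ^+ k.+1] the logarithm is at most [k + 1] times [ln 2],
    one unit for each of the nested balls containing [z]; the volumes of these balls form a
    geometric series. The factor 2 in their radii turns a weak inequality into membership in an open
    ball. *)
Lemma log_gauge_integral : exists2 K : R, 0 < K & forall r, 0 < r ->
  (\int[mu]_(z in D r) (Q * ln (r / N z))%:E <= (K * r `^ Q)%:E)%E.
Proof.
have /andP[q0 q1] := dyadic_ratio.
have ln2 : 0 < ln 2 :> R by rewrite ln_gt0// ltr1n.
exists (Q * ln 2 * c2 * 2 `^ Q / (1 - q)).
  by rewrite divr_gt0 ?subr_gt0// !mulr_gt0// powR_gt0.
move=> r r0.
have -> : Q * ln 2 * c2 * 2 `^ Q / (1 - q) * r `^ Q =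
    (Q * ln 2 * (c2 * (2 * r) `^ Q)) / (1 - q).
  by rewrite powRM ?ltW// !mulrA mulrAC.
apply: (dyadic_integral_le (A := fun k => B (2 * r * 2^-1 ^+ k))
  (b := fun=> Q * ln 2)) => //.
- apply: measurable_funM; first exact: measurable_cst.
  apply: (measurableT_comp (@measurable_ln R)).
  apply: measurable_funM; first exact: measurable_cst.
  have -> : (fun z => (N z)^-1) = (fun z => N z `^ (-1)).
    by apply/funext => z; rewrite powR_inv1.
  apply: (measurableT_comp (@measurable_powR R (-1))).
  exact: measurable_funTS.
- move=> z /andP[z0 zr]; rewrite mulr_ge0 ?(ltW Q_gt0)// ln_ge0//.
  by rewrite ler_pdivlMr// mul1r ltW.
- by move=> k; rewrite mulr_ge0// ltW.
- by rewrite !mulr_ge0 ?powR_ge0// ltW.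
- exact: dyadic_ratio.
- move=> k.
  have rk : 0 < 2 * r * 2^-1 ^+ k by rewrite !mulr_gt0// exprn_gt0// invr_gt0.
  apply: (@le_trans _ _ ((Q * ln 2)%:E * (c2 * (2 * r * 2^-1 ^+ k) `^ Q)%:E)%E).
    apply: lee_wpmul2l; last exact: ball_upper.
    by rewrite lee_fin mulr_ge0// ltW.
  rewrite -EFinM lee_fin powRM ?mulr_ge0 ?exprn_ge0 ?invr_ge0 ?(ltW r0)//.
  by rewrite powR_exprn ?invr_ge0// !mulrA.
move=> z /andP[z0 zr].
have [|k /andP[k1 k2]] := @dyadic_scale R (r / N z).
  by rewrite ler_pdivlMr// mul1r ltW.
exists k.+1.
rewrite (eq_big_nat _ _ (F2 := fun=> Q * ln 2)) => [|j /andP[_ jk]]; last first.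
  rewrite indicE mem_set ?mulr1// /quasi_ball/=.
  have k1' : N z <= r * 2^-1 ^+ k.
    rewrite exprVn ler_pdivlMr ?exprn_gt0// mulrC -ler_pdivlMr//.
  apply: (le_lt_trans k1').
  apply: (@le_lt_trans _ _ (r * 2^-1 ^+ j)).
    rewrite ler_pM2l//; apply: ler_wiXn2l => //; rewrite ?invr_ge0//.
    by rewrite invf_le1// ler1n.
  by rewrite -mulrA mulr_natl mulr2n ltrDl mulr_gt0// exprn_gt0// invr_gt0.
rewrite sumr_const_nat subn0 -[leRHS]mulr_natr -mulrA.
rewrite ler_pM2l//; apply: (@le_trans _ _ (ln (2 ^+ k.+1))).
  by rewrite ler_ln ?posrE ?divr_gt0 ?exprn_gt0// ltW.
by rewrite lnXn// mulr_natr.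
Qed.

Lemma ln_le_subr1 (y : R) : 0 < y -> ln y <= y - 1.
Proof. by move=> y0; have := @le_ln1Dx R (y - 1); rewrite (addrC 1) subrK; apply; lra. Qed.

Lemma integral_pos (A : set (borel G)) (f : borel G -> R) :
  measurable A -> measurable_fun A f -> (forall x, A x -> 0 < f x) ->
  (0 < mu A)%E -> (0 < \int[mu]_(x in A) (f x)%:E)%E.
Proof.
move=> mA mf f0 muA; rewrite lt_neqAle integral_ge0 ?andbT => [|x Ax]; last first.
  by rewrite lee_fin ltW// f0.
apply/eqP => I0.
have /(ae_eq_integral_abs mu mA) : measurable_fun A (EFin \o f).
  exact/measurable_EFinP.
case=> + _; rewrite (eq_integral (EFin \o f)); last first.
  by move=> x; rewrite inE => Ax; rewrite /= ger0_norm// ltW// f0.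
move=> /(_ (esym I0)) [Y [mY Y0 AY]].
move: muA; rewrite ltNge; apply/negP/negPn; rewrite -Y0.
apply: le_measure; rewrite ?inE// => x Ax; apply: AY => /(_ Ax) [fx0].
by have := f0 x Ax; rewrite fx0 ltxx.
Qed.

(* With [w z = (N z / N x)^Q], Jensen's inequality is applied to [psi f w] and
   not to [psi f]; the mean of [ln (1 / w)] does not depend on [x] up to a
   constant.  This is what produces the weight [N x ^ (-2 Q)]. *)
Lemma exp_mean_ln_le : exists2 K : R, 0 < K &
  forall (f psi : G -> R), positive_function f -> positive_function psi ->
  forall x, 0 < N x ->
  (\int[mu]_z (psi z * f z)%:E < +oo)%E ->
  (expeR (mean mu N (fun z => ln (f z)) x) <=
   expeR (mean mu N (fun z => ln (1 / psi z)) x) *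
   ((K * (N x `^ (2 * Q))^-1)%:E *
    \int[mu]_(z in D (N x)) (N z `^ Q * (psi z * f z))%:E))%E.
Proof.
have [K0 K00 HK0] := log_gauge_integral.
pose K1 := K0 / c1.
exists (expR K1 / c1); first by rewrite divr_gt0// expR_gt0.
move=> f psi [mf f0] [mpsi psi0] x x0 gfin.
set r := N x in x0 *.
have rQ : 0 < r `^ Q by exact: powR_gt0.
have [V [V0 V1 V2 VE]] := ball_volume_fin x0.
pose g (z : borel G) := psi z * f z.
have g0 z : 0 < g z by exact: mulr_gt0.
have mg : measurable_fun setT g by exact: measurable_funM.
pose a (z : borel G) := N z `^ Q * g z.
have mNQ : measurable_fun setT (fun z : borel G => N z `^ Q).
  exact: (measurableT_comp (@measurable_powR R Q)).
have ma : measurable_fun setT a by exact: measurable_funM.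
have a0 z : 0 <= a z by rewrite mulr_ge0 ?powR_ge0// ltW.
have ap z : D r z -> 0 < a z.
  by move=> /andP[z0 _]; rewrite mulr_gt0// powR_gt0.
have Dpos : (0 < mu (D r))%E by rewrite punctured_ball_volume VE lte_fin.
have Ipos := integral_pos (punctured_ball_measurable r) (measurable_funTS ma) ap Dpos.
have Ifin : (\int[mu]_(z in D r) (a z)%:E < +oo)%E.
  apply: (@le_lt_trans _ _ ((r `^ Q)%:E * \int[mu]_z (g z)%:E)%E); last first.
    by apply: lte_mul_pinfty => //; rewrite lee_fin powR_ge0.
  apply: (@le_trans _ _ (\int[mu]_(z in D r) ((r `^ Q)%:E * (g z)%:E))%E).
    apply: ge0_le_integral => //.
    - by move=> z _; rewrite lee_fin.
    - exact/measurable_EFinP/measurable_funTS.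
    - apply: measurable_funTS; apply: emeasurable_funM => //.
      exact/measurable_EFinP.
    - move=> z /andP[z0 zr]; rewrite -EFinM lee_fin ler_wpM2r ?(ltW (g0 z))//.
      by apply: ge0_ler_powR; rewrite ?nnegrE ?(ltW Q_gt0)// ltW.
  rewrite ge0_integralZl//; last 3 first.
  - exact/measurable_EFinP/measurable_funTS.
  - by move=> z _; rewrite lee_fin ltW.
  - by rewrite lee_fin powR_ge0.
  apply: lee_wpmul2l; first by rewrite lee_fin powR_ge0.
  apply: ge0_subset_integral => //; first exact/measurable_EFinP.
  by move=> z _; rewrite lee_fin ltW.
have [I _ IE] := lee_fin_exists (ltW Ipos) Ifin.
have I0 : 0 < I by rewrite -lte_fin -IE.
(* The mean of g w over the ball, hence the point at which Jensen's inequality takes the tangent to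
   [ln]. *)
pose Lam := I / (V * r `^ Q).
have Lam0 : 0 < Lam by rewrite divr_gt0// mulr_gt0.
pose s (z : borel G) := Q * ln (r / N z).
(* The tangent at [Lam], evaluated at g w, plus [s = ln (1 / w)]. Its integrability is what permits
   [h] to be arbitrary. *)
pose k (z : borel G) := a z / (r `^ Q * Lam) + (ln Lam - 1) + s z.
pose h (z : borel G) := ln (1 / psi z).
have mln (u : borel G -> R) : measurable_fun setT u -> measurable_fun setT (fun z => ln (u z)).
  by move=> mu_; apply: (measurableT_comp (@measurable_ln R)).
have mh : measurable_fun setT h.
  have -> : h = (fun z => - ln (psi z)).
    by apply/funext => z; rewrite /h div1r lnV ?posrE.
  by apply: measurable_funN; exact: mln.
have mlf : measurable_fun setT (fun z : borel G => ln (f z)) by exact: mln.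
have ms : measurable_fun setT s.
  apply: measurable_funM; first exact: measurable_cst.
  apply: mln; apply: measurable_funM; first exact: measurable_cst.
  have -> : (fun z => (N z)^-1) = (fun z => N z `^ (-1)).
    by apply/funext => z; rewrite powR_inv1.
  exact: (measurableT_comp (@measurable_powR R (-1))).
have s0 z : D r z -> 0 <= s z.
  move=> /andP[z0 zr]; rewrite mulr_ge0 ?(ltW Q_gt0)// ln_ge0//.
  by rewrite ler_pdivlMr// mul1r ltW.
have fk z : D r z -> ln (f z) <= h z + k z.
  move=> Dz; have /andP[z0 zr] := Dz.
  have NQ : 0 < N z `^ Q by exact: powR_gt0.
  have fE : f z = (psi z)^-1 * ((a z / (r `^ Q * Lam)) * (Lam * (r / N z) `^ Q)).
    rewrite powRM ?invr_ge0 ?(ltW z0) ?(ltW x0)//.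
    have -> : (N z)^-1 `^ Q = (N z `^ Q)^-1.
      by rewrite -powR_inv1 ?ltW// -powRrM mulN1r powRN.
    by rewrite /a /g; field; rewrite !gt_eqF.
  have aL : 0 < a z / (r `^ Q * Lam) by exact: divr_gt0 (ap z Dz) (mulr_gt0 rQ Lam0).
  have rN : 0 < (r / N z) `^ Q by rewrite powR_gt0// divr_gt0.
  have LrN : 0 < Lam * (r / N z) `^ Q by exact: mulr_gt0.
  rewrite fE lnM ?posrE ?invr_gt0//; last exact: mulr_gt0.
  rewrite lnM ?posrE//.
  rewrite [ln (Lam * _)]lnM ?posrE// ln_powR -/(s z) /h div1r lerD2l /k.
  have := ln_le_subr1 aL.
  by lra.
have DE : mu (D r) = V%:E by rewrite punctured_ball_volume VE.
have intcst c : mu.-integrable (D r) (EFin \o cst c).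
  apply/integrableP; split; first exact/measurable_EFinP/measurable_cst.
  rewrite (eq_integral (cst `|c|%:E)); last by move=> z _.
  by rewrite integral_cst// DE -EFinM ltry.
have inta : mu.-integrable (D r) (EFin \o a).
  apply/integrableP; split; first exact/measurable_EFinP/measurable_funTS.
  by under eq_integral do rewrite /= ger0_norm//.
pose k1 (z : borel G) := a z / (r `^ Q * Lam).
pose cL := ln Lam - 1.
pose k2 (z : borel G) := k1 z + cL.
have intk1 : mu.-integrable (D r) (EFin \o k1).
  have -> : EFin \o k1 = (fun z => ((r `^ Q * Lam)^-1)%R%:E * (EFin \o a) z)%E.
    by apply/funext => z; rewrite /= /k1 mulrC EFinM.
  exact: integrableZl.
have sfin := HK0 r x0.
have ints : mu.-integrable (D r) (EFin \o s).
  apply/integrableP; split; first exact/measurable_EFinP/measurable_funTS.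
  rewrite (eq_integral (EFin \o s)); last first.
    by move=> z; rewrite inE => Dz; rewrite /= ger0_norm// s0.
  by apply: le_lt_trans sfin _; exact: ltry.
have intk2 : mu.-integrable (D r) (EFin \o k2).
  have -> : EFin \o k2 = ((EFin \o k1) \+ (EFin \o cst cL))%E by apply/funext => z.
  exact: integrableD.
have intk : mu.-integrable (D r) (EFin \o k).
  have -> : EFin \o k = ((EFin \o k2) \+ (EFin \o s))%E by apply/funext => z.
  exact: integrableD.
have kI : (\int[mu]_(z in D r) (k z)%:E <= ((ln Lam + K1) * V)%:E)%E.
  have -> : (\int[mu]_(z in D r) (k z)%:E = \int[mu]_(z in D r) (k1 z)%:E +
      \int[mu]_(z in D r) cL%:E + \int[mu]_(z in D r) (s z)%:E)%E.
    have E2 : (\int[mu]_(z in D r) (k2 z)%:E =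
        \int[mu]_(z in D r) (k1 z)%:E + \int[mu]_(z in D r) cL%:E)%E.
      exact: (integralD _ intk1 (intcst cL)).
    have E1 : (\int[mu]_(z in D r) (k z)%:E =
        \int[mu]_(z in D r) (k2 z)%:E + \int[mu]_(z in D r) (s z)%:E)%E.
      exact: (integralD _ intk2 ints).
    by rewrite E1 E2.
  (* By the choice of [Lam] this cancels the contribution [- V] of the constant [ln Lam - 1]. *)
  have -> : (\int[mu]_(z in D r) (k1 z)%:E = V%:E)%E.
    under eq_integral do rewrite /k1 mulrC EFinM.
    rewrite integralZl// IE -EFinM /Lam; congr (_%:E); field.
    by rewrite !gt_eqF.
  rewrite (integral_cst mu _ cL%:E)// DE -EFinM -EFinD.
  apply: (@le_trans _ _ ((V + cL * V)%:E + (K0 * r `^ Q)%:E)%E).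
    by rewrite leeD2l.
  rewrite -EFinD lee_fin.
  have : K0 * r `^ Q <= K1 * V.
    by rewrite /K1 -mulrA ler_pM2l// ler_pdivlMl.
  by rewrite /cL; lra.
have meanV (u : borel G -> R) : measurable_fun setT u ->
    mean mu N u x = (V^-1%:E * \int[mu]_(z in D r) (u z)%:E)%E.
  move=> mu_; rewrite meanE// -/r VE/= integral_punctured//.
  exact/measurable_EFinP/measurable_funTS.
have mean_le : (mean mu N (fun z => ln (f z)) x <=
    mean mu N (fun z => ln (1 / psi z)) x + (ln Lam + K1)%:E)%E.
  rewrite (meanV (fun z => ln (f z)))// (meanV h)//.
  apply: (@le_trans _ _ (V^-1%:E * (\int[mu]_(z in D r) (h z)%:E + ((ln Lam + K1) * V)%:E))%E).
    apply: lee_wpmul2l; first by rewrite lee_fin invr_ge0 ltW.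
    apply: (@le_trans _ _ (\int[mu]_(z in D r) (h z + k z)%:E)%E).
      apply: le_integral_signed => //.
      - exact/measurable_EFinP/measurable_funTS.
      - apply/measurable_EFinP; apply: measurable_funD; first exact: measurable_funTS.
        by apply/measurable_EFinP; exact: measurable_int intk.
    rewrite integralD_integrable//; last exact: measurable_funTS.
    by rewrite leeD2l.
  rewrite muleDr// ?fin_num_adde_defl// -EFinM mulrC mulfK ?gt_eqF//.
apply: (@le_trans _ _ (expeR (mean mu N (fun z => ln (1 / psi z)) x + (ln Lam + K1)%:E))%E).
  by rewrite lee_expeR.
rewrite expeRD; apply: lee_wpmul2l; first exact: expeR_ge0.
rewrite -/(a _) IE -EFinM /= lee_fin expRD lnK ?posrE//.
have -> : r `^ (2 * Q) = r `^ Q * r `^ Q.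
  by rewrite mulrDl !mul1r powRD//; apply/implyP => _; rewrite gt_eqF.
rewrite /Lam.
have -> : expR K1 / c1 * (r `^ Q * r `^ Q)^-1 * I = I / (c1 * r `^ Q * r `^ Q) * expR K1.
  by field; rewrite !gt_eqF.
rewrite ler_pM2r ?expR_gt0// ler_pM2l// lef_pV2 ?posrE ?mulr_gt0//.
by rewrite ler_pM2r.
Qed.

(** * The two-weight inequality and its tail condition *)

Section TwoWeights.
Variables phi psi : G -> R.
Hypothesis phi_pos : positive_function phi.
Hypothesis psi_pos : positive_function psi.

Let W (x : borel G) : \bar R :=
  ((phi x)%:E * expeR (mean mu N (fun z => ln (1 / psi z)) x) *
   ((N x `^ (2 * Q))^-1)%R%:E)%E.

Let psi_measurable : measurable_fun setT (psi : borel G -> R) := psi_pos.1.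
Let phi_measurable : measurable_fun setT (phi : borel G -> R) := phi_pos.1.

Lemma ln_measurable (u : borel G -> R) :
  measurable_fun setT u -> measurable_fun setT (fun z => ln (u z)).
Proof. by move=> mu_; apply: (measurableT_comp (@measurable_ln R)). Qed.

Lemma ln_inv_measurable (u : G -> R) : positive_function u ->
  measurable_fun setT (fun z : borel G => ln (1 / u z)).
Proof.
move=> [mu_ u0]; have -> : (fun z => ln (1 / u z)) = (fun z => - ln (u z)).
  by apply/funext => z; rewrite div1r lnV ?posrE.
by apply: measurable_funN; exact: ln_measurable.
Qed.

Lemma weighted_exp_measurable (u : G -> R) :
  measurable_fun setT (u : borel G -> R) ->
  measurable_fun setT
    (fun x : borel G => (phi x)%:E * expeR (mean mu N u x))%E.
Proof.
move=> mu_; apply: emeasurable_funM; first exact/measurable_EFinP.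
by apply: measurable_expeR_comp; exact: measurable_mean.
Qed.

Lemma weighted_exp_ge0 (u : G -> R) x :
  (0 <= (phi x)%:E * expeR (mean mu N u x))%E.
Proof.
by apply: mule_ge0; [rewrite lee_fin ltW// phi_pos.2|exact: expeR_ge0].
Qed.

Lemma weight_measurable : measurable_fun setT W.
Proof.
apply: emeasurable_funM.
  by apply: weighted_exp_measurable; exact: ln_inv_measurable.
apply/measurable_EFinP.
have -> : (fun x => (N x `^ (2 * Q))^-1) = (fun x => N x `^ (2 * Q) `^ (-1)).
  by apply/funext => z; rewrite powR_inv1// powR_ge0.
apply: (measurableT_comp (@measurable_powR R (-1))).
exact: (measurableT_comp (@measurable_powR R (2 * Q))).
Qed.

Lemma weight_ge0 x : (0 <= W x)%E.
Proof.
apply: mule_ge0; first exact: weighted_exp_ge0.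
by rewrite lee_fin invr_ge0 powR_ge0.
Qed.

Lemma outside_measurable r : measurable ([set x | r <= N x] : set (borel G)).
Proof.
have -> : [set x | r <= N x] = ~` B r.
  by apply/seteqP; split=> x /=; rewrite /quasi_ball/= leNgt => /negP.
by apply: measurableC; exact: quasi_ball_measurable.
Qed.

(** After the pointwise bound and the exchange of integrals, the inner integral over [x] is the tail
    of [W] beyond [N z] with the factor [N z ^ Q], which is the quantity bounded by [A] at radius
    [r = N z]. *)
Lemma exp_mean_inequality (A : R) : 0 <= A ->
  (forall r, 0 < r -> ((r `^ Q)%R%:E *
    \int[mu]_(x in ([set x | (r <= N x)%R] : set (borel G))) W x <= A%:E)%E) ->
  exists2 C : R, 0 < C & forall f : G -> R, positive_function f ->
    (\int[mu]_x ((phi x)%:E * expeR (mean mu N (fun z => ln (f z)) x))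
       <= C%:E * \int[mu]_x (psi x * f x)%R%:E)%E.
Proof.
move=> A0 HA; have [K K0 HK] := exp_mean_ln_le.
(* The added 1 keeps the constant positive when [A = 0]; it also makes the right-hand side infinite
   as soon as the integral of [psi * f] is. *)
exists (K * A + 1) => [|f fp]; first by rewrite ltr_wpDl// mulr_ge0// ltW.
have C0 : 0 < K * A + 1 by rewrite ltr_wpDl// mulr_ge0// ltW.
have [mf f0] := fp; have [mpsi psi0] := psi_pos.
pose g (z : borel G) := psi z * f z.
have mg : measurable_fun setT g by exact: measurable_funM.
have g0 z : 0 < g z by exact: mulr_gt0.
have Ig0 : (0 <= \int[mu]_x (g x)%:E)%E.
  by apply: integral_ge0 => x _; rewrite lee_fin ltW.
have [gfin|] := ltP (\int[mu]_x (g x)%:E)%E +oo%E; last first.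
  rewrite leye_eq => /eqP gy; rewrite -/(g _) gy mulry gtr0_sg// mul1e.
  by rewrite leey.
pose g' (z : borel G) : \bar R := (N z `^ Q * g z)%:E.
have mg' : measurable_fun setT g'.
  apply/measurable_EFinP; apply: measurable_funM => //.
  exact: (measurableT_comp (@measurable_powR R Q)).
have g'0 z : (0 <= g' z)%E by rewrite lee_fin mulr_ge0 ?powR_ge0// ltW.
pose E : set (borel G * borel G) := [set p | 0 < N p.2 < N p.1].
have mE : measurable E.
  have m1 : measurable_fun setT (fun p : borel G * borel G => N p.2 < N p.1).
    by apply: measurable_fun_ltr; apply: measurableT_comp mN _;
      [exact: measurable_snd|exact: measurable_fst].
  have m2 : measurable_fun setT (fun p : borel G * borel G => 0 < N p.2).
    apply: measurable_fun_ltr; first exact: measurable_cst.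
    by apply: measurableT_comp mN _; exact: measurable_snd.
  have := measurable_and m2 m1.
  move=> /(_ measurableT [set true] I); rewrite setTI.
  by congr (measurable _); apply/seteqP; split.
pose H : borel G * borel G -> \bar R := (fun p => W p.1 * g' p.2)%E \_ E.
have mH : measurable_fun setT H.
  apply/(measurable_restrictT _ mE); apply: measurable_funTS.
  apply: emeasurable_funM.
    by apply: measurableT_comp weight_measurable _; exact: measurable_fst.
  by apply: measurableT_comp mg' _; exact: measurable_snd.
have H0 z : (0 <= H z)%E.
  rewrite /H patchE; case: ifP => _; last exact: lexx.
  by apply: mule_ge0; [exact: weight_ge0|exact: g'0].
have inner x : (\int[mu]_z H (x, z) = W x * \int[mu]_(z in D (N x)) g' z)%E.
  rewrite -(ge0_integralZl _ (punctured_ball_measurable _)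
    (measurable_funTS mg') (fun z _ => g'0 z) (weight_ge0 x)).
  rewrite [RHS]integral_mkcond; apply: eq_integral => z _.
  by rewrite /H !patchE !mem_setE.
have outer z : (\int[mu]_x H (x, z) <= A%:E * (g z)%:E)%E.
  have [z0|z0] := ltP 0 (N z); last first.
    rewrite (eq_integral (cst 0%E)) ?integral0 => [|x _].
      by rewrite mule_ge0 ?lee_fin// ltW.
    by rewrite /H patchE memNset// /E/= => /andP[]; rewrite ltNge z0.
  have -> : (\int[mu]_x H (x, z) =
      \int[mu]_(x in [set x | (N z < N x)%R]) (g' z * W x))%E.
    rewrite [RHS]integral_mkcond; apply: eq_integral => x _.
    rewrite /H !patchE; have [zx|zx] := boolP (N z < N x).
      rewrite mem_set; last by rewrite /E/= z0.
      by rewrite mem_set//= muleC.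
    rewrite memNset; last by rewrite /E/= (negbTE zx) andbF.
    by rewrite memNset//=; exact/negP.
  have mzx : measurable ([set x | N z < N x] : set (borel G)).
    have : measurable_fun setT (fun x : borel G => N z < N x).
      by apply: measurable_fun_ltr => //; exact: measurable_cst.
    move=> /(_ measurableT [set true] I); rewrite setTI.
    by congr (measurable _); apply/seteqP; split.
  rewrite (ge0_integralZl _ mzx (measurable_funTS weight_measurable)
    (fun x _ => weight_ge0 x) (g'0 z)).
  rewrite /g' EFinM muleAC; apply: lee_wpmul2r; first by rewrite lee_fin ltW.
  apply: le_trans (HA _ z0); apply: lee_wpmul2l; first by rewrite lee_fin powR_ge0.
  apply: ge0_subset_integral => //.
  - exact: outside_measurable.
  - exact: measurable_funTS weight_measurable.
  - by move=> x _; exact: weight_ge0.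
  - by move=> x /= /ltW.
pose L (x : borel G) : \bar R :=
  ((phi x)%:E * expeR (mean mu N (fun z => ln (f z)) x))%E.
have mL : measurable_fun setT L by apply: weighted_exp_measurable; exact: ln_measurable.
have L0 x : (0 <= L x)%E by exact: weighted_exp_ge0.
pose Z : set (borel G) := [set z | N z = 0%R].
have mZ : measurable Z by exact: gauge_zero_measurable.
have mI : measurable_fun setT (fun x => K%:E * \int[mu]_z H (x, z))%E.
  apply: emeasurable_funM; first exact: measurable_cst.
  exact: (sigma_finite_measurable_section gauge_sigma_finite).
have I0 x : (0 <= K%:E * \int[mu]_z H (x, z))%E.
  by apply: mule_ge0; [rewrite lee_fin ltW|exact: integral_ge0].
(* The pointwise bound needs a ball of positive radius, so the null set [N x = 0] is discarded
   first. *)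
have -> : (\int[mu]_x L x = \int[mu]_(x in setT `\` Z) L x)%E.
  exact: integral_off_zero.
apply: (@le_trans _ _ (\int[mu]_(x in setT `\` Z) (K%:E * \int[mu]_z H (x, z)))%E).
  apply: ge0_le_integral => //.
  - exact: measurableD.
  - exact: measurable_funTS.
  - exact: measurable_funTS.
  move=> x [_ Zx]; have x0 : 0 < N x.
    by rewrite lt_neqAle N_ge0 andbT eq_sym; apply/eqP.
  rewrite inner /L /W.
  have := HK f psi fp psi_pos x x0 gfin.
  move=> /(@lee_wpmul2l _ (phi x)%:E) => /(_ _) HL.
  apply: le_trans (HL _) _; first by rewrite lee_fin ltW// phi_pos.2.
  rewrite le_eqVlt; apply/orP; left; apply/eqP.
  by rewrite EFinM -!muleA [RHS]muleCA [in RHS](muleCA K%:E).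
apply: (@le_trans _ _ (\int[mu]_x (K%:E * \int[mu]_z H (x, z)))%E).
  apply: ge0_subset_integral => //.
  exact: measurableD.
rewrite (ge0_integralZl _ measurableT
  (sigma_finite_measurable_section gauge_sigma_finite mH H0)
  (fun x _ => integral_ge0 mu (fun z _ => H0 (x, z)))); last by rewrite lee_fin ltW.
rewrite (sigma_finite_tonelli gauge_sigma_finite mH H0).
apply: (@le_trans _ _ (K%:E * (A%:E * \int[mu]_z (g z)%:E))%E).
  apply: lee_wpmul2l; first by rewrite lee_fin ltW.
  have mgE : measurable_fun setT (EFin \o g) by exact/measurable_EFinP.
  have gE0 (z : borel G) : setT z -> (0 <= (EFin \o g) z)%E.
    by move=> _; rewrite lee_fin ltW.
  rewrite -(ge0_integralZl _ measurableT mgE gE0); last by rewrite lee_fin.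
  apply: ge0_le_integral => //.
  - by move=> z _; exact: integral_ge0.
  - pose H' (p : borel G * borel G) := H (p.2, p.1).
    have mH' : measurable_fun setT H'.
      apply: (measurableT_comp mH); exact: measurable_swap.
    exact: (sigma_finite_measurable_section gauge_sigma_finite mH'
      (fun p => H0 (p.2, p.1))).
  - apply: emeasurable_funM; first exact: measurable_cst.
    exact/measurable_EFinP.
rewrite muleA -EFinM; apply: lee_wpmul2r => //.
by rewrite lee_fin lerDl.
Qed.

(** On the layer where [Num.max r (N z)] is about [2 ^+ k * r] the integrand is at most
    [q ^+ (2 * k) / r ^ Q], against a volume of order [r ^ Q / q ^+ k]. The powers of [r] cancel,
    which gives uniformity in [r], and the series in [q ^+ k] converges. *)
Lemma gauge_decay_integral : exists2 K : R, 0 < K & forall r, 0 < r ->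
  (\int[mu]_z (r `^ Q / Num.max r (N z) `^ (2 * Q))%:E <= K%:E)%E.
Proof.
have /andP[q0 q1] := dyadic_ratio.
exists (c2 * 2 `^ Q / (1 - q)) => [|r r0].
  by rewrite divr_gt0 ?subr_gt0// !mulr_gt0// powR_gt0.
have rQ : 0 < r `^ Q by exact: powR_gt0.
have mx z : 0 < Num.max r (N z) by rewrite lt_max r0.
have p2 (x : R) : 0 <= x -> x `^ (2 * Q) = x `^ Q * x `^ Q.
  move=> x0; rewrite mulrC powRrM powR_mulrn ?powR_ge0//.
pose b k := (r `^ Q)^-1 * (q ^+ k * q ^+ k).
have b0 k : 0 <= b k by rewrite mulr_ge0 ?invr_ge0 ?mulr_ge0 ?exprn_ge0 ?ltW.
apply: (dyadic_integral_le (A := fun k => B (r * 2 ^+ k.+1)) (b := b)) => //.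
- apply: measurable_funM; first exact: measurable_cst.
  have -> : (fun x => (Num.max r (N x) `^ (2 * Q))^-1) =
    (fun x => Num.max r (N x) `^ (2 * Q) `^ (-1)).
    by apply/funext => z; rewrite powR_inv1// powR_ge0.
  apply: (measurableT_comp (@measurable_powR R (-1))).
  apply: (measurableT_comp (@measurable_powR R (2 * Q))).
  by apply: measurable_maxr => //; exact: measurable_cst.
- by move=> z _; rewrite divr_ge0 ?powR_ge0.
- by rewrite mulr_ge0 ?powR_ge0// ltW.
- exact: dyadic_ratio.
- move=> k.
  have rk : 0 < r * 2 ^+ k.+1 by rewrite mulr_gt0// exprn_gt0.
  apply: (@le_trans _ _ ((b k)%:E * (c2 * (r * 2 ^+ k.+1) `^ Q)%:E)%E).
    apply: lee_wpmul2l; last exact: ball_upper.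
    by rewrite lee_fin mulr_ge0 ?invr_ge0 ?mulr_ge0 ?exprn_ge0 ?ltW.
  rewrite -EFinM lee_fin /b powRM ?exprn_ge0 ?(ltW r0)// powR_exprn//.
  have qE : q = (2 `^ Q)^-1.
    by rewrite /q -powR_inv1// -powRrM mulN1r powRN.
  rewrite qE !exprVn exprS le_eqVlt; apply/orP; left; apply/eqP; field.
  by rewrite !gt_eqF ?exprn_gt0 ?powR_gt0.
move=> z _; have [|k /andP[k1 k2]] := @dyadic_scale R (Num.max r (N z) / r).
  by rewrite ler_pdivlMr// mul1r le_max lexx.
exists k.+1; rewrite big_nat_recr//=.
have S0 : 0 <= \sum_(0 <= i < k) b i * \1_(B (r * 2 ^+ i.+1)) z.
  apply: sumr_ge0 => i _.
  exact: mulr_ge0.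
rewrite ler_wpDl// indicE mem_set ?mulr1; last first.
  rewrite /quasi_ball/= mulrC -ltr_pdivrMr//; apply: le_lt_trans k2.
  by rewrite ler_pM2r ?invr_gt0// le_max lexx orbT.
rewrite ler_pdivlMr// in k1.
rewrite /b p2; last exact: ltW.
have k3 : r `^ Q / q ^+ k <= Num.max r (N z) `^ Q.
  have -> : r `^ Q / q ^+ k = (2 ^+ k * r) `^ Q.
    have qE : q = (2 `^ Q)^-1.
      by rewrite /q -powR_inv1// -powRrM mulN1r powRN.
    by rewrite powRM ?exprn_ge0 ?(ltW r0)// powR_exprn// qE exprVn invrK mulrC.
  by apply: ge0_ler_powR;
    rewrite ?nnegrE ?(ltW Q_gt0) ?mulr_ge0 ?exprn_ge0 ?(ltW r0)// ltW.
have mQ : 0 < Num.max r (N z) `^ Q by exact: powR_gt0.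
have qk : 0 < q ^+ k by exact: exprn_gt0.
rewrite ler_pdivrMr// in k3.
rewrite ler_pdivrMr ?mulr_gt0// -mulrA ler_pdivlMl//.
set m := Num.max _ _ `^ Q in k3 mQ *.
rewrite (_ : q ^+ k * q ^+ k * (m * m) = (m * q ^+ k) * (m * q ^+ k)); last by ring.
by apply: ler_pM => //; exact: ltW.
Qed.

Lemma weight_tail_bound (C : R) : 0 < C ->
  (forall f : G -> R, positive_function f ->
    (\int[mu]_x ((phi x)%:E * expeR (mean mu N (fun z => ln (f z)) x))
       <= C%:E * \int[mu]_x (psi x * f x)%R%:E)%E) ->
  exists A : R, forall r, 0 < r ->
    ((r `^ Q)%R%:E *
     \int[mu]_(x in ([set x | (r <= N x)%R] : set (borel G))) W x <= A%:E)%E.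
Proof.
move=> C0 HC; have [K K0 HK] := gauge_decay_integral.
have [mpsi psi0] := psi_pos.
exists (C * K) => r r0.
(* The maximum removes the singularity at the identity while keeping [g] radially nonincreasing, so
   its infimum over a ball of radius [N x >= r] is controlled at the boundary. *)
pose g z := r `^ Q / Num.max r (N z) `^ (2 * Q).
pose f z := g z / psi z.
have rQ : 0 < r `^ Q by exact: powR_gt0.
have mx z : 0 < Num.max r (N z) by rewrite lt_max r0.
have g0 z : 0 < g z by rewrite divr_gt0// powR_gt0.
have f0 z : 0 < f z by rewrite divr_gt0.
have inv_measurable (u : borel G -> R) : measurable_fun setT u -> (forall z, 0 <= u z) ->
    measurable_fun setT (fun z => (u z)^-1).
  move=> mu_ u0; have -> : (fun z => (u z)^-1) = (fun z => u z `^ (-1)).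
    by apply/funext => z; rewrite powR_inv1.
  exact: (measurableT_comp (@measurable_powR R (-1))).
have mg : measurable_fun setT (g : borel G -> R).
  apply: measurable_funM; first exact: measurable_cst.
  apply: inv_measurable => [|z]; last exact: powR_ge0.
  apply: (measurableT_comp (@measurable_powR R (2 * Q))).
  by apply: measurable_maxr => //; exact: measurable_cst.
have mf : measurable_fun setT (f : borel G -> R).
  apply: measurable_funM => //; apply: inv_measurable => // z; exact: ltW.
have fp : positive_function f by split.
have := HC f fp.
have -> : (\int[mu]_x (psi x * f x)%R%:E = \int[mu]_x (g x)%:E)%E.
  by apply: eq_integral => x _; rewrite /f mulrC divfK// gt_eqF.
move=> H; rewrite EFinM.
apply: (@le_trans _ _ (C%:E * \int[mu]_x (g x)%:E)%E); last first.
  by apply: lee_wpmul2l; [rewrite lee_fin ltW|exact: HK].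
apply: le_trans H.
rewrite -(ge0_integralZl _ (outside_measurable _)
  (measurable_funTS weight_measurable) (fun x _ => weight_ge0 x));
  last by rewrite lee_fin ltW.
have mlf : measurable_fun setT (fun z : borel G => ln (f z)) by exact: ln_measurable.
apply: (@le_trans _ _ (\int[mu]_(x in [set x | (r <= N x)%R])
   ((phi x)%:E * expeR (mean mu N (fun z => ln (f z)) x)))%E); last first.
  apply: ge0_subset_integral => //.
  - exact: outside_measurable.
  - exact: weighted_exp_measurable.
  - by move=> x _; exact: weighted_exp_ge0.
apply: ge0_le_integral.
- exact: outside_measurable.
- by move=> x _; apply: mule_ge0; [rewrite lee_fin ltW|exact: weight_ge0].
- apply: emeasurable_funM; first exact: measurable_cst.
  exact: measurable_funTS weight_measurable.
- exact: measurable_funTS (weighted_exp_measurable _).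
move=> x /= rx; have x0 : 0 < N x by exact: lt_le_trans rx.
rewrite /W -!muleA (muleCA (r `^ Q)%:E); apply: lee_wpmul2l.
  by rewrite lee_fin ltW// phi_pos.2.
have NQ : 0 < N x `^ (2 * Q) by exact: powR_gt0.
(* The lower bound of [g] on the ball of radius [N x]; its logarithm is then carried inside the mean
   as an integrable constant. *)
pose y := r `^ Q / N x `^ (2 * Q).
have y0 : 0 < y by rewrite divr_gt0.
have -> : ((r `^ Q)%:E * (expeR (mean mu N (fun z => ln (1 / psi z)) x) *
    ((N x `^ (2 * Q))^-1)%:E) =
    expeR (mean mu N (fun z => ln (1 / psi z)) x + (ln y)%:E))%E.
  by rewrite expeRD /= lnK ?posrE// muleCA /y EFinM.
rewrite lee_expeR.
have [V [V0 _ _ VE]] := ball_volume_fin x0.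
have mBx : measurable (B (N x)) by exact: quasi_ball_measurable.
have mh := ln_inv_measurable psi_pos.
rewrite !meanE// VE/=.
have -> : (V^-1%:E * \int[mu]_(z in B (N x)) (ln (1 / psi z))%:E + (ln y)%:E =
  V^-1%:E * (\int[mu]_(z in B (N x)) (ln (1 / psi z))%:E + (V * ln y)%:E))%E.
  have E1 : (V^-1%:E * (V * ln y)%:E = (ln y)%:E)%E.
    by rewrite -EFinM mulKf// gt_eqF.
  move: (\int[mu]_(z in _) _)%E => I.
  by rewrite -E1 muleDr// fin_num_adde_defl.
apply: lee_wpmul2l; first by rewrite lee_fin invr_ge0 ltW.
have intcst : mu.-integrable (B (N x)) (EFin \o cst (ln y)).
  apply/integrableP; split; first exact/measurable_EFinP/measurable_cst.
  rewrite (eq_integral (cst `|ln y|%:E)); last by move=> z _.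
  by rewrite integral_cst// VE -EFinM ltry.
have -> : ((V * ln y)%:E = \int[mu]_(z in B (N x)) (cst (ln y) z)%:E)%E.
  by rewrite (integral_cst mu mBx (ln y)%:E) VE -EFinM mulrC.
rewrite -integralD_integrable//; last exact: measurable_funTS.
apply: le_integral_signed => //.
- apply/measurable_EFinP; apply: measurable_funD; last exact: measurable_cst.
  exact: measurable_funTS.
- exact/measurable_EFinP/measurable_funTS.
move=> z zx; rewrite lee_fin /f /g -lnM ?posrE ?divr_gt0//.
rewrite ler_ln ?posrE ?mulr_gt0 ?divr_gt0 ?invr_gt0 ?powR_gt0//.
rewrite div1r mulrC ler_pM2r ?invr_gt0// /y ler_pM2l//.
rewrite lef_pV2 ?posrE ?powR_gt0//.
apply: ge0_ler_powR; rewrite ?nnegrE ?mulr_ge0 ?(ltW Q_gt0) ?(ltW (mx z)) ?(ltW x0)//.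
by rewrite ge_max rx ltW.
Qed.

End TwoWeights.

End GaugeMean.

Unset Implicit Arguments.

Theorem theorem5p1 (R : realType) (n : nat) (n_gt0 : (0 < n)%N)
    (G : homogeneousGroup R n)
    (mu : {measure set (borel G) -> \bar R}) (mu_haar : haar_measure mu)
    (N : G -> R) (N_norm : quasi_norm N)
    (phi psi : G -> R)
    (phi_pos : positive_function phi) (psi_pos : positive_function psi) :
  (exists2 C : R, 0 < C &
    forall f : G -> R, positive_function f ->
      (\int[mu]_x
          ((phi x)%:E * expeR (mean mu N (fun z => ln (f z)) x))
       <= C%:E * \int[mu]_x (psi x * f x)%R%:E)%E)
  <->
  (ereal_sup
     [set ((r `^ homogeneous_dim G)%R%:E *
           \int[mu]_(x in ([set x | (r <= N x)%R] : set (borel G)))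
              ((phi x)%:E * expeR (mean mu N (fun z => ln (1 / psi z)%R) x) *
               ((N x `^ (2 * homogeneous_dim G))^-1)%R%:E))%E
     | r in [set r : R | (0 < r)%R]] < +oo)%E.
Proof.
have [K [a [a_gt0 aQ a_diff]]] := dilation_coords G.
have [[N_cont N_ge0] N_inv N_dil N_eq0] := N_norm.
have dil_cont l : 0 < l -> continuous (@hg_dil _ _ G l).
  by move=> l0; case: (hg_dil_smooth G l0).
have dilM l x y : 0 < l ->
    hg_dil l (x * y)%g = (hg_dil l x * hg_dil l y)%g :> G.
  by move=> l0; exact: hg_dilM.
have [c1 [c2 [c10 c20 volB]]] := ball_volume (@hg_connected _ _ G) (@lg_hausdorff _ _ G)
  a_gt0 dilM dil_cont a_diff mu_haar N_cont N_ge0 N_dil N_eq0.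
rewrite aQ in volB.
(* Positivity of the dimension makes the ratio 2 ^ (-Q) of the dyadic series less than 1 and the
   zero set of [N] null. *)
have Q_gt0 : 0 < homogeneous_dim G.
  rewrite -aQ (bigD1 (Ordinal n_gt0))//= ltr_pwDl//.
  by apply: sumr_ge0 => i _; exact: ltW.
have lowB r (r0 : 0 < r) := (volB r r0).1.
have upB r (r0 : 0 < r) := (volB r r0).2.
have mN := continuous_borel_measurable N_cont.
split.
  move=> [C C0 HC].
  have [A HA] := weight_tail_bound mN N_ge0 Q_gt0 c10 c20 lowB upB phi_pos psi_pos C0 HC.
  apply: (@le_lt_trans _ _ A%:E); last exact: ltry.
  by apply: ge_ereal_sup => _ [r r0 <-]; exact: HA.
set S := [set _ | _ in _] => Soo.
(* Any member of the set bounds the supremum from below, here the one at radius 1; the supremum is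
   then a nonnegative real [A]. *)
have S0 : (0 <= ereal_sup S)%E.
  apply: (@le_trans _ _ ((1 `^ homogeneous_dim G)%R%:E *
           \int[mu]_(x in ([set x | (1 <= N x)%R] : set (borel G)))
              ((phi x)%:E * expeR (mean mu N (fun z => ln (1 / psi z)%R) x) *
               ((N x `^ (2 * homogeneous_dim G))^-1)%R%:E))%E); last first.
    by apply: ereal_sup_ubound; exists 1 => //=; exact: ltr01.
  apply: mule_ge0; first by rewrite lee_fin powR_ge0.
  apply: integral_ge0 => x _.
  exact: weight_ge0.
have [A A0 AE] := lee_fin_exists S0 Soo.
apply: (exp_mean_inequality mN N_ge0 Q_gt0 c10 c20 lowB upB phi_pos psi_pos A0).
by move=> r r0; rewrite -AE; apply: ereal_sup_ubound; exists r.
Qed.
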